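(* Consider fine scale trace regression $\mathcal Q_{1n}=\{\mathbb Q_{1,n,\rho}:\rho\in\Theta\}$ and quantum state tomography with individual measurements $\mathcal Q_{2n}=\{\mathbb Q_{2,n,\rho}:\rho\in\Theta\}$, as defined in the context, and assume conditions (C1), (C2$^*$), (C3) of the context, with fixed integer $\kappa$ and fixed constants $0<c_0\le c_1<1$. Then there is a constant $C$ depending only on $(\kappa,c_0,c_1)$ such that the following hold. (a) (Random design.) $$\Delta(\mathcal Q_{1n},\mathcal Q_{2n})\le n\gamma_p+C\Big(\frac{n\zeta_p}{m}\Big)^{1/2},$$ where $$\gamma_p=\max_{1\le j\le p}\Big[\Big|1-\frac{\Pi(j)}{\Xi(j)}\Big|+\Big|1-\frac{\Xi(j)}{\Pi(j)}\Big|\Big],$$ $$\zeta_p=\max_{\rho\in\Theta}\max\Big\{\sum_{j=1}^p\Pi(j)\,1(|\mathcal I_j(\rho)|\ge2),\ \sum_{j=1}^p\Xi(j)\,1(|\mathcal I_j(\rho)|\ge 2)\Big\}.$$ In particular, if $\Pi(j)=\Xi(j)=1/p$ for $j=1,\dots,p$, then $$\Delta(\mathcal Q_{1n},\mathcal Q_{2n})\le C\Big(\frac{n\zeta_p}{m}\Big)^{1/2},\qquad \zeta_p=\max_{\rho\in\Theta}\Big\{\frac1p\sum_{j=1}^p1(|\mathcal I_j(\rho)|\ge2)\Big\}.$$ (b) (Fixed design.) With the same constant $C$, $$\Delta(\mathcal Q_{1n},\mathcal Q_{2n})\le C\Big(\frac{n\zeta_p}{m}\Big)^{1/2},\qquad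 \zeta_p=\max_{\rho\in\Theta}\Big\{\frac1p\sum_{j=1}^p1(|\mathcal I_j(\rho)|\ge2)\Big\}.$$
   Context: **Matrices.** A density matrix is a $d\times d$ complex Hermitian positive semidefinite matrix with trace $1$; $\Theta$ is a class of $d\times d$ density matrices. $\mathcal B=\{B_1,\dots,B_p\}$ is a set of $p$ distinct Hermitian $d\times d$ matrices with spectral decompositions $B_j=\sum_{a=1}^{r_j}\lambda_{ja}Q_{ja}$, where $\lambda_{j1},\dots,\lambda_{jr_j}$ are the distinct (real) eigenvalues of $B_j$ (in a fixed order) and $Q_{ja}$ is the orthogonal projection onto the eigenspace of $\lambda_{ja}$. For a density matrix $\rho$ let $$\mathcal I_j(\rho)=\{a:\ 0<\mathrm{tr}(Q_{ja}\rho)<1,\ 1\le a\le r_j\},$$ with cardinality $|\mathcal I_j(\rho)|$. **Designs.** $X_1,\dots,X_n$ (matrix inputs of trace regression) and $M_1,\dots,M_n$ (observables of tomography) are taken from $\mathcal B$. Fixed design: $p=n$ and $X_k=M_k=B_k$ for $k=1,\dots,n$. Random design: $X_1,\dots,X_n$ are i.i.d. with $P(X_k=B_j)=\Pi(j)$, and $M_1,\dots,M_n$ are i.i.d. with $P(M_k=B_j)=\Xi(j)$, where $\Pi,\Xi$ are probability distributions on $\{1,\dots,p\}$ with positive weights. **Fine scale trace regression.** Write $X_k=\sum_{a=1}^{r^X_k}\lambda^X_{ka}Q^X_{ka}$ for the spectral decomposition of $X_k$ (so if $X_k=B_j$ then $r_k^X=r_j$, $\lambda^X_{ka}=\lambda_{ja}$,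 $Q^X_{ka}=Q_{ja}$). One observes $$y_{ka}=\mathrm{tr}(Q^X_{ka}\rho)+z_{ka},\qquad k=1,\dots,n,\ a=1,\dots,r^X_k .$$ $\mathbb Q_{1,n,\rho}$ is the joint law of $(X_k,y_{k1},\dots,y_{kr_k^X})_{k\le n}$ (random design) or of $(y_{k1},\dots,y_{kr_k^X})_{k\le n}$ (fixed design). **Quantum state tomography, individual measurements.** For each $k$, given $M_k=B_j$, one has $m$ conditionally i.i.d. outcomes $R_{k1},\dots,R_{km}$ with $P(R_{k\ell}=\lambda_{ja}\mid M_k=B_j)=\mathrm{tr}(Q_{ja}\rho)$, $a=1,\dots,r_j$; data for different $k$ are independent. $\mathbb Q_{2,n,\rho}$ is the joint law of $(M_k,R_{k1},\dots,R_{km})_{k\le n}$ (random design) or of $(R_{k1},\dots,R_{km})_{k\le n}$ (fixed design). **Conditions.** (C1) Each $B_j$ has at most $\kappa$ distinct eigenvalues, $\kappa$ a fixed integer. In the fixed design, $p=n$ and $X_k=M_k=B_k$ for $k=1,\dots,n$. In the random design, $X_1,\dots,X_n$ are i.i.d. from $\mathcal B$ with $P(X_k=B_j)=\Pi(j)$ and $M_1,\dots,M_n$ are i.i.d. from $\mathcal B$ with $P(M_k=B_j)=\Xi(j)$; the quantities $p,d,m,\mathcal B,\Pi,\Xi,\Theta$ may vary with $n$, and $n\gamma_p\to0$ as $n,p\to\infty$. (C2$^*$) Both models are identifiable (the map $\rho\mapsto\mathbb Q_{i,n,\rho}$ is injective on $\Theta$, $i=1,2$). The error vectors $(z_{k1},\dots,z_{kr^X_k})$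 are independent over $k$, and given $X_k$ this vector is (possibly degenerate) multivariate normal with mean zero and, for $a\ne b$, $$\mathrm{Var}(z_{ka}|X_k)=\tfrac1m\mathrm{tr}(Q^X_{ka}\rho)[1-\mathrm{tr}(Q^X_{ka}\rho)],\qquad \mathrm{Cov}(z_{ka},z_{kb}|X_k)=-\tfrac1m\mathrm{tr}(Q^X_{ka}\rho)\,\mathrm{tr}(Q^X_{kb}\rho).$$ (C3) $c_0,c_1$ are fixed with $0<c_0\le c_1<1$, and for every $\rho\in\Theta$, every $j=1,\dots,p$ and every $a\in\mathcal I_j(\rho)$, $c_0\le\mathrm{tr}(Q_{ja}\rho)\le c_1$. **Deficiency distance.** For statistical experiments $\mathcal E_1,\mathcal E_2$ with the same parameter set $\Theta$, let $R_i(\chi_i,L,\rho)$ be the risk at $\rho$ of a (possibly randomized) decision procedure $\chi_i$ in $\mathcal E_i$ under loss $L:\Theta\times\mathcal A\to[0,\infty)$, with $\mathcal A$ a measurable action space, and $\|L\|=\sup L$. Then $$\delta(\mathcal E_1,\mathcal E_2)=\sup_{\chi_2}\inf_{\chi_1}\sup_{\rho\in\Theta}\sup_{L:\|L\|=1}|R_1(\chi_1,L,\rho)-R_2(\chi_2,L,\rho)|$$ (with a supremum over action spaces $\mathcal A$ as well), and $\Delta(\mathcal E_1,\mathcal E_2)=\max\{\delta(\mathcal E_1,\mathcal E_2),\delta(\mathcal E_2,\mathcal E_1)\}$. So $\Delta\le\epsilon$ means every procedure in either experiment has a corresponding procedure in the other whose risk is within $\epsilon$, uniformly over $\rho$ and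 losses bounded by $1$. *)

(* Defs.v *)
From HB Require Import structures.
From mathcomp Require Import all_boot all_order all_algebra.
From mathcomp Require Import sesquilinear spectral.
From mathcomp Require Import all_classical all_reals all_analysis.
From mathcomp.real_closed Require Import complex.

Set Implicit Arguments.
Unset Strict Implicit.
Unset Printing Implicit Defensive.

Import Order.TTheory GRing.Theory Num.Theory.
Import numFieldNormedType.Exports.

Local Open Scope classical_set_scope.
Local Open Scope complex_scope.
Local Open Scope sesquilinear_scope.
Local Open Scope ring_scope.

Definition density_matrix (R : realType) (d : nat) : set 'M[R[i]]_d :=
  [set rho | [/\ rho \is hermsymmx,
                 forall v : 'rV[R[i]]_d, 0 <= (v *m rho *m v^t*) 0 0 &
                 \tr rho = 1]].

(* MathComp subspaces are row spaces, and [eigenspace B x] is the space of the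
   row vectors u with u *m B = x *: u. For Hermitian B and real x these are the
   conjugate transposes of the column eigenvectors, and a Hermitian idempotent Q
   projects on the right onto the row space of Q and on the left onto its
   conjugate transpose: Q is the same matrix under both conventions. *)
Definition orthogonal_projection (R : realType) (d : nat)
    (Q V : 'M[R[i]]_d) : Prop :=
  [/\ Q \is hermsymmx, Q *m Q = Q & (Q == V)%MS].

Definition spectral_decomposition (R : realType) (d r : nat) (B : 'M[R[i]]_d)
    (lam : 'I_r -> R) (Q : 'I_r -> 'M[R[i]]_d) : Prop :=
  [/\ injective lam,
      forall x : R[i], eigenvalue B x <-> exists a, x = (lam a)%:C,
      forall a, orthogonal_projection (Q a) (eigenspace B (lam a)%:C) &
      B = \sum_(a < r) (lam a)%:C *: Q a].

(* The set B = {B_1, ..., B_p} with its spectral decompositions, and the class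
   of states Theta. *)
Record setting (R : realType) (p : nat) := Setting {
  hdim : nat;
  obs : 'I_p -> 'M[R[i]]_hdim;
  nev : 'I_p -> nat;
  ev : forall j : 'I_p, 'I_(nev j) -> R;
  eproj : forall j : 'I_p, 'I_(nev j) -> 'M[R[i]]_hdim;
  states : set 'M[R[i]]_hdim;
  obs_inj : injective obs;
  obs_herm : forall j, obs j \is hermsymmx;
  obs_spectral : forall j, spectral_decomposition (obs j) (@ev j) (@eproj j);
  states_density : states `<=` @density_matrix R hdim }.
Arguments states {R p} s _.

Section outcome_probabilities.
Context {R : realType} {p : nat} (S : setting R p).
Implicit Types (j : 'I_p) (rho : 'M[R[i]]_(hdim S)).

(* tr(Q_ja rho), which is real because both matrices are Hermitian. *)
Definition oprob j (a : 'I_(nev S j)) rho : R :=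
  complex.Re (\tr (eproj a *m rho)).

Definition Iset j rho : {set 'I_(nev S j)} :=
  [set a : 'I_(nev S j) | 0 < oprob a rho < 1]%SET.

Definition nondeg j rho : R := (2 <= #|Iset j rho|)%N%:R.

Definition zeta (Pi Xi : 'I_p -> R) : R :=
  sup [set Num.max (\sum_(j < p) Pi j * nondeg j rho)
                   (\sum_(j < p) Xi j * nondeg j rho) | rho in states S].

Definition zeta_unif : R :=
  sup [set p%:R^-1 * \sum_(j < p) nondeg j rho | rho in states S].

Definition few_eigenvalues (kappa : nat) : Prop :=
  forall j, (nev S j <= kappa)%N.

Definition bounded_probabilities (c0 c1 : R) : Prop :=
  forall rho j a, states S rho -> a \in Iset j rho -> c0 <= oprob a rho <= c1.

End outcome_probabilities.

Definition gamma (R : realType) (p : nat) (Pi Xi : 'I_p -> R) : R :=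
  \big[Num.max/0]_(j < p) (`|1 - Pi j / Xi j| + `|1 - Xi j / Pi j|).

Definition positive_distribution (R : realType) (p : nat) (w : 'I_p -> R) :
    Prop :=
  (forall j, 0 < w j) /\ \sum_(j < p) w j = 1.

Definition fin_prod_display : measure_display -> measure_display.
Proof. exact. Qed.

Section fin_prod.
Context {d : measure_display} {n : nat} (T : 'I_n -> measurableType d).

Definition fin_prod : Type := forall k, T k.

HB.instance Definition _ := Pointed.copy fin_prod (forall k, T k).

Definition fin_prod_measurable : set (set fin_prod) :=
  <<s \bigcup_(k in [set: 'I_n])
        preimage_set_system setT (fun x : fin_prod => x k) measurable >>.

Let fin_prod0 : fin_prod_measurable set0.
Proof. exact: sigma_algebra0. Qed.

Let fin_prodC A : fin_prod_measurable A -> fin_prod_measurable (~` A).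
Proof. exact: sigma_algebraC. Qed.

Let fin_prod_bigcup (F : (set fin_prod)^nat) :
  (forall i, fin_prod_measurable (F i)) ->
  fin_prod_measurable (\bigcup_i F i).
Proof. exact: sigma_algebra_bigcup. Qed.

HB.instance Definition _ := @isMeasurable.Build (fin_prod_display d)
  fin_prod fin_prod_measurable fin_prod0 fin_prodC fin_prod_bigcup.

End fin_prod.

(* Disjoint union of the T j, with at least one summand because measurable
   types are pointed. A point is a pair (j, x) with x in T j; when the tag j is
   the index of an observable, it stands for the matrix B_j (j |-> B_j is
   injective). *)
Definition tagged_display : measure_display -> measure_display.
Proof. exact. Qed.

Section tagged.
Context {d : measure_display} {q : nat} (T : 'I_q.+1 -> measurableType d).

Definition tagged_space : Type := {j : 'I_q.+1 & T j}.

Definition tag_in (j : 'I_q.+1) (x : T j) : tagged_space :=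
  existT (fun i => T i : Type) j x.

HB.instance Definition _ :=
  Choice.copy tagged_space {j : 'I_q.+1 & (T j : choiceType)}.
HB.instance Definition _ := isPointed.Build tagged_space (@tag_in ord0 point).

Definition tagged_measurable : set (set tagged_space) :=
  [set A | forall j, measurable (@tag_in j @^-1` A)].

Let tagged0 : tagged_measurable set0.
Proof. by move=> j; rewrite preimage_set0. Qed.

Let taggedC A : tagged_measurable A -> tagged_measurable (~` A).
Proof. by move=> mA j; rewrite preimage_setC; apply: measurableC; exact: mA. Qed.

Let tagged_bigcup (F : (set tagged_space)^nat) :
  (forall i, tagged_measurable (F i)) -> tagged_measurable (\bigcup_i F i).
Proof.
by move=> mF j; rewrite preimage_bigcup; apply: bigcup_measurable => k _; exact: mF.
Qed.

HB.instance Definition _ := @isMeasurable.Build (tagged_display d)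
  tagged_space tagged_measurable tagged0 taggedC tagged_bigcup.

End tagged.

Definition rvec (R : realType) (r : nat) :=
  fin_prod (fun _ : 'I_r => measurableTypeR R).

Section laws.
Local Open Scope ereal_scope.
Context {R : realType}.

(* The coordinates are independent with marginals P k. *)
Definition product_law d n (T : 'I_n -> measurableType d)
    (P : forall k, probability (T k) R) (Q : probability (fin_prod T) R) : Prop :=
  forall A : forall k, set (T k), (forall k, measurable (A k)) ->
    Q [set x | forall k, A k (x k)] = \prod_(k < n) P k (A k).

(* The tag is j with probability w j, and given the tag j the second component
   has law P j. *)
Definition mixture_law d q (T : 'I_q.+1 -> measurableType d)
    (w : 'I_q.+1 -> R) (P : forall j, probability (T j) R)
    (Q : probability (tagged_space T) R) : Prop :=
  forall j (A : set (T j)), measurable A ->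
    Q (@tag_in _ _ T j @` A) = (w j)%:E * P j A.

(* [normal_prob m s] takes the standard deviation s and is the uniform law on
   [0, 1] when s = 0, hence the case distinction. *)
Definition normal_law (m v : R) (A : set (measurableTypeR R)) : \bar R :=
  if v == 0%R then \d_m A else normal_prob m (Num.sqrt v) A.

(* Possibly degenerate: every linear combination of the coordinates is
   univariate normal with the corresponding mean and variance. *)
Definition multivariate_normal r (mu : 'I_r -> R) (Sigma : 'M[R]_r)
    (N : set (rvec R r) -> \bar R) : Prop :=
  forall (t : 'I_r -> R) (A : set (measurableTypeR R)), measurable A ->
    N [set z : rvec R r | A (\sum_(a < r) t a * z a)%R] =
    normal_law (\sum_(a < r) t a * mu a)%R
               (\sum_(a < r) \sum_(b < r) t a * t b * Sigma a b)%R A.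

End laws.

Section experiments.
Context {R : realType} {p : nat} (S : setting R p) (m : nat).
Implicit Types (j : 'I_p) (rho : 'M[R[i]]_(hdim S)).

Definition noise_cov j rho : 'M[R]_(nev S j) :=
  \matrix_(a, b) (if a == b then m%:R^-1 * (oprob a rho * (1 - oprob a rho))
                  else - (m%:R^-1 * (oprob a rho * oprob b rho))).

(* Law of (y_ka)_a given X_k = B_j: the noise z_ka = y_ka - tr(Q_ja rho) is
   centred normal. *)
Definition regression_law j rho (P : probability (rvec R (nev S j)) R) : Prop :=
  multivariate_normal (fun=> 0) (noise_cov j rho)
    (pushforward P (fun y : rvec R (nev S j) =>
       (fun a => y a - oprob a rho) : rvec R (nev S j))).

(* Law of (R_k1, ..., R_km) given M_k = B_j. *)
Definition tomography_law j rho (P : probability (rvec R m) R) : Prop :=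
  exists mu : probability (measurableTypeR R) R,
    (forall a : 'I_(nev S j), mu [set ev a] = (oprob a rho)%:E) /\
    product_law (fun _ : 'I_m => mu) P.

End experiments.
Arguments regression_law {R p} S m j rho P.
Arguments tomography_law {R p} S m j rho P.

Section random_design.
Context {R : realType} {q : nat} (S : setting R q.+1) (m n : nat).
Variable w : 'I_q.+1 -> R.

Definition random_regression_space :=
  fin_prod (fun _ : 'I_n => tagged_space (fun j : 'I_q.+1 => rvec R (nev S j))).

Definition random_tomography_space :=
  fin_prod (fun _ : 'I_n => tagged_space (fun _ : 'I_q.+1 => rvec R m)).

Definition random_regression (rho : 'M[R[i]]_(hdim S))
    (Q : probability random_regression_space R) : Prop :=
  exists (P : forall j, probability (rvec R (nev S j)) R)
         (M : probability (tagged_space (fun j => rvec R (nev S j))) R),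
    [/\ forall j, regression_law S m j rho (P j),
        mixture_law w P M & product_law (fun _ : 'I_n => M) Q].

Definition random_tomography (rho : 'M[R[i]]_(hdim S))
    (Q : probability random_tomography_space R) : Prop :=
  exists (P : 'I_q.+1 -> probability (rvec R m) R)
         (M : probability (tagged_space (fun _ : 'I_q.+1 => rvec R m)) R),
    [/\ forall j, tomography_law S m j rho (P j),
        mixture_law w P M & product_law (fun _ : 'I_n => M) Q].

End random_design.
Arguments random_regression {R q} S m n w rho Q.
Arguments random_tomography {R q} S m n w rho Q.
Arguments random_tomography_space R q m n : clear implicits.

Section fixed_design.
Context {R : realType} {n : nat} (S : setting R n) (m : nat).

Definition fixed_regression_space :=
  fin_prod (fun k : 'I_n => rvec R (nev S k)).

Definition fixed_tomography_space := fin_prod (fun _ : 'I_n => rvec R m).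

Definition fixed_regression (rho : 'M[R[i]]_(hdim S))
    (Q : probability fixed_regression_space R) : Prop :=
  exists P : forall k, probability (rvec R (nev S k)) R,
    (forall k, regression_law S m k rho (P k)) /\ product_law P Q.

Definition fixed_tomography (rho : 'M[R[i]]_(hdim S))
    (Q : probability fixed_tomography_space R) : Prop :=
  exists P : 'I_n -> probability (rvec R m) R,
    (forall k, tomography_law S m k rho (P k)) /\ product_law P Q.

End fixed_design.
Arguments fixed_regression {R n} S m rho Q.
Arguments fixed_tomography {R n} S m rho Q.
Arguments fixed_tomography_space R n m : clear implicits.

Section deficiency.
Local Open Scope ereal_scope.
Context {R : realType} {param : Type} (Theta : set param).

Definition identifiable d (X : measurableType d) (Q : param -> probability X R) :
    Prop :=
  forall rho rho', Theta rho -> Theta rho' ->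
    (forall A, measurable A -> Q rho A = Q rho' A) -> rho = rho'.

Definition unit_loss d (A : measurableType d) (L : param -> A -> R) : Prop :=
  [/\ forall rho a, Theta rho -> (0 <= L rho a)%R,
      forall rho, Theta rho -> measurable_fun [set: A] (L rho) &
      ereal_sup [set (L rho a)%:E | rho in Theta & a in [set: A]] = 1].

(* Randomized procedures are Markov kernels from the sample space to the
   action space. *)
Definition risk dX (X : measurableType dX) dA (A : measurableType dA)
    (Q : param -> probability X R) (chi : R.-pker X ~> A)
    (L : param -> A -> R) (rho : param) : \bar R :=
  \int[Q rho]_x \int[chi x]_a (L rho a)%:E.

Definition deficiency d1 (X1 : measurableType d1) d2 (X2 : measurableType d2)
    (Q1 : param -> probability X1 R) (Q2 : param -> probability X2 R) : \bar R :=
  ereal_sup [set e | exists dA (A : measurableType dA) (chi2 : R.-pker X2 ~> A),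
    e = ereal_inf [set f | exists chi1 : R.-pker X1 ~> A,
      f = ereal_sup [set g | exists rho (L : param -> A -> R),
        [/\ Theta rho, unit_loss L &
            g = `|risk Q1 chi1 L rho - risk Q2 chi2 L rho|]]]].

Definition Delta d1 (X1 : measurableType d1) d2 (X2 : measurableType d2)
    (Q1 : param -> probability X1 R) (Q2 : param -> probability X2 R) : \bar R :=
  Order.max (deficiency Q1 Q2) (deficiency Q2 Q1).

End deficiency.

(* Main.v *)
(* Given the observable, the outcome counts are sufficient in tomography.  Adding
   independent uniform noise on [0, 1) to the positive counts, one of which is
   adjusted to keep the total fixed, gives a vector whose law is compared with the
   normal law of the regression errors: by Stirling's formula the quadratic terms
   of the multinomial probabilities cancel those of the normal density, and the
   remaining terms have mean O(1/m) because positive cell probabilities are at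
   least c0.  So the relative entropy is O(1/m).  It is 0 when |I_j(rho)| <= 1,
   both observations being then deterministic.  Relative entropies add up over
   independent observations and average over mixtures, hence are at most
   C n zeta / m in total, and Pinsker's inequality gives (n zeta / m)^(1/2).

   Conversely, when all counts with positive probability are large, which fails
   with probability O(1/m), the smoothed vector determines the counts, and a
   uniformly shuffled sequence with these counts has the law of the outcomes.  The
   total error O(n zeta / m) is absorbed in (n zeta / m)^(1/2) since Delta <= 1.
   In the random design, exchanging Pi for Xi costs gamma per observation. *)
Require Import Defs.
From HB Require Import structures.
From mathcomp Require Import all_boot all_order all_algebra.
From mathcomp Require Import fingroup perm sesquilinear spectral.
From mathcomp Require Import all_classical all_reals all_analysis.
From mathcomp.real_closed Require Import complex.
From mathcomp Require Import measurable_realfun ring lra.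

Set Implicit Arguments.
Unset Strict Implicit.
Unset Printing Implicit Defensive.

Import Order.TTheory GRing.Theory Num.Theory.
Import numFieldNormedType.Exports.

Local Open Scope classical_set_scope.
Local Open Scope ring_scope.

(** The randomizations must not depend on rho, although the set of possible outcomes does. Hence the
    adjusted count is the first positive one, read off from the data; once all possible outcomes
    have large counts it belongs to the first possible outcome, the coordinate that the analysis
    eliminates from the normal law, which is degenerate because its entries sum to 1.

    The entropy is that of the smoothed counts relative to the normal law, so the normal law only
    has to be bounded below on unit cells. It is known through its linear forms alone; passing to
    the residuals of successive regressions, independent normals by the Cramer-Wold theorem, gives
    this bound one coordinate at a time, with no change of variables in several dimensions.

    The rate 1/m rather than m^(-1/2) comes from averaging the log-likelihood ratio: the third
    central moment of a binomial count is linear in m, and the terms linear in the noise have mean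
    0.

    For the way back, regression data are replaced by smoothed counts at the cost already found, so
    only the round trip of the outcomes remains to be examined. *)

HB.lock Definition Ex {R : realType} {d : measure_display} {X : measurableType d}
  (P : probability X R) (f : X -> R) : R := \int[P]_x f x.

(** * Expectations of bounded functions and product laws *)

Section bounded_expectation.
Context {R : realType} {d : measure_display} {X : measurableType d}.
Implicit Types (P : probability X R) (f g : X -> R).

(** Bounded measurable functions are integrable under every probability law and stable under the
    operations below, so computations with [Ex] leave no integrability conditions behind. *)
Definition bmf f := measurable_fun [set: X] f /\ exists M : R, forall x, `|f x| <= M.

Lemma bmf_integrable P f : bmf f -> P.-integrable [set: X] (EFin \o f).
Proof.
move=> [mf [M fM]]; apply: measurable_bounded_integrable => //.
  by rewrite (le_lt_trans (probability_le1 _ _)) ?ltry.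
exists M; split; first exact: num_real.
by move=> y My x _; exact: le_trans (fM x) (ltW My).
Qed.

Lemma bmf_cst c : bmf (fun=> c).
Proof. by split; [exact: measurable_cst|exists `|c|]. Qed.

Lemma bmfD f g : bmf f -> bmf g -> bmf (fun x => f x + g x).
Proof.
move=> [mf [M fM]] [mg [N gN]]; split; first exact: measurable_funD.
by exists (M + N) => x; rewrite (le_trans (ler_normD _ _)) ?lerD.
Qed.

Lemma bmfN f : bmf f -> bmf (fun x => - f x).
Proof.
move=> [mf [M fM]]; split; first exact: measurableT_comp.
by exists M => x; rewrite normrN.
Qed.

Lemma bmfB f g : bmf f -> bmf g -> bmf (fun x => f x - g x).
Proof. by move=> bf bg; exact/bmfD/bmfN. Qed.

Lemma bmfM f g : bmf f -> bmf g -> bmf (fun x => f x * g x).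
Proof.
move=> [mf [M fM]] [mg [N gN]]; split; first exact: measurable_funM.
by exists (M * N) => x; rewrite normrM ler_pM.
Qed.

Lemma bmfZ c f : bmf f -> bmf (fun x => c * f x).
Proof. by move=> bf; apply: bmfM => //; exact: bmf_cst. Qed.

Lemma bmf_sum I (s : seq I) (p : pred I) (F : I -> X -> R) :
  (forall i, p i -> bmf (F i)) -> bmf (fun x => \sum_(i <- s | p i) F i x).
Proof.
move=> bF; elim: s => [|i s IH].
  by under eq_fun do rewrite big_nil; exact: bmf_cst.
under eq_fun do rewrite big_cons.
case: (boolP (p i)) => // pi; exact: bmfD (bF _ pi) IH.
Qed.

Lemma bmf_prod I (s : seq I) (p : pred I) (F : I -> X -> R) :
  (forall i, p i -> bmf (F i)) -> bmf (fun x => \prod_(i <- s | p i) F i x).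
Proof.
move=> bF; elim: s => [|i s IH].
  by under eq_fun do rewrite big_nil; exact: bmf_cst.
under eq_fun do rewrite big_cons.
case: (boolP (p i)) => // pi; exact: bmfM (bF _ pi) IH.
Qed.

Lemma bmf_itv f a b : measurable_fun setT f -> (forall x, a <= f x <= b) -> bmf f.
Proof.
move=> mf fab; split => //; exists (Num.max `|a| `|b|) => x.
have /andP[afx fxb] := fab x.
rewrite ler_norml; apply/andP; split.
  by rewrite lerNl le_max -[`|a|]normrN (le_trans _ (ler_norm _)) ?lerN2.
by rewrite le_max (le_trans fxb (ler_norm _)) orbT.
Qed.

Lemma bmf_indic A : measurable A -> bmf (\1_A : X -> R).
Proof.
move=> mA; apply: (@bmf_itv _ 0 1); first exact: measurable_indic.
by move=> x; rewrite indicE; case: (_ \in _); rewrite /= ?lexx ler01.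
Qed.

Lemma Ex_cst P c : Ex P (fun=> c) = c.
Proof. by rewrite unlock Rintegral_cst//= (@probability_setT _ _ _ P) mulr1. Qed.

Lemma ExD P f g : bmf f -> bmf g -> Ex P (fun x => f x + g x) = Ex P f + Ex P g.
Proof. by move=> bf bg; rewrite unlock RintegralD//; exact: bmf_integrable. Qed.

Lemma ExZ P c f : bmf f -> Ex P (fun x => c * f x) = c * Ex P f.
Proof. by move=> bf; rewrite unlock RintegralZl//; exact: bmf_integrable. Qed.

Lemma ExN P f : bmf f -> Ex P (fun x => - f x) = - Ex P f.
Proof.
move=> bf; rewrite -mulN1r -ExZ// unlock; apply: eq_Rintegral => x _.
by rewrite mulN1r.
Qed.

Lemma ExB P f g : bmf f -> bmf g -> Ex P (fun x => f x - g x) = Ex P f - Ex P g.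
Proof. by move=> bf bg; rewrite ExD ?ExN//; exact: bmfN. Qed.

Lemma eq_Ex P f g : f =1 g -> Ex P f = Ex P g.
Proof. by move=> fg; rewrite unlock; apply: eq_Rintegral => x _. Qed.

Lemma le_Ex P f g : bmf f -> bmf g -> (forall x, f x <= g x) -> Ex P f <= Ex P g.
Proof. by move=> bf bg fg; rewrite unlock; apply: le_Rintegral => //; exact: bmf_integrable. Qed.

Lemma Ex_ge0 P f : (forall x, 0 <= f x) -> 0 <= Ex P f.
Proof. by move=> f0; rewrite unlock; apply: Rintegral_ge0. Qed.

Lemma Ex_ge P c f : bmf f -> (forall x, c <= f x) -> c <= Ex P f.
Proof. by move=> bf cf; rewrite -(Ex_cst P c); apply: le_Ex => //; exact: bmf_cst. Qed.

Lemma Ex_le P c f : bmf f -> (forall x, f x <= c) -> Ex P f <= c.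
Proof. by move=> bf cf; rewrite -[leRHS](Ex_cst P c); apply: le_Ex => //; exact: bmf_cst. Qed.

Lemma Ex_sum P I (s : seq I) (p : pred I) (F : I -> X -> R) :
  (forall i, p i -> bmf (F i)) ->
  Ex P (fun x => \sum_(i <- s | p i) F i x) = \sum_(i <- s | p i) Ex P (F i).
Proof.
move=> bF; elim: s => [|i s IH].
  by rewrite big_nil -[RHS](Ex_cst P); apply: eq_Ex => x; rewrite big_nil.
rewrite big_cons -IH; case: ifPn => pi.
  rewrite -ExD; [|exact: bF|exact: bmf_sum].
  by apply: eq_Ex => x; rewrite big_cons pi.
by apply: eq_Ex => x; rewrite big_cons (negbTE pi).
Qed.

Lemma Ex_indic P A : measurable A -> Ex P \1_A = fine (P A).
Proof. by move=> mA; rewrite unlock /Rintegral integral_indic// setIT. Qed.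

Lemma EFin_Ex P f : bmf f -> ((Ex P f)%:E = \int[P]_x (f x)%:E)%E.
Proof.
by move=> bf; rewrite unlock /Rintegral fineK//; apply: integrable_fin_num => //;
  exact: bmf_integrable.
Qed.

Lemma eq_measure_Ex P P' f : (forall A, measurable A -> P A = P' A) ->
  Ex P f = Ex P' f.
Proof.
move=> PP'; rewrite unlock; congr fine; apply: eq_measure_integral => A mA _; exact: PP'.
Qed.

Lemma Ex_cvg P (f_ : nat -> X -> R) f (M : R) :
  (forall n, measurable_fun setT (f_ n)) -> (forall n x, `|f_ n x| <= M) ->
  (forall x, f_ n x @[n --> \oo] --> f x) ->
  bmf f /\ Ex P (f_ n) @[n --> \oo] --> Ex P f.
Proof.
move=> mf_ f_M f_f.
have mf : measurable_fun setT f by apply: (measurable_fun_cvg mf_) => x _; exact: f_f.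
have bf : bmf f.
  split => //; exists M => x.
  have c : `|f_ n x| @[n --> \oo] --> `|f x| by apply: cvg_norm; exact: f_f.
  rewrite -(cvg_lim _ c)//; apply: limr_le; first exact: cvgP c.
  by apply: nearW => n; exact: f_M.
split => //.
have M0 : 0 <= M.
  by rewrite (le_trans (normr_ge0 _) (f_M 0%N point)).
have [] := @dominated_convergence _ X R P setT measurableT
  (fun n => EFin \o f_ n) (EFin \o f) (fun=> M%:E) _ _ _ _ _.
- by move=> n; exact/measurable_EFinP.
- exact/measurable_EFinP.
- by apply/aeW => x _; apply: cvg_EFin; [exact: nearW|exact: f_f].
- by apply: bmf_integrable; exact: bmf_cst.
- by apply: aeW => x n _; rewrite /= lee_fin.
move=> _ _ /=.
by rewrite -EFin_Ex// unlock => /fine_cvgP[].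
Qed.

End bounded_expectation.

Lemma measurableT_fun {d d' : measure_display} {X : measurableType d}
  {Y : measurableType d'} (f : X -> Y) :
  (forall A, measurable A -> measurable (f @^-1` A)) -> measurable_fun setT f.
Proof. by move=> h _ A mA; rewrite setTI; exact: h. Qed.

Section pushforward_probability.
Context {R : realType} {d d' : measure_display} {X : measurableType d}
  {Y : measurableType d'}.
Variables (P : probability X R) (phi : X -> Y).
Hypothesis mphi : measurable_fun [set: X] phi.

Definition push : probability Y R :=
  distribution P (HB.pack_for {mfun X >-> Y} phi (isMeasurableFun.Build _ _ _ _ phi mphi)).

Lemma pushE A : push A = P (phi @^-1` A).
Proof. by []. Qed.

Lemma bmf_comp (f : Y -> R) : bmf f -> bmf (f \o phi).
Proof.
by move=> [mf [M fM]]; split; [exact: measurableT_comp|exists M => x /=].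
Qed.

Lemma Ex_push f : bmf f -> Ex push f = Ex P (f \o phi).
Proof.
move=> bf; apply: EFin_inj; rewrite !EFin_Ex//; last exact: bmf_comp.
rewrite integral_pushforward//; first by apply/measurable_EFinP; case: bf.
by apply: bmf_integrable; exact: bmf_comp.
Qed.

End pushforward_probability.

Section product.
Context {R : realType} {d d' : measure_display} {X : measurableType d}
  {Y : measurableType d'}.
Variables (P : probability X R) (Q : probability Y R).

Let pT : (P \x Q)%E [set: X * Y] = 1%E.
Proof.
have -> : [set: X * Y] = [set: X] `*` [set: Y] by rewrite setXTT.
rewrite product_measure1E//.
by rewrite [X in (X * _)%E]probability_setT [X in (_ * X)%E]probability_setT mule1.
Qed.

HB.instance Definition _ := @Measure_isProbability.Build _ _ R
  (P \x Q)%E pT.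

Definition pprod : probability (X * Y)%type R := (P \x Q)%E.

End product.

Section fubini_bounded.
Context {R : realType} {d d' : measure_display} {X : measurableType d}
  {Y : measurableType d'}.

Lemma bmf_snd (f : X * Y -> R) x : bmf f -> bmf (fun y => f (x, y)).
Proof. by move=> bf; exact: bmf_comp (pair1_measurable x) _ bf. Qed.

Lemma bmf_Ex_snd (Q : probability Y R) (f : X * Y -> R) : bmf f -> bmf (fun x => Ex Q (fun y => f (x, y))).
Proof.
move=> bf; have [mf [M fM]] := bf; split.
  (* Measurability of a partial integral is obtained from Fubini's theorem, which wants a measure on
     the first factor; any probability serves. *)
  pose P : probability X R := \d_(point : X).
  rewrite unlock; apply: measurableT_comp => //.
  apply: (@measurable_fubini_F _ _ _ _ _ P Q (EFin \o f)).
  exact: (@bmf_integrable _ _ _ (pprod P Q)).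
exists M => x; rewrite ler_norml; apply/andP; split.
  by apply: Ex_ge; [exact: bmf_snd|move=> y; have := fM (x, y); rewrite ler_norml => /andP[]].
by apply: Ex_le; [exact: bmf_snd|move=> y; have := fM (x, y); rewrite ler_norml => /andP[]].
Qed.

Lemma Ex_prod (P : probability X R) (Q : probability Y R) (f : X * Y -> R) : bmf f ->
  Ex (pprod P Q) f = Ex P (fun x => Ex Q (fun y => f (x, y))).
Proof.
move=> bf; apply: EFin_inj; rewrite !EFin_Ex//; last exact: bmf_Ex_snd.
rewrite -integral12_prod_meas1//=; last exact: (@bmf_integrable _ _ _ (pprod P Q)).
by apply: eq_integral => x _; rewrite EFin_Ex//; exact: bmf_snd.
Qed.

End fubini_bounded.

Lemma probability_unique {R : realType} {d : measure_display} {X : measurableType d}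
    (C : set (set X)) (P Q : probability X R) :
  @measurable d X `<=` <<s C >> -> C `<=` measurable -> setI_closed C ->
  (forall A, C A -> P A = Q A) -> forall A, measurable A -> P A = Q A.
Proof.
move=> mC Cm CI PQ A mA.
(* [C] need not contain the whole space; adjoining it provides the cover by sets of finite measure
   that uniqueness of measures asks for. *)
apply: (measure_unique (C `|` [set setT]) (fun=> setT)) => //.
- apply/seteqP; split => [B mB|].
    by apply: (sub_smallest2r _ _ (mC _ mB)); [exact: smallest_sigma_algebra|left].
  apply: smallest_sub; first exact: sigma_algebra_measurable.
  by move=> B [/Cm//|->].
- move=> B D [CB|->] [CD|->]; rewrite ?setIT ?setTI; [left; exact: CI|by left|by left|by right].
- by move=> _; right.
- by rewrite bigcup_const.
- by move=> B [/PQ//|->]; rewrite [LHS]probability_setT [RHS]probability_setT.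
- by move=> _; rewrite [X in (X < _)%E]probability_setT ltry.
Qed.

Section dependent_cons.
Context {n : nat} {T : 'I_n.+1 -> Type}.

(** The type of an entry varies with its index, hence the transports; equality proofs between
    ordinals are unique, so they disappear at [ord0] and at lifted indices. *)
Definition dcons (x0 : T ord0) (y : forall k, T (lift ord0 k)) : forall k, T k :=
  fun k => match unliftP ord0 k with
  | UnliftSome j e => eq_rect_r T (y j) e
  | UnliftNone e => eq_rect_r T x0 e
  end.

Lemma dcons0 x0 y : dcons x0 y ord0 = x0.
Proof.
rewrite /dcons; case: unliftP => [j e|e]; first by have /eqP := neq_lift ord0 j.
by rewrite (eq_irrelevance e erefl).
Qed.

Lemma dconsS x0 y k : dcons x0 y (lift ord0 k) = y k.
Proof.
rewrite /dcons; case: unliftP => [j e|e]; last first.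
  by case: (elimN eqP (neq_lift ord0 k) (esym e)).
have kj := lift_inj e; case: _ / kj e => e.
by rewrite (eq_irrelevance e erefl).
Qed.

Lemma forall_ord_recl (A : 'I_n.+1 -> Prop) :
  (forall k, A k) <-> A ord0 /\ forall k, A (lift ord0 k).
Proof.
split=> [h|[h0 h] k]; first by split.
by case: (unliftP ord0 k) => [j ->|->].
Qed.

Lemma dcons_eta (x : forall k, T k) : dcons (x ord0) (fun k => x (lift ord0 k)) = x.
Proof.
apply/functional_extensionality_dep => k.
by case: (unliftP ord0 k) => [j ->|->]; rewrite ?dcons0 ?dconsS.
Qed.

End dependent_cons.

Section fin_prod_measurability.
Context {d : measure_display} {n : nat} {T : 'I_n -> measurableType d}.

Lemma measurable_coord k : measurable_fun [set: fin_prod T] (fun x : fin_prod T => x k).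
Proof.
move=> _ A mA; apply: sub_sigma_algebra; exists k => //.
by exists A.
Qed.

Lemma measurable_fun_fin_prod {d' : measure_display} {X : measurableType d'} (f : X -> fin_prod T) :
  (forall k, measurable_fun [set: X] (fun x => f x k)) -> measurable_fun [set: X] f.
Proof.
move=> mf; apply: measurableT_fun.
suff : fin_prod_measurable (T := T) `<=` [set A | measurable (f @^-1` A)] by [].
apply: smallest_sub.
  split => /=; first by rewrite preimage_set0.
  - by move=> A mA; rewrite setTD preimage_setC; exact: measurableC.
  - by move=> F mF; rewrite preimage_bigcup; exact: bigcup_measurable.
move=> _ [k _ [A mA <-]] /=; rewrite setTI.
by have := mf k measurableT A mA; rewrite setTI.
Qed.

Lemma measurable_box (A : forall k, set (T k)) : (forall k, measurable (A k)) ->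
  measurable [set x : fin_prod T | forall k, A k (x k)].
Proof.
move=> mA; rewrite (_ : [set _ | _] = \bigcap_(k in [set: 'I_n]) ((fun x : fin_prod T => x k) @^-1` A k)).
  apply: fin_bigcap_measurable => // k _.
  by have := measurable_coord (measurableT) (mA k); rewrite setTI.
by apply/seteqP; split => x /= h k; [move=> _; exact: h|exact: (h k I)].
Qed.

End fin_prod_measurability.

Section product_laws.
Context {R : realType} {d : measure_display}.

Lemma product_law_unique n (T : 'I_n -> measurableType d)
    (P : forall k, probability (T k) R) (Q Q' : probability (fin_prod T) R) :
  product_law P Q -> product_law P Q' -> forall A, measurable A -> Q A = Q' A.
Proof.
move=> PQ PQ'.
apply: (@probability_unique _ _ _
  [set B | exists2 A : forall k, set (T k), (forall k, measurable (A k)) &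
     B = [set x : fin_prod T | forall k, A k (x k)]]).
- suff : fin_prod_measurable (T := T) `<=`
     <<s [set B | exists2 A : forall k, set (T k), (forall k, measurable (A k)) &
     B = [set x : fin_prod T | forall k, A k (x k)]]>> by [].
  apply: smallest_sub; first exact: smallest_sigma_algebra.
  move=> _ [k _ [A mA <-]]; rewrite setTI; apply: sub_sigma_algebra => /=.
  pose B j : set (T j) := match pselect (k = j) with
     | left e => eq_rect k (fun i => set (T i)) A j e | right _ => setT end.
  exists B => [j|].
    by rewrite /B; case: pselect => // e; case: _ / e.
  apply/seteqP; split=> [x /= xA j|x /= /(_ k)]; rewrite /B; case: pselect => // e.
    by case: _ / e.
  by rewrite (eq_irrelevance e erefl).
- by move=> _ [A mA ->]; exact: measurable_box.
- move=> _ _ [A mA ->] [B mB ->]; exists (fun k => A k `&` B k).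
    by move=> k; exact: measurableI.
  by apply/seteqP; split => x /= => [[? ?] k|h]; split => // k; have [] := h k.
- by move=> _ [A mA ->]; rewrite PQ// PQ'.
Qed.

Section cons.
Context {n : nat} {T : 'I_n.+1 -> measurableType d}.
Let T' k := T (lift ord0 k).

Definition fcons (z : T ord0 * fin_prod T') : fin_prod T := dcons z.1 z.2.

Lemma measurable_fcons : measurable_fun setT fcons.
Proof.
apply: measurable_fun_fin_prod => k; rewrite /fcons.
case: (unliftP ord0 k) => [j ->|->].
  under eq_fun do rewrite dconsS.
  exact: measurableT_comp (@measurable_coord _ _ _ _) _.
by under eq_fun do rewrite dcons0; exact: measurable_fst.
Qed.

Lemma product_law_fcons (P : forall k, probability (T k) R)
    (Q' : probability (fin_prod T') R) :
  product_law (fun k => P (lift ord0 k)) Q' ->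
  product_law P (push (pprod (P ord0) Q') measurable_fcons).
Proof.
move=> PQ' A mA; rewrite pushE big_ord_recl -PQ'//.
rewrite -product_measure1E//; last first.
  by apply: (@measurable_box _ _ T' (fun k => A (lift ord0 k))) => k; exact: mA.
congr (_ _); apply/seteqP; split=> -[x y] /=.
  move=> h; split; first by have := h ord0; rewrite /fcons dcons0.
  by move=> k; have := h (lift ord0 k); rewrite /fcons dconsS.
move=> [h0 h]; apply/forall_ord_recl; rewrite /fcons dcons0; split => // k.
by rewrite dconsS; exact: h.
Qed.

(** Basis of the inductions on the number of coordinates: the tail marginal is again a product law,
    and by uniqueness the whole law is the one assembled from the first marginal and the tail, to
    which Fubini applies. *)
Lemma product_law_tail (P : forall k, probability (T k) R)
    (Q : probability (fin_prod T) R) : product_law P Q ->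
  exists2 Q' : probability (fin_prod T') R,
    product_law (fun k => P (lift ord0 k)) Q' &
    forall f, bmf f -> Ex Q f = Ex (P ord0) (fun x => Ex Q' (fun y => f (fcons (x, y)))).
Proof.
move=> PQ.
have mt : measurable_fun [set: fin_prod T] (fun x : fin_prod T => (fun k => x (lift ord0 k)) : fin_prod T').
  by apply: measurable_fun_fin_prod => k; exact: measurable_coord.
pose Q' := push Q mt.
have PQ' : product_law (fun k => P (lift ord0 k)) Q'.
  move=> A mA; rewrite pushE.
  pose B := dcons (T := fun k => set (T k)) setT A.
  have := PQ B; rewrite big_ord_recl /B dcons0 [X in (X * _)%E]probability_setT mul1e.
  under [in X in _ -> X]eq_bigr do rewrite -(dconsS (T := fun k => set (T k)) setT A).
  move=> <-; last first.
    by move=> k; case: (unliftP ord0 k) => [j ->|->]; rewrite ?dcons0 ?dconsS.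
  congr (_ _); apply/seteqP; split => x /=.
    by move=> h; apply/forall_ord_recl; rewrite dcons0; split => // k; rewrite dconsS; exact: h.
  by move/forall_ord_recl => [_] h k; have := h k; rewrite dconsS.
exists Q' => // f bf.
rewrite (eq_measure_Ex _ (product_law_unique PQ (product_law_fcons PQ'))).
rewrite Ex_push// Ex_prod//.
exact: bmf_comp measurable_fcons _ bf.
Qed.

End cons.

Lemma product_law_exists n (T : 'I_n -> measurableType d)
    (P : forall k, probability (T k) R) :
  exists Q : probability (fin_prod T) R, product_law P Q.
Proof.
elim: n T P => [|n IH] T P.
  exists (\d_(point : fin_prod T)) => A mA.
  rewrite big_ord0 (_ : [set _ | _] = setT) ?[LHS]probability_setT//.
  by apply/seteqP; split => x //= _ [].
have [Q' PQ'] := IH _ (fun k => P (lift ord0 k)).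
by exists (push (pprod (P ord0) Q') measurable_fcons); exact: product_law_fcons.
Qed.

Lemma Ex_prod_coord n (T : 'I_n -> measurableType d)
    (P : forall k, probability (T k) R) (Q : probability (fin_prod T) R)
    (h : forall k, T k -> R) :
  product_law P Q -> (forall k, bmf (h k)) ->
  Ex Q (fun x => \prod_(k < n) h k (x k)) = \prod_(k < n) Ex (P k) (h k).
Proof.
elim: n T P Q h => [|n IH] T P Q h PQ bh.
  by rewrite big_ord0 -[RHS](Ex_cst Q); apply: eq_Ex => x; rewrite big_ord0.
have [Q' PQ' ->] := product_law_tail PQ; last first.
  apply: bmf_prod => k _.
  exact: (@bmf_comp _ _ _ (fin_prod T) (T k) (fun x => x k) (@measurable_coord _ _ _ k) _ (bh k)).
rewrite big_ord_recl -(IH _ _ _ _ PQ')//.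
rewrite mulrC -ExZ//; apply: eq_Ex => x.
rewrite mulrC -ExZ; last first.
  apply: bmf_prod => k _.
  exact: (@bmf_comp _ _ _ (fin_prod _) (T _) (fun x => x k) (@measurable_coord _ _ _ k) _ (bh _)).
apply: eq_Ex => y; rewrite big_ord_recl /fcons dcons0.
by under eq_bigr do rewrite dconsS.
Qed.

End product_laws.

(** * Total variation and relative entropy *)

Section divergences.
Context {R : realType} {d : measure_display} {X : measurableType d}.
Implicit Types (P Q : probability X R) (e : R).

(** Tested on functions with values in [0, 1] instead of events: this is how the conditional risk of
    a procedure under a loss bounded by 1 enters. *)
Definition tv e P Q := forall f : X -> R, measurable_fun [set: X] f ->
  (forall x, 0 <= f x <= 1) -> `|Ex P f - Ex Q f| <= e.

(* KL(P, Q) <= e, with ln x <= x - 1 applied in the Donsker-Varadhan formula so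
   that Q enters linearly; functions of oscillation 1 suffice for Pinsker. *)
Definition dvar e P Q := forall (c : R) (f : X -> R), measurable_fun [set: X] f ->
  (forall x, c <= f x <= c + 1) -> Ex P f + 1 <= Ex Q (expR \o f) + e.

Lemma tv_one_sided e P Q :
  (forall f : X -> R, measurable_fun [set: X] f -> (forall x, 0 <= f x <= 1) ->
     Ex P f <= Ex Q f + e) -> tv e P Q.
Proof.
move=> h f mf f01; have bf := bmf_itv mf f01.
have m1 : measurable_fun [set: X] (fun x => 1 - f x).
  by apply: measurable_funB => //; exact: measurable_cst.
have := h _ m1; rewrite !(ExB _ (bmf_cst 1) bf) !Ex_cst => h1.
rewrite ler_distl; apply/andP; split.
  have : 1 - Ex P f <= 1 - Ex Q f + e.
    by apply: h1 => x; have /andP[? ?] := f01 x; rewrite subr_ge0 lerBlDr lerDl; apply/andP.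
  lra.
exact: h.
Qed.

Lemma tv_sym e P Q : tv e P Q -> tv e Q P.
Proof. by move=> h f mf f01; rewrite distrC; exact: h. Qed.

Lemma tv_trans e e' P Q S : tv e P Q -> tv e' Q S -> tv (e + e') P S.
Proof.
move=> h h' f mf f01; rewrite (le_trans (ler_distD (Ex Q f) _ _))//.
by rewrite lerD ?h ?h'.
Qed.

Lemma tv_le e e' P Q : e <= e' -> tv e P Q -> tv e' P Q.
Proof. by move=> ee' h f mf f01; rewrite (le_trans (h f mf f01)). Qed.

Lemma tv1 P Q : tv 1 P Q.
Proof.
apply: tv_one_sided => f mf f01; have bf := bmf_itv mf f01.
have : Ex P f <= 1 by apply: Ex_le => // x; have /andP[] := f01 x.
have : 0 <= Ex Q f by apply: Ex_ge => // x; have /andP[] := f01 x.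
lra.
Qed.

Lemma tv0 P Q : (forall A, measurable A -> P A = Q A) -> tv 0 P Q.
Proof. by move=> PQ f _ _; rewrite (eq_measure_Ex _ PQ) subrr normr0. Qed.

Lemma dvar_le e e' P Q : e <= e' -> dvar e P Q -> dvar e' P Q.
Proof. by move=> ee' h c f mf fc; rewrite (le_trans (h c f mf fc))// lerD2l. Qed.

Lemma bmf_expR (f : X -> R) : bmf f -> bmf (expR \o f).
Proof.
move=> [mf [M fM]]; split; first exact: measurableT_comp.
exists (expR M) => x; rewrite ger0_norm ?expR_ge0//= ler_expR.
by rewrite (le_trans (ler_norm _)).
Qed.

Lemma Ex_expR_itv P (c : R) (f : X -> R) : measurable_fun [set: X] f ->
  (forall x, c <= f x <= c + 1) ->
  [/\ 0 < Ex P (expR \o f), c <= ln (Ex P (expR \o f)) & ln (Ex P (expR \o f)) <= c + 1].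
Proof.
move=> mf fc; have bf := bmf_expR (bmf_itv mf fc).
have l : expR c <= Ex P (expR \o f).
  by apply: Ex_ge => // x; rewrite /= ler_expR; have /andP[] := fc x.
have u : Ex P (expR \o f) <= expR (c + 1).
  by apply: Ex_le => // x; rewrite /= ler_expR; have /andP[] := fc x.
have p : 0 < Ex P (expR \o f) by exact: lt_le_trans (expR_gt0 c) l.
split => //.
  by rewrite -(expRK c) ler_ln// posrE expR_gt0.
by rewrite -(expRK (c + 1)) ler_ln// posrE expR_gt0.
Qed.

(* Applying the bound to f - ln E_Q e^f turns it into the Donsker-Varadhan form. *)
Lemma dvar_ln e P Q (c : R) (f : X -> R) : dvar e P Q ->
  measurable_fun [set: X] f -> (forall x, c <= f x <= c + 1) ->
  Ex P f <= ln (Ex Q (expR \o f)) + e.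
Proof.
move=> h mf fc; have bf := bmf_itv mf fc.
have [p _ _] := Ex_expR_itv Q mf fc.
set L := ln _.
have mL : measurable_fun [set: X] (fun x => f x - L).
  by apply: measurable_funB => //; exact: measurable_cst.
have := h (c - L) _ mL; rewrite ExB ?Ex_cst//; last exact: bmf_cst.
have -> : Ex Q (expR \o (fun x => f x - L)) = 1.
  rewrite (_ : _ \o _ = fun x => (Ex Q (expR \o f))^-1 * (expR \o f) x); last first.
    by apply/funext => x /=; rewrite expRB lnK ?posrE// mulrC.
  by rewrite ExZ ?mulVf ?gt_eqF//; exact: bmf_expR.
move=> H; have : Ex P f - L + 1 <= 1 + e.
  by apply: H => x; have /andP[? ?] := fc x; apply/andP; split; lra.
lra.
Qed.

(** Subtracting L = ln E_Q e^f puts a function of oscillation 1 into [-1, 1], and 1 + L <= e^L leads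
    back to f. With a fixed range, an exceptional event can later be discarded at a constant
    multiple of its probability. *)
Lemma ln_dvar e P Q :
  (forall (f : X -> R), measurable_fun [set: X] f -> (forall x, -1 <= f x <= 1) ->
    Ex P f + 1 <= Ex Q (expR \o f) + e) -> dvar e P Q.
Proof.
move=> h c f mf fc; have bf := bmf_itv mf fc.
have [p l u] := Ex_expR_itv Q mf fc.
set L := ln _ in l u.
have mL : measurable_fun [set: X] (fun x => f x - L).
  by apply: measurable_funB => //; exact: measurable_cst.
have := h _ mL; rewrite ExB ?Ex_cst//; last exact: bmf_cst.
have -> : Ex Q (expR \o (fun x => f x - L)) = 1.
  rewrite (_ : _ \o _ = fun x => (Ex Q (expR \o f))^-1 * (expR \o f) x); last first.
    by apply/funext => x /=; rewrite expRB lnK ?posrE// mulrC.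
  by rewrite ExZ ?mulVf ?gt_eqF//; exact: bmf_expR.
move=> H; have : Ex P f - L + 1 <= 1 + e.
  by apply: H => x; have /andP[? ?] := fc x; apply/andP; split; lra.
have := expR_ge1Dx L; rewrite [expR L]lnK ?posrE// => ? ?.
lra.
Qed.

Lemma dvar_refl P : dvar 0 P P.
Proof.
move=> c f mf fc; have bf := bmf_itv mf fc.
rewrite addr0 -[X in _ + X](Ex_cst P) -ExD//; last exact: bmf_cst.
apply: le_Ex => [||x /=]; [apply: bmfD => //; exact: bmf_cst|exact: bmf_expR|].
by rewrite addrC expR_ge1Dx.
Qed.

Lemma dvar_eq P Q : (forall A, measurable A -> P A = Q A) -> dvar 0 P Q.
Proof.
by move=> PQ c f mf fc; rewrite (eq_measure_Ex _ PQ); exact: (@dvar_refl Q c f mf fc).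
Qed.

(** Squaring and inverting e^(-x/2) >= 1 - x/2 bounds e^x by (1 - x/2)^(-2); the rest is the
    polynomial inequality (1 + x + 2x^2)(1 - x/2)^2 >= 1. *)
Lemma expR_le_quadratic (x : R) : `|x| <= 1 -> expR x <= 1 + x + 2 * x ^+ 2.
Proof.
rewrite ler_norml => /andP[x1 x2].
have h0 : 0 < 1 - x / 2 by lra.
have h : expR (x / 2) <= (1 - x / 2)^-1.
  rewrite -[expR _]invrK -expRN lef_pV2 ?posrE ?expR_gt0//.
  by have := expR_ge1Dx (- (x / 2)).
have -> : expR x = expR (x / 2) ^+ 2 by rewrite -expRM_natr; congr expR; field.
apply: (@le_trans _ _ ((1 - x / 2)^-1 ^+ 2)).
  by rewrite ler_sqr ?nnegrE ?expR_ge0 ?invr_ge0 ?(ltW h0).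
rewrite exprVn -[leLHS]mul1r ler_pdivrMr ?exprn_gt0// -subr_ge0.
have -> : (1 + x + 2 * x ^+ 2) * (1 - x / 2) ^+ 2 - 1 = x ^+ 2 * ((1 - x) * (5 / 4 - x / 2)) by field.
by rewrite mulr_ge0 ?sqr_ge0// mulr_ge0; lra.
Qed.

(** Pinsker's inequality up to the constant. The test function l (f - E_Q f) has mean 0 under Q, so
    its exponential has mean at most 1 + 2l^2; dividing by l gives 2l + e/l, and l = sqrt e gives
    the factor 3. *)
Lemma dvar_tv e P Q : 0 <= e -> dvar e P Q -> tv (3 * Num.sqrt e) P Q.
Proof.
move=> e0 h; apply: tv_one_sided => f mf f01; have bf := bmf_itv mf f01.
have key (l : R) : 0 < l <= 1 -> Ex P f <= Ex Q f + (2 * l + e / l).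
  move=> /andP[l0 l1].
  pose q := Ex Q f.
  have q01 : 0 <= q <= 1.
    apply/andP; split; [apply: Ex_ge|apply: Ex_le] => // x; by have /andP[] := f01 x.
  pose g x := l * (f x - q).
  have mg : measurable_fun [set: X] g.
    apply: measurable_funM; first exact: measurable_cst.
    by apply: measurable_funB => //; exact: measurable_cst.
  have gq x : - (l * q) <= g x <= - (l * q) + 1.
    have /andP[? ?] := f01 x; rewrite /g; apply/andP; split; nra.
  have bg := bmf_itv mg gq.
  have EPg : Ex P g = l * (Ex P f - q).
    rewrite ExZ ?ExB ?Ex_cst//; [exact: bmf_cst|]; apply: bmfB => //; exact: bmf_cst.
  have EQg : Ex Q g = 0.
    rewrite ExZ ?ExB ?Ex_cst ?subrr ?mulr0//; [exact: bmf_cst|]; apply: bmfB => //; exact: bmf_cst.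
  have : Ex Q (expR \o g) <= 1 + 2 * l ^+ 2.
    apply: (@le_trans _ _ (Ex Q (fun x => (1 + 2 * l ^+ 2) + g x))).
      apply: le_Ex; first exact: bmf_expR.
        by apply: bmfD => //; exact: bmf_cst.
      move=> x /=; have gl : `|g x| <= l.
        rewrite normrM gtr0_norm// -[leRHS]mulr1 ler_pM2l// ler_distl.
        by have /andP[? ?] := f01 x; move/andP: q01 => [? ?]; apply/andP; split; lra.
      have := expR_le_quadratic (le_trans gl l1).
      have : g x ^+ 2 <= l ^+ 2 by rewrite -[leLHS]real_normK ?num_real// ler_sqr ?nnegrE ?(ltW l0).
      lra.
    by rewrite ExD ?Ex_cst ?EQg ?addr0//; exact: bmf_cst.
  have := h _ _ mg gq; rewrite EPg => h1 h2.
  have : l * (Ex P f - q) <= l * (2 * l + e / l).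
    have -> : l * (2 * l + e / l) = 2 * l ^+ 2 + e by field; rewrite gt_eqF.
    lra.
  by rewrite ler_pM2l// -/q; lra.
(* The choice l = sqrt e is allowed for 0 < e < 1. For e >= 1 the bound exceeds 1 and is trivial;
   for e = 0 let l tend to 0. *)
have [e1|e1] := leP 1 e.
  have := tv1 P Q mf f01; rewrite ler_distl => /andP[_ H].
  apply: (le_trans H); rewrite lerD2l.
  have : 1 <= Num.sqrt e by rewrite -[leLHS]sqrtr1 ler_sqrt.
  lra.
move: e0; rewrite le_eqVlt => /predU1P[e0|e0].
  rewrite -e0 sqrtr0 mulr0 addr0; apply/ler_addgt0Pl => l l0.
  have l20 : 0 < l / 2 by lra.
  have := key (Num.min (l / 2) 1); rewrite lt_min l20 ltr01 ge_min lexx orbT => /(_ isT).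
  rewrite -e0 mul0r addr0 => H; apply: (le_trans H).
  have : Num.min (l / 2) 1 <= l / 2 by rewrite ge_min lexx.
  lra.
have s0 : 0 < Num.sqrt e by rewrite sqrtr_gt0.
have := key (Num.sqrt e); rewrite s0 -{1}sqrtr1 ler_sqrt// (ltW e1) => /(_ isT).
rewrite -{2}(sqr_sqrtr (ltW e0)) expr2 mulfK ?gt_eqF//.
lra.
Qed.

End divergences.

Section tensorization.
Context {R : realType} {d : measure_display}.

(** The tails are compared for a fixed first coordinate; integrating the tail under Q' leaves a
    function with values in [0, 1], a legitimate test for the first coordinate. *)
Lemma tv_tensor n (T : 'I_n -> measurableType d)
    (P Q : forall k, probability (T k) R) (e : 'I_n -> R)
    (PP QQ : probability (fin_prod T) R) :
  product_law P PP -> product_law Q QQ -> (forall k, tv (e k) (P k) (Q k)) ->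
  tv (\sum_k e k) PP QQ.
Proof.
elim: n T P Q e PP QQ => [|n IH] T P Q e PP QQ hP hQ hPQ.
  rewrite big_ord0; apply: tv0; apply: (product_law_unique hP) => A mA.
  by rewrite hQ// !big_ord0.
have [P' hP' EP] := product_law_tail hP.
have [Q' hQ' EQ] := product_law_tail hQ.
apply: tv_one_sided => f mf f01; have bf := bmf_itv mf f01.
have bff := bmf_comp measurable_fcons bf.
rewrite EP// EQ// big_ord_recl.
have IH' := IH _ _ _ _ _ _ hP' hQ' (fun k => hPQ (lift ord0 k)).
pose g x := Ex Q' (fun y => f (fcons (x, y))).
have bg : bmf g := bmf_Ex_snd Q' bff.
have g01 x : 0 <= g x <= 1.
  apply/andP; split; [apply: Ex_ge|apply: Ex_le];
   by [exact: (bmf_snd x bff)|move=> y; have /andP[] := f01 (fcons (x, y))].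
apply: (@le_trans _ _ (Ex (P ord0) (fun x => g x + \sum_(i < n) e (lift ord0 i)))).
  apply: le_Ex; first exact: (bmf_Ex_snd P' bff).
    by apply: bmfD => //; exact: bmf_cst.
  move=> x; have bx := bmf_snd x bff.
  have := IH' _ bx.1 (fun y => f01 (fcons (x, y))).
  by rewrite ler_distl => /andP[].
rewrite ExD ?Ex_cst//; last exact: bmf_cst.
have := hPQ ord0 _ bg.1 g01; rewrite ler_distl => /andP[_].
rewrite -/(Ex _ g) => ?; lra.
Qed.

(** Chain rule of relative entropy. The function g(x) = ln E_Q' e^f(x, .) obtained from the tail has
    the same range [c, c + 1] as f, so it can be tested on the first coordinate, and e^g is the
    inner integral of e^f. *)
Lemma dvar_tensor n (T : 'I_n -> measurableType d)
    (P Q : forall k, probability (T k) R) (e : 'I_n -> R)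
    (PP QQ : probability (fin_prod T) R) :
  product_law P PP -> product_law Q QQ -> (forall k, dvar (e k) (P k) (Q k)) ->
  dvar (\sum_k e k) PP QQ.
Proof.
elim: n T P Q e PP QQ => [|n IH] T P Q e PP QQ hP hQ hPQ.
  rewrite big_ord0; apply: dvar_eq; apply: (product_law_unique hP) => A mA.
  by rewrite hQ// !big_ord0.
have [P' hP' EP] := product_law_tail hP.
have [Q' hQ' EQ] := product_law_tail hQ.
move=> c f mf fc; have bf := bmf_itv mf fc.
have bff := bmf_comp measurable_fcons bf.
rewrite EP// EQ ?big_ord_recl; last exact: bmf_expR.
have IH' := IH _ _ _ _ _ _ hP' hQ' (fun k => hPQ (lift ord0 k)).
have bef := bmf_comp measurable_fcons (bmf_expR bf).
pose g x := ln (Ex Q' (fun y => expR (f (fcons (x, y))))).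
have gc x : [/\ 0 < Ex Q' (fun y => expR (f (fcons (x, y)))), c <= g x & g x <= c + 1].
  have bx := bmf_snd x bff.
  exact: (Ex_expR_itv Q' bx.1 (fun y => fc (fcons (x, y)))).
have mg : measurable_fun setT g.
  have [mh _] := bmf_Ex_snd Q' bef.
  exact: measurableT_comp (@measurable_ln R) mh.
have gc' x : c <= g x <= c + 1 by have [_ -> ->] := gc x.
have bg : bmf g := bmf_itv mg gc'.
have H1 : Ex (P ord0) (fun x => Ex P' (fun y => f (fcons (x, y)))) <=
  Ex (P ord0) g + \sum_(i < n) e (lift ord0 i).
  rewrite -[X in _ + X](Ex_cst (P ord0)) -ExD//; last exact: bmf_cst.
  apply: le_Ex; first exact: (bmf_Ex_snd P' bff).
    by apply: bmfD => //; exact: bmf_cst.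
  move=> x; have bx := bmf_snd x bff.
  exact: (dvar_ln IH' bx.1 (fun y => fc (fcons (x, y)))).
have := hPQ ord0 _ _ mg gc'.
rewrite (_ : expR \o g = fun x => Ex Q' (fun y => expR (f (fcons (x, y))))); last first.
  by apply/funext => x /=; rewrite lnK// posrE; have [] := gc x.
rewrite /comp; move: H1; lra.
Qed.

End tensorization.

(** * Randomizations and the deficiency distance *)

Section randomized_procedure.
Context {R : realType} {d1 d2 d3 dO : measure_display} {X1 : measurableType d1}
  {X2 : measurableType d2} {A : measurableType d3} {O : measurableType dO}.
Variables (W : probability O R) (phi : X1 * O -> X2).
Hypothesis mphi : measurable_fun [set: X1 * O] phi.
Variable chi : R.-pker X2 ~> A.

Definition noise_kernel (_ : X1) : {measure set O -> \bar R} := W.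

Let noise_kernel_measurable U : measurable U -> measurable_fun [set: X1] (noise_kernel ^~ U).
Proof. by move=> mU; exact: measurable_cst. Qed.

HB.instance Definition _ := isKernel.Build _ _ _ _ R noise_kernel noise_kernel_measurable.

Let noise_kernel_prob x : noise_kernel x [set: O] = 1%E.
Proof. exact: probability_setT. Qed.

HB.instance Definition _ := Kernel_isProbability.Build _ _ _ _ R noise_kernel noise_kernel_prob.

Definition transported_kernel (z : X1 * O) : {measure set A -> \bar R} := chi (phi z).

Let transported_kernel_measurable U : measurable U ->
  measurable_fun [set: X1 * O] (transported_kernel ^~ U).
Proof.
move=> mU; exact: (measurableT_comp (measurable_kernel chi U mU) mphi).
Qed.

HB.instance Definition _ := isKernel.Build _ _ _ _ R transported_kernel transported_kernel_measurable.

Let transported_kernel_prob x : transported_kernel x [set: A] = 1%E.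
Proof. exact: prob_kernel. Qed.

HB.instance Definition _ :=
  Kernel_isProbability.Build _ _ _ _ R transported_kernel transported_kernel_prob.

(** The procedure that simulates an observation of the second experiment from one of the first, with
    auxiliary randomness [W], and then follows [chi]. *)
Definition randomized : X1 -> {measure set A -> \bar R} :=
  mkcomp noise_kernel transported_kernel.

Let randomized_measurable U : measurable U -> measurable_fun [set: X1] (randomized ^~ U).
Proof. exact: measurable_fun_mkcomp_sfinite. Qed.

HB.instance Definition _ := isKernel.Build _ _ _ _ R randomized randomized_measurable.

Let randomized_prob x : randomized x [set: A] = 1%E.
Proof.
rewrite /randomized /mkcomp /= /kcomp.
under eq_integral do rewrite [transported_kernel _ _](@prob_kernel _ _ _ _ _ transported_kernel).
by rewrite integral_cst// mul1e (@prob_kernel _ _ _ _ _ noise_kernel).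
Qed.

HB.instance Definition _ := Kernel_isProbability.Build _ _ _ _ R randomized randomized_prob.

Lemma randomized_integral x (f : A -> \bar R) : (forall a, 0 <= f a)%E ->
  measurable_fun [set: A] f ->
  (\int[randomized x]_a f a = \int[W]_o \int[chi (phi (x, o))]_a f a)%E.
Proof. by move=> f0 mf; rewrite integral_kcomp. Qed.

End randomized_procedure.

Section deficiency_bound.
Context {R : realType} {param : Type} (Theta : set param).
Context {d1 d2 dO : measure_display} {X1 : measurableType d1}
  {X2 : measurableType d2} {O : measurableType dO}.
Variables (Q1 : param -> probability X1 R) (Q2 : param -> probability X2 R).
Variables (W : probability O R) (phi : X1 * O -> X2).
Hypothesis mphi : measurable_fun [set: X1 * O] phi.

(** The easy half of Le Cam's randomization criterion. The conditional expected loss g of [chi] has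
    values in [0, 1], and the two risks are the expectations of g under the simulated and under the
    true law. *)
Lemma deficiency_le (e : R) :
  (forall rho, Theta rho -> tv e (push (pprod (Q1 rho) W) mphi) (Q2 rho)) ->
  (deficiency Theta Q1 Q2 <= e%:E)%E.
Proof.
move=> h; apply: ge_ereal_sup => _ [dA [A [chi ->]]].
apply: (@le_trans _ _ (ereal_sup [set g | exists rho (L : param -> A -> R),
        [/\ Theta rho, unit_loss Theta L &
            g = `|risk Q1 (randomized W mphi chi) L rho - risk Q2 chi L rho|%E]])).
  by apply: ereal_inf_lbound; exists (randomized W mphi chi).
apply: ge_ereal_sup => _ [rho [L [Trho [L0 mL L1] ->]]].
have mLr : measurable_fun [set: A] (fun a => (L rho a)%:E).
  by apply/measurable_EFinP; exact: mL.
have Lr0 a : (0 <= (L rho a)%:E)%E by rewrite lee_fin L0.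
have Lr1 a : L rho a <= 1.
  by rewrite -lee_fin -L1; apply: ereal_sup_ubound; exists rho => //; exists a.
pose ge y := (\int[chi y]_a (L rho a)%:E)%E.
have ge01 y : (0 <= ge y <= 1)%E.
  rewrite integral_ge0//= -[leRHS](@prob_kernel _ _ _ _ _ chi y) -[leRHS]mul1e.
  rewrite -integral_cst//; apply: ge0_le_integral => // a _.
  by rewrite lee_fin.
pose g y := fine (ge y).
have gE y : ge y = (g y)%:E.
  rewrite fineK// fin_real//; have /andP[g0 g1] := ge01 y.
  by rewrite (lt_le_trans _ g0) ?ltNyr// (le_lt_trans g1) ?ltry.
have g01 y : 0 <= g y <= 1 by have := ge01 y; rewrite gE !lee_fin.
have mg : measurable_fun [set: X2] g.
  apply: measurableT_comp => //.
  apply: measurable_fun_integral_kernel => //.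
  by move=> U mU; exact: measurable_kernel.
have bg := bmf_itv mg g01.
have bgf := bmf_comp mphi bg.
have -> : risk Q2 chi L rho = (Ex (Q2 rho) g)%:E.
  by rewrite EFin_Ex//; apply: eq_integral => x _; exact: gE.
have -> : risk Q1 (randomized W mphi chi) L rho = (Ex (push (pprod (Q1 rho) W) mphi) g)%:E.
  rewrite Ex_push// Ex_prod// EFin_Ex; last exact: bmf_Ex_snd.
  apply: eq_integral => x _; rewrite randomized_integral//.
  rewrite EFin_Ex; last exact: bmf_snd x bgf.
  by apply: eq_integral => w _; exact: gE.
by rewrite -EFinB abse_EFin lee_fin; exact: h.
Qed.

End deficiency_bound.

Section coordinatewise.
Context {d d' dO : measure_display} {n : nat}
  {T : 'I_n -> measurableType d} {T' : 'I_n -> measurableType d'}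
  {O : 'I_n -> measurableType dO}.
Variable phi : forall k, T k * O k -> T' k.
Hypothesis mphi : forall k, measurable_fun setT (@phi k).

Definition coordwise (z : fin_prod T * fin_prod O) : fin_prod T' :=
  fun k => phi (z.1 k, z.2 k).

Lemma measurable_coordwise : measurable_fun setT coordwise.
Proof.
apply: measurable_fun_fin_prod => k; rewrite /coordwise.
have mp : measurable_fun setT (fun z : fin_prod T * fin_prod O => (z.1 k, z.2 k)).
  apply/measurable_fun_pairP; split => /=.
    exact: (measurableT_comp (@measurable_coord _ _ T k) (@measurable_fst _ _ _ _)).
  exact: (measurableT_comp (@measurable_coord _ _ O k) (@measurable_snd _ _ _ _)).
exact: (measurableT_comp (@mphi k) mp).
Qed.

End coordinatewise.

Lemma probE {R : realType} {d : measure_display} {X : measurableType d}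
  (P : probability X R) (A : set X) : measurable A -> P A = (Ex P \1_A)%:E.
Proof. by move=> mA; rewrite Ex_indic// fineK// fin_num_measure. Qed.

Lemma prodEFin {R : realType} I (s : seq I) (p : pred I) (f : I -> R) :
  (\prod_(i <- s | p i) (f i)%:E = (\prod_(i <- s | p i) f i)%:E)%E.
Proof. by elim/big_rec2: _ => [//|i x y _ ->]. Qed.

Lemma indic_box {R : realType} {d : measure_display} {n : nat}
    {T : 'I_n -> measurableType d} (A : forall k, set (T k)) (x : fin_prod T) :
  \1_[set x : fin_prod T | forall k, A k (x k)] x = \prod_(k < n) (\1_(A k) (x k)) :> R.
Proof.
rewrite indicE; case: (boolP (x \in _)) => [|/negP].
  by rewrite inE => /= xA; rewrite big1// => k _; rewrite indicE mem_set.
rewrite inE => /= /existsNP[k xk]; rewrite (bigD1 k)//= indicE memNset//= mul0r //.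
Qed.

Lemma product_law_image {R : realType} {d d' dO : measure_display} {n : nat}
  {T : 'I_n -> measurableType d} {T' : 'I_n -> measurableType d'}
  {O : 'I_n -> measurableType dO} (phi : forall k, T k * O k -> T' k)
  (mphi : forall k, measurable_fun setT (@phi k))
  (P : forall k, probability (T k) R) (W : forall k, probability (O k) R)
  (PP : probability (fin_prod T) R) (WW : probability (fin_prod O) R) :
  product_law P PP -> product_law W WW ->
  product_law (fun k => push (pprod (P k) (W k)) (mphi k))
    (push (pprod PP WW) (measurable_coordwise mphi)).
Proof.
move=> hP hW A mA.
rewrite (probE _ (measurable_box mA)).
under eq_bigr do rewrite (probE _ (mA _)).
rewrite prodEFin; congr EFin.
have bA k : bmf (\1_(A k) : _ -> R) := bmf_indic (mA k).
have bphi k := bmf_comp (mphi k) (bA k).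
rewrite Ex_push; last exact: bmf_indic (measurable_box mA).
rewrite Ex_prod; last first.
  by apply: (bmf_comp (measurable_coordwise mphi)); exact: bmf_indic (measurable_box mA).
under eq_Ex => x.
  under eq_Ex => w do rewrite /= indic_box.
  rewrite (Ex_prod_coord (h := fun k w => \1_(A k) (phi k (x k, w))) hW); last first.
    by move=> k; exact: bmf_snd (x k) (bphi k).
  over.
rewrite (Ex_prod_coord (h := fun k x => Ex (W k) (fun w => \1_(A k) (phi k (x, w)))) hP); last first.
  by move=> k; exact: bmf_Ex_snd (W k) _ (bphi k).
by apply: eq_bigr => k _; rewrite Ex_push// Ex_prod.
Qed.

(** A randomization cannot increase total variation: integrating out the noise keeps a test function
    in [0, 1]. *)
Lemma tv_push {R : realType} {d d' dO : measure_display} {X : measurableType d}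
  {Y : measurableType d'} {O : measurableType dO} (W : probability O R)
  (phi : X * O -> Y) (mphi : measurable_fun setT phi) (e : R) (P Q : probability X R) :
  tv e P Q -> tv e (push (pprod P W) mphi) (push (pprod Q W) mphi).
Proof.
move=> h f mf f01; have bf := bmf_itv mf f01.
have bff := bmf_comp mphi bf.
rewrite !Ex_push// !Ex_prod//; apply: h; first by have [] := bmf_Ex_snd W bff.
move=> x; apply/andP; split; [apply: Ex_ge|apply: Ex_le];
  by [exact: (bmf_snd x bff)|move=> y; have /andP[] := f01 (phi (x, y))].
Qed.

Section transfer.
Context {R : realType} {param : Type} (Theta : set param).
Context {d d' dO dO' : measure_display} {n : nat}
  {T : 'I_n -> measurableType d} {T' : 'I_n -> measurableType d'}
  {O : 'I_n -> measurableType dO} {O' : 'I_n -> measurableType dO'}.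
Variables (phi : forall k, T k * O k -> T' k) (psi : forall k, T' k * O' k -> T k).
Hypothesis (mphi : forall k, measurable_fun setT (@phi k))
  (mpsi : forall k, measurable_fun setT (@psi k)).
Variables (W : forall k, probability (O k) R) (W' : forall k, probability (O' k) R).
Variables (Q1 : param -> probability (fin_prod T') R)
  (Q2 : param -> probability (fin_prod T) R).

(** [phi] sends an observation of the second experiment to one of the first, [psi] goes back;
    neither depends on rho. [P2'] is an intermediate law that absorbs a change of design. For the
    converse direction the first experiment is replaced by the [phi]-image of the second, at the
    cost already found, after which only [psi] after [phi] has to be close to the identity in
    law. *)
Lemma Delta_transfer (H E E' : R) : 0 <= E -> 0 <= E' ->
  (forall rho, Theta rho -> exists (P1 : forall k, probability (T' k) R)
     (P2 P2' : forall k, probability (T k) R) (eta eps eta' : 'I_n -> R),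
    [/\ product_law P1 (Q1 rho), product_law P2 (Q2 rho),
      forall k, tv (eta k) (P2 k) (P2' k),
      forall k, dvar (eps k) (push (pprod (P2' k) (W k)) (@mphi k)) (P1 k) &
      forall k, tv (eta' k) (push (pprod (push (pprod (P2 k) (W k)) (@mphi k)) (W' k)) (@mpsi k)) (P2 k)]
    /\ [/\ \sum_k eta k <= H, \sum_k eps k <= E & \sum_k eta' k <= E']) ->
  (Delta Theta Q1 Q2 <= (H + 3 * Num.sqrt E + E')%:E)%E.
Proof.
move=> E0 E'0 h.
have [WW hW] := product_law_exists W.
have [WW' hW'] := product_law_exists W'.
have key rho : Theta rho ->
  tv (H + 3 * Num.sqrt E) (push (pprod (Q2 rho) WW) (measurable_coordwise mphi)) (Q1 rho) /\
  tv (H + 3 * Num.sqrt E + E') (push (pprod (Q1 rho) WW') (measurable_coordwise mpsi)) (Q2 rho).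
  move=> /h[P1 [P2 [P2' [eta [eps [eta' [[h1 h2 h3 h4 h5] [H1 H2 H3]]]]]]]].
  have [PP2' h2'] := product_law_exists P2'.
  have c1 : tv (H + 3 * Num.sqrt E) (push (pprod (Q2 rho) WW) (measurable_coordwise mphi)) (Q1 rho).
    apply: tv_trans (tv_push WW (measurable_coordwise mphi) (tv_le H1 (tv_tensor h2 h2' h3))) _.
    apply: dvar_tv => //; apply: dvar_le H2 _.
    exact: dvar_tensor (product_law_image mphi h2' hW) h1 h4.
  split => //.
  apply: tv_trans (tv_push WW' (measurable_coordwise mpsi) (tv_sym c1)) _.
  apply: tv_le H3 _.
  exact: tv_tensor (product_law_image mpsi (product_law_image mphi h2 hW) hW') h2 h5.
rewrite /Delta ge_max; apply/andP; split.
  by apply: (deficiency_le (W := WW') (mphi := measurable_coordwise mpsi)) => rho /key[].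
apply: (@le_trans _ _ (H + 3 * Num.sqrt E)%:E); last by rewrite lee_fin lerDl.
by apply: (deficiency_le (W := WW) (mphi := measurable_coordwise mphi)) => rho /key[].
Qed.

End transfer.

(** * Laws on R^n are determined by their linear forms *)

Section smoothstep.
Context {R : realType}.

(* Iterates of 3x^2 - 2x^3 send x < 1/2 to 0 and x > 1/2 to 1, so that iterates at
   (1 + sin y) / 2, which are trigonometric polynomials, approach an indicator. *)
Definition smoothstep (x : R) : R := 3 * x ^+ 2 - 2 * x ^+ 3.

Definition step (y : R) : R := if y == 0 then 1 / 2 else (0 < y)%R%:R.

Lemma smoothstep01 (x : R) : 0 <= x <= 1 -> 0 <= smoothstep x <= 1.
Proof.
move=> /andP[x0 x1]; rewrite /smoothstep; apply/andP; split.
  have -> : 3 * x ^+ 2 - 2 * x ^+ 3 = x ^+ 2 * (3 - 2 * x) by ring.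
  by rewrite mulr_ge0 ?sqr_ge0//; lra.
rewrite -subr_ge0.
have -> : 1 - (3 * x ^+ 2 - 2 * x ^+ 3) = (1 - x) ^+ 2 * (1 + 2 * x) by ring.
by rewrite mulr_ge0 ?sqr_ge0//; lra.
Qed.

Lemma iter_smoothstep01 N (x : R) : 0 <= x <= 1 -> 0 <= iter N smoothstep x <= 1.
Proof. by move=> x01; elim: N => //= N IH; exact: smoothstep01. Qed.

Lemma iter_smoothstep_cvg0 (x : R) : 0 <= x < 1 / 2 -> iter N smoothstep x @[N --> \oo] --> (0 : R).
Proof.
move=> /andP[x0 x12].
(* [smoothstep] multiplies y by y (3 - 2y), which is at most q for 0 <= y <= x < 1/2; and 1 - q = (1
   - x)(1 - 2x) is positive, so the iterates decay geometrically. *)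
pose q := x * (3 - 2 * x).
have q1 : `|q| < 1.
  rewrite ger0_norm /q; last by rewrite mulr_ge0//; lra.
  rewrite -subr_gt0; have -> : 1 - x * (3 - 2 * x) = (1 - x) * (1 - 2 * x) by ring.
  by rewrite mulr_gt0//; lra.
have q0 : 0 <= q by rewrite /q mulr_ge0//; lra.
have bnd N : 0 <= iter N smoothstep x <= q ^+ N * x.
  elim: N => [|N /andP[IH0 IH]]; first by rewrite expr0 mul1r /= x0 lexx.
  rewrite /=; set y := iter N smoothstep x in IH0 IH *.
  have yx : y <= x.
    apply: (le_trans IH); rewrite -[leRHS]mul1r ler_wpM2r// exprn_ile1//.
    by rewrite ltW// (le_lt_trans (ler_norm _)).
  have -> : smoothstep y = (y * (3 - 2 * y)) * y by rewrite /smoothstep; ring.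
  have yq : y * (3 - 2 * y) <= q.
    rewrite /q -subr_ge0.
    have -> : x * (3 - 2 * x) - y * (3 - 2 * y) = (x - y) * (3 - 2 * (x + y)) by ring.
    by rewrite mulr_ge0//; lra.
  have y3 : 0 <= y * (3 - 2 * y) by rewrite mulr_ge0//; lra.
  apply/andP; split; first by rewrite mulr_ge0.
  by rewrite exprS -[leRHS]mulrA ler_pM.
apply: (@squeeze_cvgr _ _ _ _ (fun=> 0) (fun N => q ^+ N * x)).
- by apply: nearW => N; exact: bnd.
- exact: cvg_cst.
- rewrite -[X in _ --> X](mul0r x); apply: cvgMr_tmp; exact: cvg_expr.
Qed.

Lemma iter_smoothstep_sym N (x : R) : iter N smoothstep (1 - x) = 1 - iter N smoothstep x.
Proof. by elim: N => //= N ->; rewrite /smoothstep; ring. Qed.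

Lemma iter_smoothstep_cvg (y : R) : -1 <= y <= 1 ->
  iter N smoothstep ((1 + y) / 2) @[N --> \oo] --> step y.
Proof.
move=> /andP[y1 y2]; rewrite /step; have [->|y0] := eqVneq y 0.
  rewrite addr0 (_ : (fun N => _) = fun=> (1 / 2 : R)); first exact: cvg_cst.
  by apply/funext; elim => //= N ->; rewrite /smoothstep; field.
have [yp|yn] := ltP 0 y.
  have -> : (1 + y) / 2 = 1 - (1 - y) / 2 by field.
  rewrite (_ : (fun N => _) = fun N => 1 - iter N smoothstep ((1 - y) / 2)); last first.
    by apply/funext => N; exact: iter_smoothstep_sym.
  rewrite -(subr0 true%:R); apply: cvgB; first exact: cvg_cst.
  by apply: iter_smoothstep_cvg0; apply/andP; split; lra.
apply: iter_smoothstep_cvg0; have : y < 0 by rewrite lt_neqAle y0 yn.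
by move=> ?; apply/andP; split; lra.
Qed.

Lemma step01 (y : R) : 0 <= step y <= 1.
Proof. by rewrite /step; case: eqP => _; [apply/andP; split; lra|case: (_ < _); rewrite ?lexx ?ler01]. Qed.

Lemma step_near (u : nat -> R) (y : R) :
  (\forall k \near \oo, step (u k) = y) -> step (u k) @[k --> \oo] --> y.
Proof. by move=> h; apply: cvg_near_cst. Qed.

(** As soon as k + 1 exceeds |y| the angle lies in (-1, 1), where the sine has the sign of its
    argument: lengthening the period removes the periodicity. *)
Lemma step_sin_cvg (y : R) : step (sin (y / k.+1%:R)) @[k --> \oo] --> step y.
Proof.
apply: step_near.
exists (Num.truncn `|y|) => // k /= yk.
have k0 : 0 < k.+1%:R :> R by [].
have yk1 : `|y| < k.+1%:R.
  by apply: (lt_le_trans (truncnS_gt _)); rewrite ler_nat ltnS.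
rewrite /step; have [->|y0] := eqVneq y 0; first by rewrite mul0r sin0 eqxx.
have sgt (z : R) : 0 < z -> z < k.+1%:R -> 0 < sin (z / k.+1%:R).
  move=> z0 zk; apply: sin2_gt0; rewrite divr_gt0//= (@lt_trans _ _ 1)//.
    by rewrite ltr_pdivrMr// mul1r.
  by rewrite ltrDl.
have [yp|yn] := ltP 0 y.
  have s := sgt _ yp (le_lt_trans (ler_norm _) yk1).
  by rewrite gt_eqF// s.
have yl : y < 0 by rewrite lt_neqAle y0 yn.
have s : 0 < sin (- y / k.+1%:R).
  by apply: sgt; [rewrite oppr_gt0|rewrite (le_lt_trans (ler_norm _))// normrN].
rewrite mulNr sinN oppr_gt0 in s.
by rewrite lt_eqF// ltNge (ltW s).
Qed.

(** A vanishing shift to the right replaces the value 1/2 at the jump by 1, which yields the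
    indicator of a closed half-line. *)
Lemma step_shift_cvg (y : R) : step (y + k.+1%:R^-1) @[k --> \oo] --> ((0 <= y)%R%:R : R).
Proof.
apply: step_near.
have [y0|y0] := leP 0 y.
  apply: nearW => k; have h : 0 < y + k.+1%:R^-1 by rewrite ltr_wpDl ?invr_gt0.
  by rewrite /step gt_eqF// h.
exists (Num.truncn (- y)^-1) => // k /= yk.
have k0 : 0 < k.+1%:R :> R by [].
have : k.+1%:R^-1 < - y.
  rewrite -[ltRHS]invrK ltf_pV2 ?posrE ?invr_gt0 ?oppr_gt0//.
  by apply: (lt_le_trans (truncnS_gt _)); rewrite ler_nat ltnS.
move=> h; have h' : y + k.+1%:R^-1 < 0 by rewrite addrC -ltrBrDr sub0r.
by rewrite /step lt_eqF// ltNge (ltW h').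
Qed.

End smoothstep.

Section cramer_wold.
Context {R : realType} {n : nat}.
Local Notation X := (rvec R n).

Definition lin (t : 'I_n -> R) (z : X) : R := \sum_(a < n) t a * z a.

Lemma measurable_lin t : measurable_fun [set: X] (lin t).
Proof.
apply: measurable_sum => a; apply: measurable_funM; first exact: measurable_cst.
exact: measurable_coord.
Qed.

(** Real characteristic functions: cosines with arbitrary frequency vector and phase, so that sines
    and constants are included. *)
Definition trig_poly (s : seq (R * ('I_n -> R) * R)) (z : X) : R :=
  \sum_(i <- s) i.1.1 * cos (lin i.1.2 z + i.2).

Definition is_trig (f : X -> R) := exists s, f = trig_poly s.

Lemma bmf_cos t b : bmf (fun z : X => cos (lin t z + b)).
Proof.
apply: (@bmf_itv _ _ _ _ (-1) 1).
  apply: measurableT_comp; first by apply: continuous_measurable_fun; exact: continuous_cos.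
  by apply: measurable_funD; [exact: measurable_lin|exact: measurable_cst].
by move=> z; rewrite cos_geN1 cos_le1.
Qed.

Lemma is_trig_cos t b : is_trig (fun z => cos (lin t z + b)).
Proof.
by exists [:: (1, t, b)]; apply/funext => z; rewrite /trig_poly big_seq1 mul1r.
Qed.

Lemma is_trig_cst c : is_trig (fun=> c).
Proof.
exists [:: (c, (fun=> 0), 0)]; apply/funext => z; rewrite /trig_poly big_seq1 /=.
rewrite /lin big1 ?addr0 ?cos0 ?mulr1// => a _; exact: mul0r.
Qed.

Lemma is_trigD f g : is_trig f -> is_trig g -> is_trig (fun z => f z + g z).
Proof.
move=> [s ->] [s' ->]; exists (s ++ s'); apply/funext => z.
by rewrite /trig_poly big_cat.
Qed.

Lemma is_trigM f g : is_trig f -> is_trig g -> is_trig (fun z => f z * g z).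
Proof.
move=> [s ->] [s' ->].
elim: s => [|[[c t] b] s [r hr]].
  exists [::]; apply/funext => z; by rewrite /trig_poly !big_nil mul0r.
have [r' hr'] : is_trig (fun z => c * cos (lin t z + b) * trig_poly s' z).
  elim: s' {hr} => [|[[c' t'] b'] s' [r' hr']].
    exists [::]; apply/funext => z; by rewrite /trig_poly !big_nil mulr0.
  (* Product to sum: cos u cos v = (cos (u + v) + cos (u - v)) / 2. *)
  exists ((c * c' / 2, (fun a => t a + t' a), b + b') ::
          (c * c' / 2, (fun a => t a - t' a), b - b') :: r').
  apply/funext => z; have /(congr1 (fun h => h z)) := hr'.
  rewrite /trig_poly !big_cons /= => <-; rewrite mulrDr.
  have lD : lin (fun a => t a + t' a) z + (b + b') = (lin t z + b) + (lin t' z + b').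
    rewrite /lin; under eq_bigr do rewrite mulrDl; rewrite big_split /=; ring.
  have lB : lin (fun a => t a - t' a) z + (b - b') = (lin t z + b) - (lin t' z + b').
    rewrite /lin; under eq_bigr do rewrite mulrBl; rewrite sumrB /=; ring.
  rewrite lD lB; move: (lin t z + b) (lin t' z + b') (\sum_(j <- s') _) => u v S.
  by rewrite cosD cosB; field.
exists (r' ++ r); apply/funext => z.
have /(congr1 (fun h => h z)) e1 := hr; have /(congr1 (fun h => h z)) e2 := hr'.
by rewrite /trig_poly big_cons big_cat /= mulrDl /trig_poly in e1 e2 *; rewrite -e1 -e2.
Qed.

Lemma is_trig_smoothstep N f : is_trig f -> is_trig (fun z => iter N smoothstep (f z)).
Proof.
move=> tf; elim: N => //= N IH.
rewrite (_ : (fun z => _) = fun z => 3 * (iter N smoothstep (f z) * iter N smoothstep (f z)) +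
   (-2) * (iter N smoothstep (f z) * (iter N smoothstep (f z) * iter N smoothstep (f z)))).
  apply: is_trigD; (apply: is_trigM; first exact: is_trig_cst); do ?exact: is_trigM.
  by apply: is_trigM => //; exact: is_trigM.
by apply/funext => z; rewrite /smoothstep; ring.
Qed.

Lemma is_trig_prod I (s : seq I) (F : I -> X -> R) :
  (forall i, is_trig (F i)) -> is_trig (fun z => \prod_(i <- s) F i z).
Proof.
move=> tF; elim: s => [|i s IH].
  by under eq_fun do rewrite big_nil; exact: is_trig_cst.
by under eq_fun do rewrite big_cons; exact: is_trigM.
Qed.

Variables mu nu : probability X R.
Hypothesis mu_nu : forall t b,
  Ex mu (fun z => cos (lin t z + b)) = Ex nu (fun z => cos (lin t z + b)).

Lemma Ex_trig f : is_trig f -> Ex mu f = Ex nu f.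
Proof.
move=> [s ->]; rewrite !Ex_sum => [||]; try by move=> i _; apply: bmfZ; exact: bmf_cos.
by apply: eq_bigr => i _; rewrite !ExZ ?mu_nu//; exact: bmf_cos.
Qed.

(** Dominated convergence for products of functions of one coordinate. Measurability of the limits
    is returned as well because they are the approximants of the next limit. *)
Lemma Ex_agree_cvg (F : nat -> 'I_n -> R -> R) (G : 'I_n -> R -> R) :
  (forall k a, measurable_fun setT (F k a)) -> (forall k a y, 0 <= F k a y <= 1) ->
  (forall a y, F k a y @[k --> \oo] --> G a y) ->
  (forall k, Ex mu (fun z => \prod_(a < n) F k a (z a)) = Ex nu (fun z => \prod_(a < n) F k a (z a))) ->
  (forall a, measurable_fun setT (G a)) /\
  Ex mu (fun z => \prod_(a < n) G a (z a)) = Ex nu (fun z => \prod_(a < n) G a (z a)).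
Proof.
move=> mF F01 FG EF; split.
  by move=> a; apply: (measurable_fun_cvg (fun k => mF k a)) => y _; exact: FG.
have mP k : measurable_fun [set: X] (fun z : X => \prod_(a < n) F k a (z a)).
  apply: (bmf_prod _ (p := xpredT) (F := fun a (z : X) => F k a (z a)) _).1 => a _.
  apply: (@bmf_itv _ _ _ _ 0 1); last by move=> z; exact: F01.
  apply: (measurableT_comp (mF k a)); exact: measurable_coord.
have P1 k (z : X) : `|\prod_(a < n) F k a (z a)| <= 1.
  apply: (big_ind (fun x : R => `|x| <= 1)); first by rewrite normr1.
    by move=> x y hx hy; rewrite normrM -[leRHS]mulr1 ler_pM.
  by move=> a _; have /andP[? ?] := F01 k a (z a); rewrite ger0_norm.
have cv (z : X) : (\prod_(a < n) F k a (z a)) @[k --> \oo] --> \prod_(a < n) G a (z a).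
  elim: (index_enum _) => [|a s IH].
    by rewrite big_nil; under eq_cvg do rewrite big_nil; exact: cvg_cst.
  by rewrite big_cons; under eq_cvg do rewrite big_cons; apply: cvgM IH; exact: FG.
have [_ c1] := Ex_cvg mu mP P1 cv.
have [_ c2] := Ex_cvg nu mP P1 cv.
rewrite (_ : (fun k => Ex mu _) = fun k => Ex nu (fun z => \prod_(a < n) F k a (z a))) in c1; last exact/funext.
exact: cvg_unique c1 c2.
Qed.

(** Three limits in turn: iterating [smoothstep] gives [step] of a sine, letting the period grow
    gives [step] at the thresholds b, and moving these up to c gives closed half-lines. *)
Let half_space_prod : forall c : 'I_n -> R,
  Ex mu (fun z => \prod_(a < n) (0 <= z a - c a)%R%:R) =
  Ex nu (fun z => \prod_(a < n) (0 <= z a - c a)%R%:R).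
Proof.
move=> c.
pose phi (k : nat) (b : 'I_n -> R) (a : 'I_n) (y : R) := (1 + sin ((y - b a) / k.+1%:R)) / 2.
have mphi k b a : measurable_fun setT (phi k b a).
  apply: continuous_measurable_fun => y.
  apply: cvgMr_tmp; apply: cvgD; first exact: cvg_cst.
  apply: continuous_comp; last exact: continuous_sin.
  by apply: cvgMr_tmp; apply: cvgB; [exact: cvg_id|exact: cvg_cst].
have phi01 k b a y : 0 <= phi k b a y <= 1.
  have := sin_geN1 ((y - b a) / k.+1%:R); have := sin_le1 ((y - b a) / k.+1%:R).
  by rewrite /phi => ? ?; apply/andP; split; lra.
have miter N k b a : measurable_fun setT (fun y => iter N smoothstep (phi k b a y)).
  elim: N => //= N IH; rewrite /smoothstep.
  apply: measurable_funB; apply: measurable_funM; try exact: measurable_cst;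
    exact: measurable_funX.
have S1 k b := @Ex_agree_cvg (fun N a (y : R) => iter N smoothstep (phi k b a y))
  (fun a y => step (sin ((y - b a) / k.+1%:R))) (fun N => miter N k b)
  (fun N a y => iter_smoothstep01 N (phi01 k b a y)).
have S1' (k : nat) (b : 'I_n -> R) : (forall a : 'I_n, measurable_fun setT (fun y : R => step (sin ((y - b a) / k.+1%:R)))) /\
  Ex mu (fun z => \prod_(a < n) step (sin ((z a - b a) / k.+1%:R))) =
  Ex nu (fun z => \prod_(a < n) step (sin ((z a - b a) / k.+1%:R))).
  apply: S1 => [a y|N]; first by apply: iter_smoothstep_cvg; rewrite sin_geN1 sin_le1.
  apply: Ex_trig; apply: is_trig_prod => a; apply: is_trig_smoothstep.
  (* The sine is a cosine with phase -pi/2. *)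
  rewrite (_ : (fun z => _) = fun z => 1 / 2 + (1 / 2) *
    cos (lin (fun i => (i == a)%:R / k.+1%:R) z + (- (b a / k.+1%:R) - pi / 2))).
    apply: is_trigD; first exact: is_trig_cst.
    by apply: is_trigM; [exact: is_trig_cst|exact: is_trig_cos].
  apply/funext => z; rewrite /phi.
  have -> : lin (fun i => (i == a)%:R / k.+1%:R) z = z a / k.+1%:R.
    rewrite /lin (bigD1 a)//= eqxx big1 ?addr0; first by rewrite mul1r mulrC.
    by move=> i /negbTE ->; rewrite mul0r mul0r.
  rewrite addrA cosB cos_pihalf sin_pihalf mulr0 add0r mulr1 mulrBl.
  by move: (sin _) => s; field.
have S2 (b : 'I_n -> R) := @Ex_agree_cvg (fun k a (y : R) => step (sin ((y - b a) / k.+1%:R)))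
  (fun a (y : R) => step (y - b a)) (fun k => (S1' k b).1) (fun k a y => step01 _)
  (fun a y => @step_sin_cvg R (y - b a)) (fun k => (S1' k b).2).
have S3 a y : step (y - (c a - k.+1%:R^-1)) @[k --> \oo] --> ((0 <= y - c a)%R%:R : R).
  have := @step_shift_cvg R (y - c a).
  by rewrite (_ : (fun k => step (y - c a + _)) = fun k => step (y - (c a - k.+1%:R^-1)))//;
    apply/funext => k; congr step; ring.
exact: (@Ex_agree_cvg (fun k a (y : R) => step (y - (c a - k.+1%:R^-1)))
  (fun a (y : R) => (0 <= y - c a)%R%:R) (fun k => (S2 _).1) (fun k a y => step01 _)
  S3 (fun k => (S2 _).2)).2.
Qed.

(** The boxes of points with z a >= c a for all a are stable under intersection and generate the
    product sigma-algebra; [half_space_prod] gives their probabilities. *)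
Lemma cramer_wold A : measurable A -> mu A = nu A.
Proof.
apply: (@probability_unique _ _ _
  [set B | exists c : 'I_n -> R, B = [set z : X | forall a, c a <= z a]]).
- suff : fin_prod_measurable (T := fun _ : 'I_n => measurableTypeR R) `<=`
     <<s [set B | exists c : 'I_n -> R, B = [set z : X | forall a, c a <= z a]]>> by [].
  pose S := [set B | exists c : 'I_n -> R, B = [set z : X | forall a, c a <= z a]].
  apply: smallest_sub; first exact: smallest_sigma_algebra.
  move=> _ [k _ [B mB <-]]; rewrite setTI /=.
  suff : measurable_fun [set: g_sigma_algebraType S] (fun x : g_sigma_algebraType S => (x : X) k : R).
    by move=> /(_ measurableT _ mB); rewrite setTI.
  apply: (measurability _ (RGenCInfty.measurableE R)) => _ /= [_ [r ->] <-].
  rewrite setTI.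
  (* A half-line in one coordinate is a countable union of boxes, the other thresholds going to
     minus infinity. *)
  rewrite (_ : _ @^-1` _ = \bigcup_N [set z : X | forall a, (if a == k then r else - N%:R) <= z a]).
    apply: bigcup_measurable => N _; apply: sub_sigma_algebra.
    by exists (fun a => if a == k then r else - N%:R).
  apply/seteqP; split => z /=; rewrite in_itv /= andbT.
    move=> rz; exists (\max_(a < n) (Num.truncn `|z a|).+1)%N => // a.
    case: eqP => [->//|_].
    rewrite lerNl (le_trans (ler_norm _))// normrN (le_trans (ltW (truncnS_gt _)))//.
    by rewrite ler_nat (leq_bigmax (F := fun a => (Num.truncn `|z a|).+1)).
  by move=> [N _ /(_ k)]; rewrite eqxx.
- move=> _ [c ->]; apply: (@measurable_box _ _ (fun=> measurableTypeR R) (fun a => [set y | c a <= y])) => a.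
  by rewrite (_ : [set _ | _] = `[c a, +oo[%classic)//; apply/seteqP; split => y /=; rewrite in_itv /= andbT.
- move=> _ _ [c ->] [c' ->]; exists (fun a => Num.max (c a) (c' a)).
  by apply/seteqP; split => z /= => [[h h'] a|h]; [rewrite ge_max h h'|split => a; have := h a; rewrite ge_max => /andP[]].
- move=> _ [c ->].
  have mc : measurable [set z : X | forall a, c a <= z a].
    apply: (@measurable_box _ _ (fun=> measurableTypeR R) (fun a => [set y | c a <= y])) => a.
    by rewrite (_ : [set _ | _] = `[c a, +oo[%classic)//; apply/seteqP; split => y /=; rewrite in_itv /= andbT.
  rewrite !probE//; congr EFin.
  have h (P : probability X R) : Ex P \1_[set z : X | forall a, c a <= z a] =
      Ex P (fun z => \prod_(a < n) (0 <= z a - c a)%R%:R).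
    apply: eq_Ex => z; rewrite (indic_box (T := fun=> measurableTypeR R) (fun a => [set y | c a <= y])).
    apply: eq_bigr => a _; rewrite indicE subr_ge0; congr (nat_of_bool _)%:R.
    by apply/idP/idP => [/set_mem//|?]; apply/mem_set.
  by rewrite !h half_space_prod.
Qed.

End cramer_wold.

(** [normal_law] with mean 0, bundled as a probability. The parameter is the variance, so that
    convolution adds parameters. *)
HB.lock Definition centred_normal {R : realType} (v : R) : probability (measurableTypeR R) R :=
  if v == 0 then (\d_(0 : measurableTypeR R) : probability (measurableTypeR R) R)
  else (normal_prob 0 (Num.sqrt v) : probability (measurableTypeR R) R).

(** * Multinomial-type normal laws *)

Section normal_laws.
Context {R : realType}.
Local Notation lam := (@lebesgue_measure R).
Local Notation TR := (measurableTypeR R).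

Lemma lebesgue_translation (c : R) (f : TR -> \bar R) :
  measurable_fun setT f -> (forall x, 0 <= f x)%E ->
  (\int[lam]_x f x = \int[lam]_x f (x + c)%R)%E.
Proof.
move=> mf f0.
have mc : measurable_fun [set: TR] ((fun x : R => x + c) : TR -> TR).
  by apply: measurable_funD; [exact: measurable_id|exact: measurable_cst].
transitivity (\int[pushforward lam ((fun x : R => x + c)%R : TR -> TR)]_x f x)%E; last first.
  by rewrite ge0_integral_pushforward// => y _.
apply: eq_measure_integral => A mA _; apply: lebesgue_measure_unique => // _ [[a b]] _ <-.
change (lam `]a, b]%classic = lam ((fun x : R => x + c) @^-1` `]a, b]%classic)).
rewrite (_ : (fun x : R => x + c) @^-1` `]a, b]%classic = `]a - c, b - c]%classic); last first.
  by apply/seteqP; split => x /=; rewrite !in_itv /= => /andP[? ?]; apply/andP; split; lra.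
rewrite !lebesgue_measure_itv /= !lte_fin ltrD2r; case: ifP => // _.
by rewrite -!EFinB opprB addrA subrK.
Qed.

Lemma integral_normal_prob (m s : R) (f : TR -> \bar R) :
  measurable_fun setT f -> (forall x, 0 <= f x)%E ->
  (\int[normal_prob m s]_x f x < +oo)%E ->
  (\int[normal_prob m s]_x f x = \int[lam]_x (f x * (normal_pdf m s x)%:E))%E.
Proof.
move=> mf f0 fy.
have dom := normal_prob_dominates m s.
have mp : measurable_fun setT (fun x : TR => (normal_pdf m s x)%:E).
  by apply/measurable_EFinP; exact: measurable_normal_pdf.
rewrite -(Radon_Nikodym_change_of_variables dom)//=; last first.
  by apply/integrableP; split=> //; under eq_integral do rewrite gee0_abs//.
apply: ae_eq_integral => //.
- apply: emeasurable_funM => //; apply: (measurable_int lam).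
- exact: emeasurable_funM.
- apply: ae_eqe_mul2l => /=.
  rewrite Radon_NikodymE; case: cid => /= h [h1 h2 h3].
  by apply: integral_ae_eq => //= E _ mE; rewrite -h3.
Qed.

Lemma Ex_normal_prob (m s : R) (f : TR -> R) : bmf f -> (forall x, 0 <= f x) ->
  ((Ex (normal_prob m s) f)%:E = \int[lam]_x (f x * normal_pdf m s x)%:E)%E.
Proof.
move=> bf f0; rewrite EFin_Ex// integral_normal_prob//.
- by apply/measurable_EFinP; case: bf.
- by rewrite -EFin_Ex// ltry.
Qed.

(** Completing the square: the joint density of a normal x and a sum y = x + x' is the density of y
    times the conditional density of x given y, which integrates to 1 in x. *)
Lemma normal_pdf_convolution (a b x y : R) : 0 < a -> 0 < b ->
  normal_pdf 0 a x * normal_pdf 0 b (y - x) =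
  normal_pdf 0 (Num.sqrt (a ^+ 2 + b ^+ 2)) y *
  normal_pdf (y * a ^+ 2 / (a ^+ 2 + b ^+ 2)) (a * b / Num.sqrt (a ^+ 2 + b ^+ 2)) x.
Proof.
move=> a0 b0.
have c0 : 0 < a ^+ 2 + b ^+ 2 by rewrite addr_gt0// exprn_gt0.
have sc0 : 0 < Num.sqrt (a ^+ 2 + b ^+ 2) by rewrite sqrtr_gt0.
have d0 : 0 < a * b / Num.sqrt (a ^+ 2 + b ^+ 2) by rewrite divr_gt0// mulr_gt0.
rewrite !normal_pdfE ?gt_eqF// /normal_fun /normal_peak.
rewrite mulrACA [in RHS]mulrACA -!expRD -!invfM -!sqrtrM; try by rewrite mulrn_wge0// mulr_ge0 ?sqr_ge0 ?pi_ge0.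
rewrite !expr_div_n !exprMn !sqr_sqrtr ?(ltW c0)//.
congr (_ * _).
  congr (Num.sqrt _)^-1; rewrite !mulr2n; field.
  by rewrite gt_eqF.
congr expR; rewrite !mulr2n; field.
by rewrite !gt_eqF ?addr_gt0 ?exprn_gt0 ?mulr_gt0.
Qed.

Lemma bmf_addR (f : TR -> R) : bmf f -> bmf (fun z : TR * TR => f (z.1 + z.2)).
Proof.
move=> bf; have ms : measurable_fun setT (fun z : TR * TR => (z.1 + z.2 : TR)).
  by apply: measurable_funD; [exact: measurable_fst|exact: measurable_snd].
exact: (bmf_comp ms bf).
Qed.

(** Adding a constant to f reduces to nonnegative functions, for which densities and Tonelli's
    theorem are available. *)
Lemma convolution_ge0 (P Q S : probability TR R) :
  (forall f : TR -> R, bmf f -> (forall x, 0 <= f x) ->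
     Ex P (fun x => Ex Q (fun y => f (x + y))) = Ex S f) ->
  forall f : TR -> R, bmf f -> Ex P (fun x => Ex Q (fun y => f (x + y))) = Ex S f.
Proof.
move=> H f bf; have [_ [M fM]] := bf.
have bg : bmf (fun x => f x + M) by apply: bmfD => //; exact: bmf_cst.
have bs := bmf_addR bf.
have := H _ bg; rewrite (ExD S bf (bmf_cst M)) Ex_cst.
rewrite (eq_Ex P (g := fun x => Ex Q (fun y => f (x + y)) + M)); last first.
  by move=> x; rewrite (ExD Q (bmf_snd x bs) (bmf_cst M)) Ex_cst.
rewrite (ExD P (bmf_Ex_snd Q bs) (bmf_cst M)) Ex_cst => H'.
apply: (addIr M); apply: H' => x.
by have := fM x; rewrite ler_norml => /andP[]; rewrite -lerBlDr sub0r.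
Qed.

Lemma normal_convolution (a b : R) (f : TR -> R) : 0 < a -> 0 < b -> bmf f ->
  Ex (normal_prob 0 a) (fun x => Ex (normal_prob 0 b) (fun y => f (x + y))) =
  Ex (normal_prob 0 (Num.sqrt (a ^+ 2 + b ^+ 2))) f.
Proof.
move=> a0 b0.
move=> bf; move: f bf; apply: convolution_ge0 => f bf f0.
have mf := bf.1.
have bs := bmf_addR bf.
apply: EFin_inj.
have E1 : ((Ex (normal_prob 0 a) (fun x : TR => Ex (normal_prob 0 b) (fun y : TR => f (x + y))))%:E =
  \int[lam]_x (Ex (normal_prob 0 b) (fun y : TR => f (x + y)) * normal_pdf 0 a x)%:E)%E.
  apply: Ex_normal_prob; first exact: (bmf_Ex_snd _ bs).
  by move=> x; exact: Ex_ge0.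
rewrite {}E1 (Ex_normal_prob 0 (Num.sqrt (a ^+ 2 + b ^+ 2)) bf f0).
pose F (z : TR * TR) : \bar R := (f z.2 * (normal_pdf 0 a z.1 * normal_pdf 0 b (z.2 - z.1)))%:E.
have mF : measurable_fun setT F.
  apply/measurable_EFinP; apply: measurable_funM.
    exact: (measurableT_comp mf measurable_snd).
  apply: measurable_funM.
    exact: (measurableT_comp (measurable_normal_pdf 0 a) measurable_fst).
  apply: (measurableT_comp (measurable_normal_pdf 0 b)).
  by apply: measurable_funB; [exact: measurable_snd|exact: measurable_fst].
have F0 z : (0 <= F z)%E.
  by rewrite lee_fin mulr_ge0// mulr_ge0// normal_pdf_ge0.
transitivity (\int[lam]_x \int[lam]_y F (x, y))%E.
  apply: eq_integral => x _.
  rewrite EFinM (Ex_normal_prob 0 b (bmf_snd x bs) (fun y => f0 (x + y))).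
  rewrite -ge0_integralZr//; first last.
  - by rewrite lee_fin normal_pdf_ge0.
  - by move=> y _; rewrite lee_fin mulr_ge0// normal_pdf_ge0.
  - apply/measurable_EFinP; apply: measurable_funM; last exact: measurable_normal_pdf.
    exact: (bmf_snd x bs).1.
  rewrite [RHS](lebesgue_translation x)//; last first.
    by apply: (measurableT_comp mF); exact: pair1_measurable.
  apply: eq_integral => y _; rewrite /F /= -EFinM; congr EFin.
  by rewrite addrK [y + x]addrC; ring.
rewrite (fubini_tonelli F)//.
apply: eq_integral => y _.
under eq_integral do rewrite /F /= normal_pdf_convolution// mulrA EFinM.
rewrite ge0_integralZl//.
- by rewrite integral_normal_pdf mule1.
- by apply/measurable_EFinP; exact: measurable_normal_pdf.
- by move=> x _; rewrite lee_fin normal_pdf_ge0.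
- by rewrite lee_fin mulr_ge0// normal_pdf_ge0.
Qed.

Lemma centred_normalE (v : R) A : centred_normal v A = normal_law 0 v A.
Proof. by rewrite unlock /normal_law; case: eqP. Qed.

Lemma Ex_dirac (x : TR) (f : TR -> R) : bmf f -> Ex (\d_x : probability TR R) f = f x.
Proof.
move=> bf; apply: EFin_inj; rewrite EFin_Ex// integral_dirac//.
  by rewrite diracT mul1e.
by apply/measurable_EFinP; case: bf.
Qed.

Lemma Ex_centred_normal0 (f : TR -> R) : bmf f -> Ex (centred_normal 0) f = f 0.
Proof. by move=> bf; rewrite centred_normal.unlock eqxx; exact: Ex_dirac. Qed.

Lemma centred_normal_convolution (u v : R) (f : TR -> R) : 0 <= u -> 0 <= v -> bmf f ->
  Ex (centred_normal u) (fun x => Ex (centred_normal v) (fun y => f (x + y))) =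
  Ex (centred_normal (u + v)) f.
Proof.
move=> u0 v0 bf.
have bs := bmf_addR bf.
rewrite centred_normal.unlock; have [->|u1] := eqVneq u 0.
  rewrite Ex_dirac; last exact: (bmf_Ex_snd _ bs).
  by rewrite add0r; apply: eq_Ex => y; rewrite add0r.
have [->|v1] := eqVneq v 0.
  rewrite addr0 (negbTE u1); apply: eq_Ex => x.
  by rewrite Ex_dirac ?addr0//; exact: (bmf_snd x bs).
have u2 : 0 < u by rewrite lt_neqAle eq_sym u1.
have v2 : 0 < v by rewrite lt_neqAle eq_sym v1.
rewrite gt_eqF ?addr_gt0//.
have su : 0 < Num.sqrt u by rewrite sqrtr_gt0.
have sv : 0 < Num.sqrt v by rewrite sqrtr_gt0.
by have := normal_convolution su sv bf; rewrite !sqr_sqrtr.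
Qed.

(** The variances add one coordinate at a time by convolution. The scaling rule of centred normals
    is a hypothesis, which [gaussian_product_law] supplies. *)
Lemma Ex_lin_product (n : nat) (s : 'I_n -> R) (t : 'I_n -> R)
    (nu : probability (rvec R n) R) :
  product_law (fun k => centred_normal (s k)) nu -> (forall k, 0 <= s k) ->
  (forall k (g : TR -> R), bmf g -> Ex (centred_normal (s k)) (fun x => g (t k * x)) =
     Ex (centred_normal (t k ^+ 2 * s k)) g) ->
  forall g : TR -> R, bmf g -> Ex nu (fun z => g (lin t z)) =
    Ex (centred_normal (\sum_k t k ^+ 2 * s k)) g.
Proof.
elim: n s t nu => [|n IH] s t nu hnu s0 hs g bg.
  rewrite big_ord0 (Ex_centred_normal0 bg) -[RHS](Ex_cst nu).
  by apply: eq_Ex => z; rewrite /lin big_ord0.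
have [nu' hnu' E] := product_law_tail hnu.
rewrite E; last first.
  by apply: (bmf_comp (phi := lin t)) => //; exact: measurable_lin.
have h1 : 0 <= t ord0 ^+ 2 * s ord0 by rewrite mulr_ge0 ?sqr_ge0.
have h2 : 0 <= \sum_(k < n) t (lift ord0 k) ^+ 2 * s (lift ord0 k).
  by apply: sumr_ge0 => k _; rewrite mulr_ge0 ?sqr_ge0.
rewrite big_ord_recl -(centred_normal_convolution h1 h2 bg).
have bs := bmf_addR bg.
rewrite -[RHS]hs; last exact: (bmf_Ex_snd _ bs).
apply: eq_Ex => x.
have bx : bmf (fun y : TR => g (t ord0 * x + y)) := bmf_snd (t ord0 * x) bs.
have := IH _ _ _ hnu' (fun k => s0 _) (fun k => hs _) _ bx.
move=> <-; apply: eq_Ex => y; congr g.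
rewrite /lin big_ord_recl /fcons dcons0; congr (_ + _).
by apply: eq_bigr => k _; rewrite dconsS.
Qed.

(** Jointly normal and uncorrelated implies independent: the linear forms have the same laws as
    under the product law, and [cramer_wold] identifies the two. *)
Lemma gaussian_product_law (n : nat) (s : 'I_n -> R) (mu : probability (rvec R n) R) :
  (forall k, 0 <= s k) ->
  (forall (t : 'I_n -> R) (A : set TR), measurable A ->
     mu [set z : rvec R n | A (lin t z)] = normal_law 0 (\sum_k t k ^+ 2 * s k) A) ->
  product_law (fun k => centred_normal (s k)) mu.
Proof.
move=> s0 hmu.
have [nu hnu] := product_law_exists (fun k => centred_normal (s k)).
have mlin t : @measurable_fun _ _ (rvec R n) TR setT (lin t) by exact: measurable_lin.
have Emu t (g : TR -> R) : bmf g ->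
    Ex mu (fun z => g (lin t z)) = Ex (centred_normal (\sum_k t k ^+ 2 * s k)) g.
  move=> bg; rewrite -[LHS]/(Ex mu (g \o lin t)) -(Ex_push mu (mlin t) bg).
  apply: eq_measure_Ex => A mA; rewrite pushE centred_normalE -hmu//.
(* The scaling rule is read off from [mu] itself: z k and t k z k are both linear forms, with
   variances s k and (t k)^2 s k by hypothesis. *)
have scal (t : 'I_n -> R) k (g : TR -> R) : bmf g -> Ex (centred_normal (s k)) (fun x => g (t k * x)) =
     Ex (centred_normal (t k ^+ 2 * s k)) g.
  move=> bg.
  pose e (c : R) i := if i == k then c else 0.
  have es c : \sum_i e c i ^+ 2 * s i = c ^+ 2 * s k.
    rewrite (bigD1 k)//= /e eqxx big1 ?addr0// => i /negbTE ->.
    by rewrite expr0n mul0r.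
  have le c z : lin (e c) z = c * z k.
    rewrite /lin (bigD1 k)//= /e eqxx big1 ?addr0// => i /negbTE ->.
    by rewrite mul0r.
  rewrite -es -Emu//.
  have bt : bmf (fun x : TR => g (t k * x)).
    apply: (bmf_comp (phi := fun x : TR => (t k * x : TR))) => //.
    by apply: measurable_funM; [exact: measurable_cst|exact: measurable_id].
  have := Emu (e 1) _ bt; rewrite es expr1n mul1r => <-.
  by apply: eq_Ex => z; rewrite !le mul1r.
have mn : forall A, measurable A -> mu A = nu A.
  apply: cramer_wold => t b.
  have bc : bmf (fun x : TR => cos (x + b)).
    apply: (@bmf_itv _ _ _ _ (-1) 1).
      apply: measurableT_comp; first by apply: continuous_measurable_fun; exact: continuous_cos.
      by apply: measurable_funD; [exact: measurable_id|exact: measurable_cst].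
    by move=> z; rewrite cos_geN1 cos_le1.
  rewrite (Emu t _ bc); symmetry.
  exact: (Ex_lin_product hnu s0 (fun k g => scal t k g) bc).
by move=> A mA; rewrite mn ?hnu//; exact: measurable_box.
Qed.

End normal_laws.

Section one_cell.
Context {R : realType}.
Local Notation lam := (@lebesgue_measure R).
Local Notation TR := (measurableTypeR R).

Definition uniform01 : probability TR R := uniform_prob (@ltr01 R).

(** Makes the noise lie in [0, 1) at every sample point and not only almost surely. *)
Definition clip (u : R) : R := if 0 <= u < 1 then u else 0.

Lemma clip01 u : 0 <= clip u < 1.
Proof. by rewrite /clip; case: ifP => // _; rewrite lexx ltr01. Qed.

Lemma measurable_clip : measurable_fun setT (clip : TR -> TR).
Proof.
apply: measurable_fun_ifT; [|exact: measurable_id|exact: measurable_cst].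
apply: measurable_and.
  by apply: measurable_fun_ler; [exact: measurable_cst|exact: measurable_id].
by apply: measurable_fun_ltr; [exact: measurable_id|exact: measurable_cst].
Qed.

Lemma bmf_normal_pdf (s : R) : s != 0 -> bmf (normal_pdf 0 s : TR -> R).
Proof.
move=> s0; apply: (@bmf_itv _ _ _ _ 0 (normal_peak s)).
  exact: measurable_normal_pdf.
by move=> x; rewrite normal_pdf_ge0 normal_pdf_ub.
Qed.

(** The left side is the part over [c, c + 1) of the integral of h against the normal density; what
    is left out is nonnegative. *)
Lemma normal_cell (t2 c : R) (h : TR -> R) : 0 < t2 -> bmf h -> (forall x, 0 <= h x) ->
  Ex uniform01 (fun u => h (c + clip u) * normal_pdf 0 (Num.sqrt t2) (c + clip u)) <=
  Ex (centred_normal t2) h.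
Proof.
move=> t20 bh h0; have st : Num.sqrt t2 != 0 by rewrite gt_eqF ?sqrtr_gt0.
rewrite centred_normal.unlock gt_eqF//.
pose g (x : TR) : R := h x * normal_pdf 0 (Num.sqrt t2) x.
have bg : bmf g := bmfM bh (bmf_normal_pdf st).
have g0 x : 0 <= g x by rewrite mulr_ge0 ?normal_pdf_ge0.
have mc : measurable_fun setT (fun u : TR => (c + clip u : TR)).
  by apply: measurable_funD; [exact: measurable_cst|exact: measurable_clip].
have bgc : bmf (fun u : TR => g (c + clip u)) := bmf_comp mc bg.
rewrite -lee_fin (Ex_normal_prob 0 (Num.sqrt t2) bh h0) EFin_Ex//.
rewrite integral_uniform; first last.
- by move=> u; rewrite lee_fin; exact: g0.
- by apply/measurable_EFinP; exact: bgc.1.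
rewrite subr0 invr1 mul1e.
have mg : measurable_fun setT (fun x : TR => (g x)%:E) by apply/measurable_EFinP; exact: bg.1.
rewrite [leRHS](lebesgue_translation c mg); last by move=> x; rewrite lee_fin; exact: g0.
have mgc : measurable_fun setT (fun x : TR => (g (x + c))%:E).
  apply: (measurableT_comp mg).
  by apply: measurable_funD; [exact: measurable_id|exact: measurable_cst].
rewrite -integral_itv_bndo_bndc; last by apply: measurable_funTS; apply/measurable_EFinP; exact: bgc.1.
apply: (@le_trans _ _ (\int[lam]_(x in `[0%R, 1%R[) (g (x + c))%:E)%E).
  rewrite le_eqVlt; apply/orP; left; apply/eqP; apply: eq_integral => x.
  by rewrite inE /= in_itv /= => x01; rewrite /clip x01 [c + x]addrC.
apply: ge0_subset_integral => //.
by move=> x _; rewrite lee_fin; exact: g0.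
Qed.

End one_cell.

(** * Successive regressions for the multinomial covariance *)

Section triangular.
Context {R : realType}.
Local Notation TR := (measurableTypeR R).
Variable m : R.

(** Probability left after the first k cells. The total M is arbitrary, so that removing the first
    cell leaves a problem of the same shape with total [M - q ord0]. *)
Definition mass {d} (M : R) (q : 'I_d -> R) (k : nat) : R := M - \sum_(i < d | (i < k)%N) q i.

Lemma mass0 d M (q : 'I_d -> R) : mass M q 0 = M.
Proof. by rewrite /mass big_pred0 ?subr0. Qed.

Lemma massS d M (q : 'I_d.+1 -> R) k :
  mass M q k.+1 = mass (M - q ord0) (fun i => q (lift ord0 i)) k.
Proof. by rewrite /mass big_mkcond big_ord_recl /= -big_mkcond /= opprD addrA. Qed.

Lemma mass_gt0 d M (q : 'I_d -> R) k : (forall i, 0 < q i) -> \sum_i q i < M -> 0 < mass M q k.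
Proof.
move=> q0 qM; rewrite /mass subr_gt0; apply: le_lt_trans qM.
rewrite [leRHS](bigID (fun i : 'I_d => (i < k)%N)) /= lerDl.
by apply: sumr_ge0 => i _; exact: ltW.
Qed.

(** For the multinomial covariance, the regression of a coordinate on the earlier ones involves only
    the sum of their deviations, with coefficient minus [slope]; [tau2] is the residual variance. *)
Definition slope {d} (M : R) (q : 'I_d -> R) (k : 'I_d) : R := q k / mass M q k.

Definition tau2 {d} (M : R) (q : 'I_d -> R) (k : 'I_d) : R :=
  m * (q k * mass M q k.+1 / mass M q k).

Lemma slopeS d M (q : 'I_d.+1 -> R) k :
  slope M q (lift ord0 k) = slope (M - q ord0) (fun i => q (lift ord0 i)) k.
Proof. by rewrite /slope massS. Qed.

Lemma tau2S d M (q : 'I_d.+1 -> R) k :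
  tau2 M q (lift ord0 k) = tau2 (M - q ord0) (fun i => q (lift ord0 i)) k.
Proof. by rewrite /tau2 !massS. Qed.

Lemma slope0 d M (q : 'I_d.+1 -> R) : slope M q ord0 = q ord0 / M.
Proof. by rewrite /slope mass0. Qed.

Lemma tau20 d M (q : 'I_d.+1 -> R) : tau2 M q ord0 = m * (q ord0 * (M - q ord0) / M).
Proof. by rewrite /tau2 massS !mass0. Qed.

Lemma tau2_gt0 d M (q : 'I_d -> R) k : 0 < m -> (forall i, 0 < q i) -> \sum_i q i < M ->
  0 < tau2 M q k.
Proof.
by move=> m0 q0 qM; rewrite /tau2 mulr_gt0// divr_gt0 ?mulr_gt0 ?mass_gt0.
Qed.

(* The residual of the k-th coordinate after regression on the previous ones. *)
Definition resid {d} (M : R) (q : 'I_d -> R) (sigma : R) (v : rvec R d) : rvec R d :=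
  fun k => v k - m * q k + slope M q k * (sigma + \sum_(i < d | (i < k)%N) (v i - m * q i)).

Lemma resid0 d M (q : 'I_d.+1 -> R) sigma v :
  resid M q sigma v ord0 = v ord0 - m * q ord0 + q ord0 / M * sigma.
Proof. by rewrite /resid slope0 big_pred0 ?addr0. Qed.

Lemma residS d M (q : 'I_d.+1 -> R) sigma v k :
  resid M q sigma v (lift ord0 k) =
  resid (M - q ord0) (fun i => q (lift ord0 i)) (sigma + (v ord0 - m * q ord0))
    (fun i => v (lift ord0 i)) k.
Proof.
rewrite /resid slopeS; congr (_ + _ * _).
by rewrite big_mkcond big_ord_recl /= -big_mkcond /= addrA.
Qed.

(** Solves the triangular system one coordinate at a time; [sigma] carries the sum of the deviations
    already recovered. *)
Fixpoint unresid {d} : R -> ('I_d -> R) -> R -> rvec R d -> rvec R d :=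
  match d return R -> ('I_d -> R) -> R -> rvec R d -> rvec R d with
  | 0 => fun _ _ _ w => w
  | d'.+1 => fun M q sigma w =>
      let v0 := w ord0 + m * q ord0 - q ord0 / M * sigma in
      fcons (T := fun=> TR) (v0, unresid (M - q ord0) (fun i => q (lift ord0 i))
        (sigma + (v0 - m * q ord0)) (fun i => w (lift ord0 i)))
  end.

Lemma unresidK d M (q : 'I_d -> R) sigma v : unresid M q sigma (resid M q sigma v) = v.
Proof.
elim: d M q sigma v => [|d IH] M q sigma v /=.
  by apply/funext => -[].
rewrite resid0.
have -> : v ord0 - m * q ord0 + q ord0 / M * sigma + m * q ord0 - q ord0 / M * sigma = v ord0.
  by ring.
rewrite (_ : (fun i => resid M q sigma v (lift ord0 i)) =
  resid (M - q ord0) (fun i => q (lift ord0 i)) (sigma + (v ord0 - m * q ord0))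
    (fun i => v (lift ord0 i))); last by apply/funext => k; exact: residS.
by rewrite IH; exact: (dcons_eta (T := fun=> R) v).
Qed.

Lemma measurable_unresid d M (q : 'I_d -> R) :
  measurable_fun setT (fun z : TR * rvec R d => unresid M q z.1 z.2).
Proof.
elim: d M q => [|d IH] M q /=; first exact: measurable_snd.
have mw k : measurable_fun setT (fun z : TR * rvec R d.+1 => z.2 k : TR).
  exact: (measurableT_comp (@measurable_coord _ _ (fun=> TR) k) (@measurable_snd _ _ _ _)).
have mv0 : measurable_fun setT (fun z : TR * rvec R d.+1 => (z.2 ord0 + m * q ord0 - q ord0 / M * z.1 : TR)).
  apply: measurable_funB.
    by apply: measurable_funD; [exact: mw|exact: measurable_cst].
  by apply: measurable_funM; [exact: measurable_cst|exact: measurable_fst].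
have mp : measurable_fun setT (fun z : TR * rvec R d.+1 =>
   ((z.1 + (z.2 ord0 + m * q ord0 - q ord0 / M * z.1 - m * q ord0)) : TR,
     (fun i => z.2 (lift ord0 i)) : rvec R d)).
  apply/measurable_fun_pairP; split.
    apply: measurable_funD; first exact: measurable_fst.
    by apply: measurable_funB => //; exact: measurable_cst.
  by apply: measurable_fun_fin_prod => k; exact: mw.
apply: (measurableT_comp (@measurable_fcons _ _ (fun=> TR))).
apply/measurable_fun_pairP; split => //=.
exact: (measurableT_comp (IH (M - q ord0) (fun i => q (lift ord0 i))) mp).
Qed.

(** A normal density in d variables written as a product: the residuals are independent, and passing
    to them is triangular with unit diagonal, hence preserves volume. *)
Definition resid_pdf {d} (M : R) (q : 'I_d -> R) (sigma : R) (v : rvec R d) : R :=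
  \prod_(k < d) normal_pdf 0 (Num.sqrt (tau2 M q k)) (resid M q sigma v k).

Lemma resid_pdf_ge0 d M (q : 'I_d -> R) sigma v : 0 <= resid_pdf M q sigma v.
Proof. by apply: prodr_ge0 => k _; exact: normal_pdf_ge0. Qed.

Lemma measurable_resid d M (q : 'I_d -> R) k :
  measurable_fun setT (fun z : TR * rvec R d => resid M q z.1 z.2 k : TR).
Proof.
have mw i : measurable_fun setT (fun z : TR * rvec R d => z.2 i : TR).
  exact: (measurableT_comp (@measurable_coord _ _ (fun=> TR) i) (@measurable_snd _ _ _ _)).
have mc i : measurable_fun setT (fun z : TR * rvec R d => z.2 i - m * q i : TR).
  by apply: measurable_funB; [exact: mw|exact: measurable_cst].
apply: measurable_funD; first exact: mc.
apply: measurable_funM; first exact: measurable_cst.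
apply: measurable_funD; first exact: measurable_fst.
rewrite (_ : (fun z => _) = fun z : TR * rvec R d =>
  \sum_(i < d) (if (i < k)%N then z.2 i - m * q i else 0)); last first.
  by apply/funext => z; exact: big_mkcond.
by apply: measurable_sum => i; case: (i < k)%N; [exact: mc|exact: measurable_cst].
Qed.

Lemma bmf_resid_pdf d M (q : 'I_d -> R) : 0 < m -> (forall i, 0 < q i) -> \sum_i q i < M ->
  bmf (fun z : TR * rvec R d => resid_pdf M q z.1 z.2).
Proof.
move=> m0 q0 qM; apply: bmf_prod => k _.
have st : Num.sqrt (tau2 M q k) != 0 by rewrite gt_eqF ?sqrtr_gt0 ?tau2_gt0.
exact: (bmf_comp (measurable_resid M q k) (bmf_normal_pdf st)).
Qed.

Definition cell_point {d} (nu : 'I_d -> R) (u : rvec R d) : rvec R d :=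
  fun k => nu k + clip (u k).

Lemma measurable_cell_point d (nu : 'I_d -> R) : measurable_fun setT (cell_point nu).
Proof.
apply: measurable_fun_fin_prod => k; apply: measurable_funD; first exact: measurable_cst.
by apply: (measurableT_comp measurable_clip); exact: measurable_coord.
Qed.

(** Given the first residual, the others form the same problem with total [M - q ord0] and a shifted
    [sigma]; the induction therefore needs [normal_cell] in one variable only. *)
Lemma gaussian_cell d M (q : 'I_d -> R) (sigma : R) (nu : 'I_d -> R)
    (G U : probability (rvec R d) R) (F : rvec R d -> R) :
  0 < m -> (forall i, 0 < q i) -> \sum_i q i < M ->
  product_law (fun k => centred_normal (tau2 M q k)) G ->
  product_law (fun=> uniform01) U -> bmf F -> (forall v, 0 <= F v) ->
  Ex U (fun u => F (cell_point nu u) * resid_pdf M q sigma (cell_point nu u)) <=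
  Ex G (fun w => F (unresid M q sigma w)).
Proof.
move=> m0; elim: d M q sigma nu G U F => [|d IH] M q sigma nu G U F q0 qM hG hU bF F0.
  have un0 (v v' : rvec R 0) : v = v' by apply/funext => -[].
  rewrite (eq_Ex U (g := fun=> F point)); last first.
    by move=> u; rewrite /resid_pdf big_ord0 mulr1; congr F; exact: un0.
  rewrite (eq_Ex G (g := fun=> F point)); last by move=> u; congr F; exact: un0.
  by rewrite !Ex_cst.
have [G' hG' EG] := product_law_tail hG.
have [U' hU' EU] := product_law_tail hU.
set q' := fun i => q (lift ord0 i); set M' := M - q ord0.
have q'0 i : 0 < q' i by exact: q0.
have q'M : \sum_i q' i < M' by move: qM; rewrite big_ord_recl /M' ltrBrDl.
have t0 : 0 < tau2 M q ord0 by exact: tau2_gt0.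
have munr := measurable_unresid M q.
have mres := measurable_cell_point nu.
(* The first coordinate is the first residual plus b. *)
pose b := m * q ord0 - q ord0 / M * sigma.
pose nu' i := nu (lift ord0 i).
pose K (z : TR * rvec R d) := F (fcons (z.1 + b, cell_point nu' z.2)) *
  resid_pdf M' q' (sigma + (z.1 + b - m * q ord0)) (cell_point nu' z.2).
have mb : measurable_fun setT (fun z : TR * rvec R d => (z.1 + b : TR)).
  by apply: measurable_funD; [exact: measurable_fst|exact: measurable_cst].
have mc' : measurable_fun setT (fun z : TR * rvec R d => cell_point nu' z.2).
  exact: (measurableT_comp (@measurable_cell_point _ nu') (@measurable_snd _ _ _ _)).
have bK : bmf K.
  apply: bmfM.
    apply: (bmf_comp (phi := fun z : TR * rvec R d => fcons (T := fun=> TR) (z.1 + b, cell_point nu' z.2))) => //.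
    apply: (measurableT_comp (@measurable_fcons _ _ (fun=> TR))).
    exact/measurable_fun_pairP.
  apply: (bmf_comp (phi := fun z : TR * rvec R d => (sigma + (z.1 + b - m * q ord0) : TR, cell_point nu' z.2)) _
    (bmf_resid_pdf m0 q'0 q'M)).
  apply/measurable_fun_pairP; split => //=.
  apply: measurable_funD; first exact: measurable_cst.
  by apply: measurable_funB => //; exact: measurable_cst.
have K0 z : 0 <= K z by rewrite mulr_ge0 ?resid_pdf_ge0.
pose H x := Ex U' (fun u => K (x, u)).
have bH : bmf H := bmf_Ex_snd U' bK.
have bFu : bmf (fun w => F (unresid M q sigma w)).
  apply: (bmf_comp (phi := fun w => unresid M q sigma w)) => //.
  exact: (measurableT_comp munr (pair1_measurable sigma)).
have bFuc : bmf (fun z : TR * rvec R d => F (unresid M q sigma (fcons (T := fun=> TR) z))).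
  exact: (bmf_comp (@measurable_fcons _ _ (fun=> TR)) bFu).
rewrite EG//.
apply: (@le_trans _ _ (Ex (centred_normal (tau2 M q ord0)) H)); last first.
  apply: le_Ex => //; first exact: (bmf_Ex_snd G' bFuc).
  move=> x; pose F' v := F (fcons (T := fun=> TR) (x + b, v)).
  have bF' : bmf F'.
    apply: (bmf_comp (phi := fun v => fcons (T := fun=> TR) (x + b, v))) => //.
    exact: (measurableT_comp (@measurable_fcons _ _ (fun=> TR)) (pair1_measurable _)).
  have hG'' : product_law (fun k => centred_normal (tau2 M' q' k)) G'.
    by move=> A mA; rewrite hG'//; apply: eq_bigr => k _; rewrite tau2S.
  have := IH M' q' (sigma + (x + b - m * q ord0)) nu' G' U' F' q'0 q'M hG'' hU' bF' (fun v => F0 _).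
  congr (_ <= _); apply: eq_Ex => w; congr F.
  have e0 : fcons (T := fun=> TR) (x, w) ord0 = x := dcons0 (T := fun=> TR) _ _.
  have eS : (fun i => fcons (T := fun=> TR) (x, w) (lift ord0 i)) = w.
    by apply/funext => i; exact: (dconsS (T := fun=> TR)).
  by rewrite /= e0 eS /b addrA.
have bEU : bmf (fun u => F (cell_point nu u) * resid_pdf M q sigma (cell_point nu u)).
  apply: bmfM; first exact: (bmf_comp mres bF).
  apply: (bmf_comp (phi := fun u => (sigma : TR, cell_point nu u)) _ (bmf_resid_pdf m0 q0 qM)).
  exact: (measurableT_comp (pair1_measurable _) mres).
rewrite EU//.
have := normal_cell (nu ord0 - b) t0 bH (fun x => Ex_ge0 U' (fun u => K0 (x, u))).
apply: le_trans; rewrite le_eqVlt; apply/orP; left; apply/eqP.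
apply: eq_Ex => u0; rewrite mulrC /H -ExZ; last exact: (bmf_snd _ bK).
apply: eq_Ex => u; rewrite /K /= [RHS]mulrC -mulrA; congr (F _ * _).
  rewrite (_ : nu ord0 - b + clip u0 + b = nu ord0 + clip u0); last by ring.
  apply/functional_extensionality_dep => k; rewrite /cell_point /fcons /=.
  by case: (unliftP ord0 k) => [j ->|->]; rewrite ?dcons0 ?dconsS.
rewrite /resid_pdf big_ord_recl mulrC; congr (_ * _).
  congr (normal_pdf _ _ _); rewrite resid0 /cell_point /fcons dcons0 /b; ring.
have es : sigma + (cell_point nu (fcons (T := fun=> TR) (u0, u)) ord0 - m * q ord0) =
    sigma + (nu ord0 - b + clip u0 + b - m * q ord0).
  by rewrite /cell_point /fcons dcons0; ring.
have ev : (fun i => cell_point nu (fcons (T := fun=> TR) (u0, u)) (lift ord0 i)) = cell_point nu' u.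
  by apply/funext => i; rewrite /cell_point /fcons dconsS.
by apply: eq_bigr => k _; rewrite tau2S residS es ev.
Qed.

(* Any linear form in the residuals is a linear form in the coordinates whose
   multinomial variance is that of independent residuals. *)
Lemma resid_lin d M (q : 'I_d -> R) (t : 'I_d -> R) :
  (forall i, 0 < q i) -> \sum_i q i < M ->
  exists (s : 'I_d -> R) (S : R), [/\
    forall sigma v, lin t (resid M q sigma v) = \sum_i s i * (v i - m * q i) + sigma * S,
    \sum_i q i * s i = M * S &
    m * (\sum_i q i * s i ^+ 2 - M * S ^+ 2) = \sum_k t k ^+ 2 * tau2 M q k].
Proof.
elim: d M q t => [|d IH] M q t q0 qM.
  exists (fun=> 0), 0; split.
  - by move=> sigma v; rewrite /lin !big_ord0 mulr0 addr0.
  - by rewrite big_ord0 mulr0.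
  - by rewrite !big_ord0 expr0n /= mulr0 subr0 mulr0.
have q'0 i : 0 < q (lift ord0 i) by exact: q0.
have q'M : \sum_i q (lift ord0 i) < M - q ord0 by move: qM; rewrite big_ord_recl ltrBrDl.
have M0 : 0 < M.
  by apply: le_lt_trans qM; apply: sumr_ge0 => i _; exact: ltW.
have [s [S [h1 h2 h3]]] := IH _ _ (fun i => t (lift ord0 i)) q'0 q'M.
(* The tail is computed with [sigma] increased by the first deviation, whose coefficient is thus t 0
   from its own residual plus S from the tail. *)
exists (dcons (T := fun=> R) (t ord0 + S) s), (t ord0 * (q ord0 / M) + S); split.
- move=> sigma v; rewrite /lin !big_ord_recl resid0 dcons0.
  under eq_bigr do rewrite residS.
  rewrite -/(lin (fun i => t (lift ord0 i)) _) h1.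
  under [in RHS]eq_bigr do rewrite dconsS.
  move: (\sum_(i < d) _) => A; ring.
- rewrite big_ord_recl dcons0; under eq_bigr do rewrite dconsS.
  by rewrite h2; field; rewrite gt_eqF.
- rewrite !big_ord_recl dcons0; under eq_bigr do rewrite dconsS.
  under [in RHS]eq_bigr do rewrite tau2S.
  rewrite -h3 tau20; move: (\sum_(i < d) _) => A.
  by field; rewrite gt_eqF.
Qed.

End triangular.

Lemma Ex_event_le {R : realType} {d : measure_display} {X : measurableType d}
  (P : probability X R) (A : set X) (f g : X -> R) (c : R) :
  measurable A -> bmf f -> bmf g -> (forall x, A x -> f x <= g x) ->
  (forall x, f x - g x <= c) -> Ex P f <= Ex P g + c * fine (P (~` A)).
Proof.
move=> mA bf bg fg fgc.
have mAc : measurable (~` A) by exact: measurableC.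
rewrite -Ex_indic// -ExZ; last exact: bmf_indic.
rewrite -ExD//; last by apply: bmfZ; exact: bmf_indic.
apply: le_Ex => // [|x].
  by apply: bmfD => //; apply: bmfZ; exact: bmf_indic.
rewrite indicE; have [xA|xA] := boolP (x \in ~` A).
  by rewrite mulr1 -lerBlDl.
by rewrite mulr0 addr0 fg//; apply: contrapT; move: xA; rewrite notin_setE.
Qed.

Lemma eq_Ex_as {R : realType} {d : measure_display} {X : measurableType d}
  (P : probability X R) (A : set X) (f g : X -> R) :
  measurable A -> P A = 1%E -> bmf f -> bmf g -> (forall x, A x -> f x = g x) -> Ex P f = Ex P g.
Proof.
move=> mA PA bf bg fg.
have PAc : fine (P (~` A)) = 0 by rewrite probability_setC// PA subee.
have [_ [M fM]] := bf; have [_ [N gN]] := bg.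
have h (f1 g1 : X -> R) x : `|f1 x| <= M -> `|g1 x| <= N -> f1 x - g1 x <= M + N.
  by rewrite !ler_norml => /andP[? ?] /andP[? ?]; lra.
apply/eqP; rewrite eq_le; apply/andP; split.
  rewrite -[leRHS]addr0 -(mulr0 (M + N)) -PAc; apply: Ex_event_le => //.
    by move=> x Ax; rewrite fg.
  by move=> x; exact: h.
rewrite -[leRHS]addr0 -(mulr0 (M + N)) -PAc; apply: Ex_event_le => //.
  by move=> x Ax; rewrite fg.
by move=> x; have := fM x; have := gN x; rewrite !ler_norml => /andP[? ?] /andP[? ?]; lra.
Qed.

Lemma probability_setI1 {R : realType} {d : measure_display} {X : measurableType d}
  (P : probability X R) (A B : set X) : measurable A -> measurable B ->
  P A = 1%E -> P B = 1%E -> P (A `&` B) = 1%E.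
Proof.
move=> mA mB PA PB.
have bA := bmf_indic (R := R) mA; have bB := bmf_indic (R := R) mB.
rewrite probE; last exact: measurableI.
rewrite (@eq_Ex_as _ _ _ P A _ \1_B)//.
- by rewrite Ex_indic// PB.
- by apply: bmf_indic; exact: measurableI.
- by move=> x Ax; rewrite !indicE in_setI (mem_set Ax).
Qed.

(** * The regression law on its support *)

Section regression_structure.
Context {R : realType}.
Local Notation TR := (measurableTypeR R).
Variables (r m : nat) (p : 'I_r -> R) (P1 : probability (rvec R r) R).
Hypothesis m0 : (0 < m)%N.

(** Variance of t under the weights p, divided by m; by [mvarE] this is the quadratic form of the
    noise covariance. *)
Definition mvar (t : 'I_r -> R) : R :=
  m%:R^-1 * (\sum_a p a * t a ^+ 2 - (\sum_a p a * t a) ^+ 2).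

Lemma mvarE (t : 'I_r -> R) :
  \sum_(a < r) \sum_(b < r) t a * t b *
    (if a == b then m%:R^-1 * (p a * (1 - p a)) else - (m%:R^-1 * (p a * p b))) = mvar t.
Proof.
rewrite /mvar expr2 mulr_suml -sumrB mulr_sumr; apply: eq_bigr => a _.
rewrite mulr_sumr (bigD1 a)//= eqxx [in RHS](bigD1 a)//=.
rewrite (eq_bigr (fun b => - (m%:R^-1 * (p a * t a * (p b * t b))))); last first.
  by move=> b /negbTE; rewrite eq_sym => ->; ring.
by rewrite sumrN -mulr_sumr; move: (\sum_(i < r | _) _) => S; ring.
Qed.

Hypothesis HP1 : forall (t : 'I_r -> R) (A : set TR), measurable A ->
  P1 [set y : rvec R r | A (\sum_a t a * (y a - p a))] = normal_law 0 (mvar t) A.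

Lemma reg_degenerate (t : 'I_r -> R) : mvar t = 0 ->
  P1 [set y : rvec R r | \sum_a t a * (y a - p a) = 0] = 1%E.
Proof.
move=> t0; have := HP1 t (measurable_set1 (0 : TR)).
by rewrite t0 /normal_law eqxx diracE mem_set.
Qed.

Lemma measurable_reg_lin (t : 'I_r -> R) (c : R) :
  measurable [set y : rvec R r | \sum_a t a * (y a - p a) = c].
Proof.
have mf : measurable_fun setT (fun y : rvec R r => (\sum_a t a * (y a - p a) : TR)).
  apply: measurable_sum => a; apply: measurable_funM; first exact: measurable_cst.
  by apply: measurable_funB; [exact: measurable_coord|exact: measurable_cst].
by have := mf measurableT [set c] (measurable_set1 _); rewrite setTI.
Qed.

Hypothesis psum : \sum_a p a = 1.

Lemma mvar_cst : mvar (fun=> 1) = 0.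
Proof.
rewrite /mvar; under eq_bigr do rewrite expr1n mulr1.
under [X in _ - X ^+ 2]eq_bigr do rewrite mulr1.
by rewrite psum expr1n subrr mulr0.
Qed.

Lemma mvar_delta a : p a = 0 -> mvar (fun b => (b == a)%:R) = 0.
Proof.
move=> pa; rewrite /mvar.
have h (g : 'I_r -> R) : (forall b, b != a -> g b = 0) -> g a = 0 -> \sum_b g b = 0.
  by move=> gb ga; rewrite (bigD1 a)//= ga big1 ?addr0// => b /gb.
rewrite !h ?expr0n /= ?subr0 ?mulr0//.
all: by [move=> b /negbTE ->; rewrite ?expr0n /= mulr0|rewrite pa mul0r].
Qed.

Definition reg_support : set (rvec R r) :=
  [set y | (forall a, p a = 0 -> y a = 0) /\ \sum_a y a = 1].

(** Each constraint is a linear form of variance 0, hence almost surely constant: the sum of all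
    entries, and each entry of probability 0. *)
Lemma reg_support_as : measurable reg_support /\ P1 reg_support = 1%E.
Proof.
have S1 : [set y : rvec R r | \sum_a y a = 1] =
    [set y : rvec R r | \sum_a (fun=> 1) a * (y a - p a) = 0].
  have E (y : rvec R r) : \sum_a 1 * (y a - p a) = \sum_a y a - 1.
    by rewrite -[X in _ - X]psum -sumrB; under eq_bigr do rewrite mul1r.
  by apply/seteqP; split => y /=; rewrite E; [move=> ->; rewrite subrr|move/subr0_eq].
have Sa a : p a = 0 -> [set y : rvec R r | y a = 0] =
    [set y : rvec R r | \sum_b (b == a)%:R * (y b - p b) = 0].
  move=> pa; have E (y : rvec R r) : \sum_b (b == a)%:R * (y b - p b) = y a.
    rewrite (bigD1 a)//= eqxx mul1r pa subr0 big1 ?addr0// => b /negbTE ->.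
    by rewrite mul0r.
  by apply/seteqP; split => y /=; rewrite E.
have key (s : seq 'I_r) : let B := [set y : rvec R r | forall a, a \in s -> p a = 0 -> y a = 0] in
    measurable B /\ P1 B = 1%E.
  elim: s => [|a s [mB PB]] /=.
    rewrite (_ : [set _ | _] = setT); last by apply/seteqP; split.
    by split => //; exact: probability_setT.
  have [pa|pa] := eqVneq (p a) 0.
    have -> : [set y : rvec R r | forall b, b \in a :: s -> p b = 0 -> y b = 0] =
      [set y : rvec R r | y a = 0] `&` [set y : rvec R r | forall b, b \in s -> p b = 0 -> y b = 0].
      apply/seteqP; split => y /=.
        move=> h; split; first by apply: h; rewrite ?mem_head.
        by move=> b bs; apply: h; rewrite in_cons bs orbT.
      move=> [h1 h2] b; rewrite in_cons => /predU1P[-> //|]; exact: h2.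
    have ma : measurable [set y : rvec R r | y a = 0] by rewrite Sa//; exact: measurable_reg_lin.
    split; first exact: measurableI.
    apply: probability_setI1 => //.
    by rewrite Sa//; apply: reg_degenerate; exact: mvar_delta.
  have -> // : [set y : rvec R r | forall b, b \in a :: s -> p b = 0 -> y b = 0] =
      [set y : rvec R r | forall b, b \in s -> p b = 0 -> y b = 0].
    apply/seteqP; split => y /=.
      by move=> h b bs; apply: h; rewrite in_cons bs orbT.
    by move=> h b; rewrite in_cons => /predU1P[->|/h//] => pa0; rewrite pa0 eqxx in pa.
have -> : reg_support = [set y : rvec R r | forall a, a \in index_enum 'I_r -> p a = 0 -> y a = 0] `&`
    [set y : rvec R r | \sum_a y a = 1].
  apply/seteqP; split => y /= [h1 h2]; split => // a; first by move=> _; exact: h1.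
  by apply: h1; rewrite mem_index_enum.
have [mB PB] := key (index_enum 'I_r).
have mS : measurable [set y : rvec R r | \sum_a y a = 1] by rewrite S1; exact: measurable_reg_lin.
split; first exact: measurableI.
apply: probability_setI1 => //.
by rewrite S1; apply: reg_degenerate; exact: mvar_cst.
Qed.

Variables (d : nat) (e : 'I_d -> 'I_r) (star : 'I_r).
Hypotheses (einj : injective e) (estar : forall k, e k != star)
  (esupp : forall a, p a = 0 \/ a = star \/ exists k, a = e k)
  (q0 : forall k, 0 < p (e k)) (pstar : 0 < p star).

(** Inverse of [vvec] on [reg_support]: entries of probability 0 vanish there, and the entry at
    [star] is determined by the sum. *)
Definition yvec (v : rvec R d) : rvec R r := fun a =>
  if a == star then 1 - \sum_k v k / m%:R else \sum_(k | e k == a) v k / m%:R.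

Definition vvec (y : rvec R r) : rvec R d := fun k => m%:R * y (e k).

Let mR : 0 < m%:R :> R. Proof. by rewrite ltr0n. Qed.

Lemma sum_e (g : 'I_r -> R) : g star + \sum_k g (e k) =
  \sum_(a | (a == star) || [exists k, a == e k]) g a.
Proof.
rewrite [RHS](bigD1 star) ?eqxx//=; congr (_ + _).
rewrite (eq_bigl (fun a => a \in [seq e k | k : 'I_d])); last first.
  move=> a; have [->|ast] /= := eqVneq a star.
    by apply/esym/negbTE/mapP => -[k _] h; have := estar k; rewrite -h eqxx.
  rewrite andbT; apply/existsP/mapP => [[k /eqP ->]|[k _ ->]].
    by exists k => //; rewrite mem_enum.
  by exists k.
rewrite -big_uniq /=; last by rewrite map_inj_uniq ?enum_uniq.
by rewrite big_map big_enum.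
Qed.

Lemma sum_supp (g : 'I_r -> R) : (forall a, p a = 0 -> g a = 0) ->
  \sum_a g a = g star + \sum_k g (e k).
Proof.
move=> g0; rewrite sum_e (bigID (fun a => (a == star) || [exists k, a == e k])) /=.
rewrite [X in _ + X]big1 ?addr0// => a; rewrite negb_or => /andP[/eqP h1 h2].
apply: g0; have [//|[//|[k hk]]] := esupp a.
by move: h2 => /existsPn /(_ k); rewrite hk eqxx.
Qed.

Lemma yvecK y : reg_support y -> yvec (vvec y) = y.
Proof.
move=> [y0 y1]; apply/functional_extensionality_dep => a; rewrite /yvec /vvec.
have E k : m%:R * y (e k) / m%:R = y (e k) by rewrite mulrC mulKf ?gt_eqF.
have [->|ast] := eqVneq a star.
  by under eq_bigr do rewrite E; rewrite -y1 sum_supp// addrK.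
under eq_bigr do rewrite E.
have [pa|[pa|[k ->]]] := esupp a; last 2 first.
- by rewrite pa eqxx in ast.
- by rewrite (big_pred1 k)// => j; rewrite (inj_eq einj).
by rewrite y0// big1// => k /eqP ek; have := q0 k; rewrite ek pa ltxx.
Qed.

Lemma measurable_yvec : measurable_fun setT yvec.
Proof.
apply: measurable_fun_fin_prod => a; have [ast|/negbTE ast] := eqVneq a star.
  rewrite (_ : (fun v => _) = fun v : rvec R d => 1 - \sum_k v k / m%:R); last first.
    by apply/funext => v; rewrite /yvec ast eqxx.
  apply: measurable_funB; first exact: measurable_cst.
  apply: measurable_sum => k; apply: measurable_funM; last exact: measurable_cst.
  exact: measurable_coord.
rewrite (_ : (fun v => _) = fun v : rvec R d => \sum_k (if e k == a then v k / m%:R else 0)); last first.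
  by apply/funext => v; rewrite /yvec ast; exact: big_mkcond.
apply: measurable_sum => k; case: (e k == a); last exact: measurable_cst.
apply: measurable_funM; last exact: measurable_cst.
exact: measurable_coord.
Qed.

Lemma measurable_vvec : measurable_fun setT vvec.
Proof.
apply: measurable_fun_fin_prod => k; apply: measurable_funM; first exact: measurable_cst.
exact: measurable_coord.
Qed.

Let q k := p (e k).

Lemma qsum : \sum_k q k = 1 - p star.
Proof. by rewrite -psum sum_supp// addrC addKr. Qed.

Let qlt1 : \sum_k q k < 1. Proof. by rewrite qsum ltrBlDr ltrDl. Qed.

(** By [resid_lin] a linear form in the residuals is one in the observations, with the variance it
    would have for independent residuals; [gaussian_product_law] then applies. *)
Lemma regression_resid_law :
  exists2 G : probability (rvec R d) R,
    product_law (fun k => centred_normal (tau2 m%:R 1 q k)) G &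
    forall F, bmf F -> Ex G F = Ex P1 (fun y => F (resid m%:R 1 q 0 (vvec y))).
Proof.
have mres : measurable_fun setT (fun y : rvec R r => resid m%:R 1 q 0 (vvec y)).
  apply: measurable_fun_fin_prod => k.
  apply: (measurableT_comp (f := fun z : TR * rvec R d => resid m%:R 1 q z.1 z.2 k)
     (g := fun y => (0 : TR, vvec y)) (measurable_resid m%:R 1 q k)).
  exact: (measurableT_comp (pair1_measurable _) measurable_vvec).
exists (push P1 mres); last by move=> F bF; rewrite Ex_push.
apply: gaussian_product_law => [k|t A mA].
  by apply/ltW; apply: tau2_gt0.
rewrite pushE; have [s [S [h1 h2 h3]]] := resid_lin m%:R (q := q) t q0 qlt1.
(* The coefficients of the retained coordinates, rescaled by m and extended by 0 to all entries. *)
pose T a := \sum_(i | e i == a) (m%:R * s i).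
have sT (g : 'I_r -> R) : \sum_a g a * T a = \sum_i g (e i) * (m%:R * s i).
  rewrite /T; under eq_bigr do rewrite big_mkcond mulr_sumr.
  rewrite exchange_big /=; apply: eq_bigr => i _.
  rewrite (bigD1 (e i))//= eqxx big1 ?addr0// => a /negbTE.
  by rewrite eq_sym => ->; rewrite mulr0.
have Te i : T (e i) = m%:R * s i.
  by rewrite /T (big_pred1 i)// => j; rewrite (inj_eq einj).
have mT : mvar T = m%:R * (\sum_i q i * s i ^+ 2 - 1 * S ^+ 2).
  rewrite /mvar sT.
  have -> : \sum_a p a * T a ^+ 2 = \sum_i q i * (m%:R ^+ 2 * s i ^+ 2).
    under eq_bigr do rewrite expr2 mulrA.
    rewrite (sT (fun a => p a * T a)); apply: eq_bigr => i _.
    by rewrite Te /q; ring.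
  have -> : \sum_i p (e i) * (m%:R * s i) = m%:R * S.
    by rewrite -[S]mul1r -h2 mulr_sumr; apply: eq_bigr => i _; rewrite /q; ring.
  have -> : \sum_i q i * (m%:R ^+ 2 * s i ^+ 2) = m%:R ^+ 2 * \sum_i q i * s i ^+ 2.
    by rewrite mulr_sumr; apply: eq_bigr => i _; ring.
  by move: (\sum_i _) => Z; field; rewrite gt_eqF.
rewrite -h3 -mT -(HP1 T mA); congr (P1 _).
have E y : lin t (resid m%:R 1 q 0 (vvec y)) = \sum_a T a * (y a - p a).
  rewrite h1 mul0r addr0.
  rewrite [RHS](eq_bigr (fun a => (y a - p a) * T a)) ?sT; last by move=> a _; rewrite mulrC.
  by apply: eq_bigr => i _; rewrite /vvec /q; ring.
by apply/seteqP; split => y /=; rewrite E.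
Qed.

Lemma regression_cell (nu : 'I_d -> R) (U : probability (rvec R d) R) (F : rvec R d -> R) :
  product_law (fun=> uniform01) U -> bmf F -> (forall v, 0 <= F v) ->
  Ex U (fun u => F (cell_point nu u) * resid_pdf m%:R 1 q 0 (cell_point nu u)) <=
  Ex P1 (fun y => F (vvec y)).
Proof.
move=> hU bF F0; have [G hG EG] := regression_resid_law.
apply: (le_trans (gaussian_cell 0 nu mR q0 qlt1 hG hU bF F0)).
have bFu : bmf (fun w => F (unresid m%:R 1 q 0 w)).
  apply: (bmf_comp (phi := fun w => unresid m%:R 1 q 0 w)) => //.
  exact: (measurableT_comp (measurable_unresid m%:R 1 q) (pair1_measurable (0 : TR))).
by rewrite EG// le_eqVlt; apply/orP; left; apply/eqP/eq_Ex => y; rewrite unresidK.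
Qed.

(* The cells nu + [0,1)^d are disjoint. *)
Lemma regression_cells (U : probability (rvec R d) R) (f : rvec R r -> R) (N : nat) :
  product_law (fun=> uniform01) U -> bmf f -> (forall y, 0 <= f y) ->
  \sum_(nu : {ffun 'I_d -> 'I_N}) Ex U (fun u =>
     f (yvec (cell_point (fun k => (nu k : nat)%:R) u)) *
     resid_pdf m%:R 1 q 0 (cell_point (fun k => (nu k : nat)%:R) u)) <=
  Ex P1 f.
Proof.
move=> hU bf f0.
pose C (nu : {ffun 'I_d -> 'I_N}) : set (rvec R d) :=
  [set v | forall k, `[(nu k : nat)%:R, (nu k : nat)%:R + 1[%classic (v k)].
have mC nu : measurable (C nu).
  exact: (@measurable_box _ _ (fun=> TR) (fun k => `[(nu k : nat)%:R, (nu k : nat)%:R + 1[%classic)).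
pose F nu v := f (yvec v) * \1_(C nu) v.
have bfy : bmf (fun v => f (yvec v)) := bmf_comp measurable_yvec bf.
have bF nu : bmf (F nu) by apply: bmfM => //; exact: bmf_indic.
have ind0 nu v : 0 <= \1_(C nu) v :> R by rewrite indicE.
have F0 nu v : 0 <= F nu v by rewrite mulr_ge0.
apply: (@le_trans _ _ (\sum_(nu : {ffun 'I_d -> 'I_N}) Ex P1 (fun y => F nu (vvec y)))).
  apply: ler_sum => nu _.
  apply: le_trans (regression_cell (fun k => (nu k : nat)%:R) hU (bF nu) (F0 nu)).
  rewrite le_eqVlt; apply/orP; left; apply/eqP/eq_Ex => u.
  rewrite /F indicE mem_set ?mulr1// => k; rewrite /cell_point /= in_itv /=.
  by have /andP[c0 c1] := clip01 (u k); rewrite lerDl c0 ltrD2l c1.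
have bFv nu : bmf (fun y => F nu (vvec y)) := bmf_comp measurable_vvec (bF nu).
have [mS PS] := reg_support_as.
rewrite -Ex_sum// (@eq_Ex_as _ _ _ P1 reg_support f (fun y => f (yvec (vvec y))))//; first last.
- by move=> y Sy; rewrite yvecK.
- exact: (bmf_comp measurable_vvec bfy).
apply: le_Ex; first exact: bmf_sum.
  exact: (bmf_comp measurable_vvec bfy).
move=> y; rewrite -mulr_sumr -[leRHS]mulr1 ler_wpM2l//.
have [[nu0 h0]|h] := pselect (exists nu, C nu (vvec y)); last first.
  rewrite big1 ?ler01// => nu _; rewrite indicE memNset// => hnu.
  by apply: h; exists nu.
rewrite (bigD1 nu0)//= big1 ?addr0.
  by rewrite indicE; case: (_ \in _); rewrite ?ler01.
move=> nu /eqP nn; rewrite indicE memNset// => hnu; apply: nn; apply/ffunP => k.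
have := hnu k; have := h0 k; rewrite /= !in_itv /= => /andP[a1 a2] /andP[b1 b2].
have := le_lt_trans a1 b2; have := le_lt_trans b1 a2.
rewrite !natr1 !ltr_nat !ltnS => l1 l2; apply/val_inj/eqP.
by rewrite eqn_leq l1 l2.
Qed.

End regression_structure.

(** * Stirling's formula *)

Section calculus.
Context {R : realType}.
Implicit Types (f df : R -> R) (x y t : R).

Lemma deriv_ge0_le f df a b : a <= b ->
  (forall x, a <= x <= b -> is_derive x 1 f (df x)) ->
  (forall x, a <= x <= b -> 0 <= df x) -> f a <= f b.
Proof.
move=> ab fdf df0.
have fdf' x : x \in `]a, b[%R -> is_derive x 1 f (df x).
  by rewrite in_itv /= => /andP[/ltW ax /ltW xb]; apply: fdf; rewrite ax.
have cf : {within `[a, b], continuous f}.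
  apply: derivable_within_continuous => x; rewrite in_itv /= => xab.
  by have [] := fdf x xab.
have [c cab h] := MVT_segment ab fdf' cf.
by rewrite -subr_ge0 h mulr_ge0 ?subr_ge0// df0.
Qed.

Lemma deriv_le0_ge f df a b : a <= b ->
  (forall x, a <= x <= b -> is_derive x 1 f (df x)) ->
  (forall x, a <= x <= b -> df x <= 0) -> f b <= f a.
Proof.
move=> ab fdf df0; rewrite -lerN2.
apply: (@deriv_ge0_le (fun x => - f x) (fun x => - df x)) => // x xab.
  by have := fdf x xab => ?; exact: is_deriveN.
by rewrite oppr_ge0 df0.
Qed.

Lemma ln_ge_inv x : 0 < x -> 1 - x^-1 <= ln x.
Proof.
move=> x0; have xi : 0 < x^-1 by rewrite invr_gt0.
have : -1 < x^-1 - 1 by lra.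
by move=> /le_ln1Dx; rewrite addrC subrK lnV//; lra.
Qed.

(** At y = 1 + 1/n it reads (n + 1/2) ln (1 + 1/n) >= 1, which makes the Stirling remainder
    decrease. *)
Lemma ln_trapezoid_ge y : 1 <= y -> 2 * (y - 1) <= (y + 1) * ln y.
Proof.
move=> y1; pose f x := (x + 1) * ln x - 2 * (x - 1).
suff : f 1 <= f y by rewrite /f ln1; lra.
apply: (@deriv_ge0_le f (fun x => ln x - (1 - x^-1))) => // x /andP[x1 _].
  have x0 : 0 < x by lra.
  have := is_derive1_ln x0 => ?; apply: is_derive_eq.
  by rewrite /GRing.scale /=; field; rewrite gt_eqF.
by rewrite subr_ge0 ln_ge_inv//; lra.
Qed.

Lemma ln_le_cubic y : 1 <= y -> ln y <= (y - 1) - (y - 1) ^+ 2 / 2 + (y - 1) ^+ 3 / 3.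
Proof.
move=> y1; pose f x := (x - 1) - (x - 1) ^+ 2 / 2 + (x - 1) ^+ 3 / 3 - ln x.
suff : f 1 <= f y by rewrite /f ln1; lra.
apply: (@deriv_ge0_le f (fun x => (x - 1) ^+ 3 / x)); [exact: y1| |] => x /andP[x1 _].
  have x0 : 0 < x by lra.
  have := is_derive1_ln x0 => ?; apply: is_derive_eq.
  by rewrite /GRing.scale /=; field; rewrite gt_eqF.
by rewrite divr_ge0 ?exprn_ge0 ?subr_ge0//; lra.
Qed.

(** The left side is the third Taylor polynomial of t ln t at 1. The difference f has derivative h,
    which vanishes at 1 and increases, so f is least at 1. *)
Lemma mul_ln_ge_cubic t : 0 <= t ->
  (t - 1) + (t - 1) ^+ 2 / 2 - (t - 1) ^+ 3 / 6 <= t * ln t.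
Proof.
rewrite le_eqVlt => /predU1P[<-|t0]; first by rewrite mul0r; lra.
pose h (x : R) := ln x - (x - 1) + (x - 1) ^+ 2 / 2.
have dh (x : R) : 0 < x -> is_derive x 1 h ((x - 1) ^+ 2 / x).
  move=> x0; have := is_derive1_ln x0 => ?; apply: is_derive_eq.
  by rewrite /GRing.scale /=; field; rewrite gt_eqF.
have h1 : h 1 = 0 by rewrite /h ln1; lra.
have dh0 (x : R) : 0 < x -> 0 <= (x - 1) ^+ 2 / x.
  by move=> x0; rewrite divr_ge0 ?sqr_ge0// ltW.
pose f (x : R) := x * ln x - (x - 1) - (x - 1) ^+ 2 / 2 + (x - 1) ^+ 3 / 6.
have df (x : R) : 0 < x -> is_derive x 1 f (h x).
  move=> x0; have := is_derive1_ln x0 => ?; apply: is_derive_eq.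
  by rewrite /GRing.scale /h /=; field; rewrite gt_eqF.
suff : f 1 <= f t by rewrite /f ln1; lra.
have [t1|/ltW t1] := leP 1 t.
  apply: (deriv_ge0_le t1 (df := h)) => x /andP[x1 xt]; first by apply: df; lra.
  rewrite -h1; apply: (deriv_ge0_le x1) => z /andP[z1 _]; [apply: dh|apply: dh0]; lra.
apply: (deriv_le0_ge t1 (df := h)) => x /andP[x1 xt]; first by apply: df; lra.
rewrite -h1; apply: (deriv_ge0_le xt) => z /andP[z1 _]; [apply: dh|apply: dh0]; lra.
Qed.

End calculus.

Section wallis.
Context {R : realType}.

(* [sin_int n] vanishes at 0 and has derivative sin^n. *)
Fixpoint sin_int (n : nat) (x : R) : R :=
  match n with
  | 0 => x
  | 1 => 1 - cos x
  | n'.+2 => - (cos x * sin x ^+ n'.+1) / n'.+2%:R + n'.+1%:R / n'.+2%:R * sin_int n' x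
  end.

Lemma sin_int_derive n (x : R) : is_derive x 1 (sin_int n) (sin x ^+ n).
Proof.
suff : is_derive x 1 (sin_int n) (sin x ^+ n) /\ is_derive x 1 (sin_int n.+1) (sin x ^+ n.+1) by case.
elim: n => [|n [IH1 IH2]].
  split; first by rewrite expr0; exact: is_derive_id.
  rewrite expr1 (_ : sin_int 1 = cst 1 - cos :> (R -> R)); last exact/funext.
  by apply: is_derive_eq; rewrite sub0r opprK.
split=> //.
have ds := is_deriveX n.+1 (is_derive_sin x).
have dc := is_deriveM (is_derive_cos x) ds.
have d := is_deriveD (is_deriveZ (- n.+2%:R^-1) dc) (is_deriveZ (n.+1%:R / n.+2%:R) IH1).
rewrite (_ : sin_int n.+2 = (- n.+2%:R^-1) \*: (cos * sin ^+ n.+1) +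
    (n.+1%:R / n.+2%:R) \*: sin_int n :> (R -> R)); last first.
  apply/funext => y; transitivity (- n.+2%:R^-1 * (cos y * sin y ^+ n.+1) + n.+1%:R / n.+2%:R * sin_int n y).
    by rewrite /=; ring.
  by rewrite -[sin y ^+ n.+1]/((fun z => sin z ^+ n.+1) y) -exprfctE.
apply: (is_derive_eq d).
rewrite exprfctE /GRing.scale /=.
have -> : sin x ^+ n.+2 = (1 - cos x ^+ 2) * sin x ^+ n.
  by rewrite -(cos2Dsin2 x) !exprS; ring.
rewrite [sin x ^+ n.+1]exprS -[n.+2%:R]natr1.
have : n.+1%:R + 1 != 0 :> R by rewrite natr1 pnatr_eq0.
have : sin x * sin x = 1 - cos x ^+ 2 by rewrite -(cos2Dsin2 x); ring.
move: (sin x) (cos x) n.+1%:R => s c k sc k0; move: (s ^+ n) => P.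
transitivity ((k + 1)^-1 * (s * s * P - k * P * c ^+ 2 + k * P)); last by rewrite sc; field.
by field.
Qed.

(** The only estimate in Wallis's argument: the integrals of sin^n over [0, pi/2] decrease, which
    encloses the square of [central n] around 1 / (pi n) and brings pi into Stirling's constant. *)
Lemma wallis_decr n : sin_int n.+1 (pi / 2) <= sin_int n (pi / 2) :> R.
Proof.
rewrite -subr_ge0; pose f (x : R) := sin_int n x - sin_int n.+1 x.
have p0 : 0 <= pi / 2 :> R by rewrite divr_ge0 ?pi_ge0.
have z k : sin_int k 0 = 0 :> R.
  suff : sin_int k 0 = 0 :> R /\ sin_int k.+1 0 = 0 :> R by case.
  elim: k => [|k [IH1 IH2]]; first by rewrite /= cos0 subrr.
  by split => //=; rewrite IH1 sin0 exprS mul0r mulr0 oppr0 mul0r add0r mulr0.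
suff : f 0 <= f (pi / 2) by rewrite /f !z subrr.
apply: (@deriv_ge0_le _ f (fun x => sin x ^+ n - sin x ^+ n.+1)); first exact: p0.
  by move=> x _; apply: is_deriveB; exact: sin_int_derive.
move=> x /andP[x0 x1]; have s0 : 0 <= sin x.
  by apply: sin_ge0_pi; rewrite x0 /=; have := @pi_ge0 R; lra.
by rewrite exprS -[X in X - _]mul1r -mulrBl mulr_ge0 ?exprn_ge0// subr_ge0 sin_le1.
Qed.

Lemma wallisS n : sin_int n.+2 (pi / 2) = n.+1%:R / n.+2%:R * sin_int n (pi / 2) :> R.
Proof. by rewrite /= cos_pihalf mul0r oppr0 mul0r add0r. Qed.

(* 'C(2n, n) / 4^n *)
Definition central n : R := (n.*2)`!%:R / ((n`!%:R) ^+ 2 * 4 ^+ n).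

Let factn0 k : k`!%:R != 0 :> R. Proof. by rewrite pnatr_eq0 -lt0n fact_gt0. Qed.

Lemma centralS n : central n.+1 = (n.*2.+1%:R / n.*2.+2%:R) * central n.
Proof.
rewrite /central doubleS !factS !natrM (_ : n.*2.+2%:R = 2 * n.+1%:R :> R); last first.
  by rewrite -natrM mul2n doubleS.
rewrite [4 ^+ n.+1]exprS; have := factn0 n; move: (n`!%:R) => a a0.
have : 4 ^+ n != 0 :> R by rewrite expf_neq0// pnatr_eq0.
move: (4 ^+ n) => b b0; have : n.+1%:R != 0 :> R by rewrite pnatr_eq0.
by move: n.+1%:R => c c0; field; rewrite a0 b0 c0.
Qed.

Lemma wallis_even n : sin_int n.*2 (pi / 2) = pi / 2 * central n :> R.
Proof.
elim: n => [|n IH]; first by rewrite /central !fact0 expr1n expr0 mulr1 divr1 mulr1.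
by rewrite doubleS wallisS IH centralS; ring.
Qed.

Lemma wallis_odd n : sin_int n.*2.+1 (pi / 2) * (n.*2.+1%:R * central n) = 1 :> R.
Proof.
elim: n => [|n IH].
  by rewrite /central /= cos_pihalf subr0 !mul1r !fact0 expr1n expr0 mulr1 invr1.
rewrite doubleS wallisS -[RHS]IH centralS.
have : n.*2.+2%:R != 0 :> R by rewrite pnatr_eq0.
have : n.*2.+3%:R != 0 :> R by rewrite pnatr_eq0.
by move: n.*2.+2%:R n.*2.+3%:R => a b b0 a0; field; rewrite a0.
Qed.

Lemma central_gt0 n : 0 < central n.
Proof. by rewrite divr_gt0 ?mulr_gt0 ?exprn_gt0 ?ltr0n ?fact_gt0. Qed.

Lemma central_le n : (0 < n)%N -> central n ^+ 2 * (pi * n%:R) <= 1.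
Proof.
case: n => // n _; have := wallis_decr n.*2.+1.
rewrite -doubleS wallis_even => h.
have c0 := central_gt0 n; have n0 : 0 < n.*2.+1%:R :> R by rewrite ltr0n.
have := ler_wpM2r (mulr_ge0 (ltW n0) (ltW c0)) h; rewrite wallis_odd; apply: le_trans.
rewrite le_eqVlt; apply/orP; left; apply/eqP.
rewrite centralS (_ : n.*2.+2%:R = 2 * n.+1%:R :> R); last by rewrite -natrM mul2n doubleS.
have : n.+1%:R != 0 :> R by rewrite pnatr_eq0.
by move: n.+1%:R => c c0'; field.
Qed.

Lemma central_ge n : 1 <= central n ^+ 2 * (pi / 2 * n.*2.+1%:R).
Proof.
have := wallis_decr n.*2; rewrite wallis_even => h.
have c0 := central_gt0 n; have n0 : 0 < n.*2.+1%:R :> R by rewrite ltr0n.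
have := ler_wpM2r (mulr_ge0 (ltW n0) (ltW c0)) h; rewrite wallis_odd => /le_trans; apply.
by rewrite le_eqVlt; apply/orP; left; apply/eqP; ring.
Qed.

End wallis.

Section stirling.
Context {R : realType}.

Let lnX n (x : R) : 0 < x -> ln (x ^+ n) = n%:R * ln x.
Proof. by move=> x0; rewrite lnXn// mulr_natl. Qed.

Definition stirling_rem n : R := ln n`!%:R - (n%:R + 2^-1) * ln n%:R + n%:R.

Definition stirling_cst : R := 2^-1 * ln (2 * pi).

(** The difference is (n + 1/2) ln (1 + 1/n) - 1; the upper bound is chosen so as to telescope. *)
Lemma stirling_rem_step n : (0 < n)%N ->
  0 <= stirling_rem n - stirling_rem n.+1 <= 2^-1 * (n%:R^-1 - n.+1%:R^-1).
Proof.
move=> n0; have x0 : 0 < n%:R :> R by rewrite ltr0n.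
have E : stirling_rem n - stirling_rem n.+1 = (n%:R + 2^-1) * ln (n.+1%:R / n%:R) - 1 :> R.
  rewrite /stirling_rem factS natrM lnM ?posrE ?ltr0n ?fact_gt0// ln_div ?posrE ?ltr0n//.
  by rewrite -natr1; field.
rewrite E -[n.+1%:R]natr1; set x : R := n%:R in x0 *.
have y1 : 1 <= (x + 1) / x by rewrite ler_pdivlMr// mul1r lerDl.
apply/andP; split.
  have := ln_trapezoid_ge y1; set l := ln _ => h.
  have := ler_wpM2r (ltW x0) h; set a := (_ * x)%R; set b := (_ * x)%R.
  have -> : a = 2 by rewrite /a; field; rewrite gt_eqF.
  have -> : b = 2 * ((x + 2^-1) * l) by rewrite /b; field; rewrite gt_eqF.
  lra.
have := ln_le_cubic y1; set l := ln _ => h.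
have xp : 0 <= x + 2^-1 by lra.
have := ler_wpM2l xp h; rewrite -(lerD2r (-1)) => /le_trans; apply.
rewrite -subr_ge0.
have -> : 2^-1 * (x^-1 - (x + 1)^-1) - ((x + 2^-1) *
   ((x + 1) / x - 1 - ((x + 1) / x - 1) ^+ 2 / 2 + ((x + 1) / x - 1) ^+ 3 / 3) + -1)
   = (5 * x ^+ 2 - 3 * x - 2) / (12 * x ^+ 3 * (x + 1)).
  by field; rewrite !gt_eqF//; lra.
have x1 : 1 <= x by rewrite /x ler1n.
rewrite divr_ge0//; first by nra.
by rewrite !mulr_ge0 ?exprn_ge0//; lra.
Qed.

Lemma stirling_rem_diff n k : (0 < n)%N ->
  0 <= stirling_rem n - stirling_rem (n + k) <= 2^-1 * (n%:R^-1 - (n + k)%:R^-1).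
Proof.
move=> n0; elim: k => [|k IH]; first by rewrite addn0 !subrr mulr0 lexx.
have := @stirling_rem_step (n + k); rewrite addn_gt0 n0 addnS => /(_ isT).
move: IH; move: (n + k).+1%:R^-1 (n + k)%:R^-1 => u v /andP[h1 h2] /andP[h3 h4].
by apply/andP; split; lra.
Qed.

(** No limit is taken: the logarithm of [central n] expresses the remainder at 2n minus twice that
    at n, and the telescoped bound controls its variation from n to 2n. Each of the two errors lies
    in an interval of length 1/(4n). *)
Lemma stirling_rem_bound n : (0 < n)%N ->
  `|stirling_rem n - stirling_cst| <= (4 * n%:R)^-1.
Proof.
move=> n0; have x0 : 0 < n%:R :> R by rewrite ltr0n.
have pi0 := @pi_gt0 R.
have /andP[d1 d2] := stirling_rem_diff n n0.
have D : (n + n)%:R = 2 * n%:R :> R by rewrite addnn -mul2n natrM.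
have E : ln (central n) = stirling_rem (n + n) - 2 * stirling_rem n + 2^-1 * (ln 2 - ln n%:R) :> R.
  rewrite /central ln_div ?posrE ?mulr_gt0 ?exprn_gt0 ?ltr0n ?fact_gt0//.
  rewrite lnM ?posrE ?exprn_gt0 ?ltr0n ?fact_gt0// !lnX ?ltr0n ?fact_gt0//.
  rewrite /stirling_rem D lnM ?posrE// -addnn (_ : 4 = 2 ^+ 2 :> R); last by ring.
  by rewrite lnX//; field.
have c0 := @central_gt0 R n.
have L : stirling_cst = 2^-1 * ln 2 + 2^-1 * ln pi :> R by rewrite /stirling_cst lnM ?posrE// mulrDr.
have h1 : 2 * ln (central n) + (ln pi + ln n%:R) <= 0 :> R.
  have := @central_le R n n0; rewrite -(@ler_ln R) ?posrE ?mulr_gt0 ?exprn_gt0//.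
  rewrite ln1 lnM ?posrE ?mulr_gt0 ?exprn_gt0// lnX// lnM ?posrE//; lra.
have h2 : - n.*2%:R^-1 <= 2 * ln (central n) + (ln pi + ln n%:R) :> R.
  have h : 0 < n.*2.+1%:R :> R by rewrite ltr0n.
  have : ln 1 <= ln (central n ^+ 2 * (pi / 2 * n.*2.+1%:R)) :> R.
    by rewrite ler_ln ?posrE ?mulr_gt0 ?exprn_gt0 ?divr_gt0//; exact: central_ge.
  rewrite ln1 lnM ?posrE ?mulr_gt0 ?exprn_gt0 ?divr_gt0//.
  rewrite lnX// lnM ?posrE ?divr_gt0//.
  have e2 : (n.*2.+1%:R : R) = 2 * n%:R * (1 + n.*2%:R^-1).
    by rewrite -addnn -[(n + n).+1%:R]natr1 D; field; rewrite gt_eqF.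
  rewrite e2 (ln_div (x := pi))  ?posrE// (lnM (x := 2 * n%:R)) ?posrE; last 2 first.
  - by rewrite mulr_gt0.
  - by rewrite ltr_wpDr// invr_ge0.
  rewrite (lnM (x := 2)) ?posrE//.
  have : ln (1 + n.*2%:R^-1) <= n.*2%:R^-1 :> R.
    by apply: le_ln1Dx; rewrite (lt_le_trans (_ : _ < 0))// ?ltrN10 ?invr_ge0.
  lra.
have I : (n + n)%:R^-1 = 2^-1 * n%:R^-1 :> R by rewrite D invfM.
have I2 : n.*2%:R^-1 = 2^-1 * n%:R^-1 :> R by rewrite -addnn.
rewrite invfM (_ : 4^-1 = 2^-1 * 2^-1 :> R); last by field.
rewrite I in d2; rewrite I2 in h2.
have xi : 0 < n%:R^-1 :> R by rewrite invr_gt0.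
by rewrite ler_norml; apply/andP; split; lra.
Qed.

Lemma stirling_cst_le : stirling_cst <= 3 / 2.
Proof.
have := @stirling_rem_bound 1 isT; rewrite ler_norml => /andP[h _].
move: h; rewrite /stirling_rem ln1 mulr0 subrr add0r mulr1; lra.
Qed.

Lemma ln_fact_le n : (0 < n)%N ->
  ln n`!%:R <= n%:R * ln n%:R - n%:R + stirling_cst + 2^-1 * ln n%:R + n%:R^-1 :> R.
Proof.
move=> n0; have := stirling_rem_bound n0; rewrite ler_norml => /andP[_].
have xi : 0 < n%:R^-1 :> R by rewrite invr_gt0 ltr0n.
by rewrite /stirling_rem invfM; lra.
Qed.

(** The lower-order terms use n + 1, so that empty cells are covered; at n = 0 it only says that
    [stirling_cst] is at most 2. The mean of 1/(n + 1) is easy to bound for a binomial n. *)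
Lemma ln_fact_ge n :
  n%:R * ln n%:R - n%:R + stirling_cst + 2^-1 * ln n.+1%:R - 2 / n.+1%:R <= ln n`!%:R :> R.
Proof.
have [->|] := posnP n.
  rewrite fact0 ln1 mul0r mulr0 divr1; have := stirling_cst_le; lra.
move=> n0; have := stirling_rem_bound n0; rewrite ler_norml => /andP[h _].
have x0 : 0 < n%:R :> R by rewrite ltr0n.
have h1 : ln n.+1%:R <= ln n%:R + n%:R^-1 :> R.
  rewrite (_ : n.+1%:R = n%:R * (1 + n%:R^-1)); last by rewrite -natr1; field; rewrite gt_eqF.
  have xi : 0 < n%:R^-1 :> R by rewrite invr_gt0.
  by rewrite lnM ?posrE ?ltr_wpDr// ?(ltW xi)// lerD2l le_ln1Dx//; lra.
have h2 : 3 / 4 * n%:R^-1 <= 2 / n.+1%:R :> R.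
  rewrite ler_pdivlMr ?ltr0n// mulrAC ler_pdivrMr// -natr1.
  have : 1 <= n%:R :> R by rewrite ler1n.
  by lra.
move: h h1 h2; rewrite /stirling_rem invfM.
by move: (ln n.+1%:R) n.+1%:R^-1 (ln n%:R) n%:R^-1 (ln _) => a b c e g; lra.
Qed.

End stirling.

(** * Multinomial counts *)

Section binomial.
Context {R : realType}.
Variable q : R.
Implicit Type h : nat -> R.

(** Expectation of h at a binomial count with m trials and success probability q, conditioning on
    one trial. *)
Fixpoint bin (m : nat) (h : nat -> R) : R :=
  if m is m'.+1 then q * bin m' (fun k => h k.+1) + (1 - q) * bin m' h else h 0%N.

Lemma eq_bin m h h' : h =1 h' -> bin m h = bin m h'.
Proof. by elim: m h h' => [|m IH] h h' hh /=; [exact: hh|congr (_ * _ + _ * _); apply: IH => k]. Qed.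

Lemma binD m h h' : bin m (fun k => h k + h' k) = bin m h + bin m h'.
Proof. by elim: m h h' => [//|m IH] h h' /=; rewrite !IH; ring. Qed.

Lemma binZ m c h : bin m (fun k => c * h k) = c * bin m h.
Proof. by elim: m h => [//|m IH] h /=; rewrite !IH; ring. Qed.

Lemma bin_cst m c : bin m (fun=> c) = c.
Proof. by elim: m => [//|m /= ->]; ring. Qed.

Lemma bin_mean m : bin m (fun k => k%:R - m%:R * q) = 0.
Proof.
elim: m => [|m IH] /=; first by rewrite mul0r subr0.
rewrite (@eq_bin _ _ (fun k => (k%:R - m%:R * q) + (1 - q))); last first.
  by move=> k; rewrite -!natr1; ring.
rewrite binD IH bin_cst (@eq_bin _ _ (fun k => (k%:R - m%:R * q) + (- q))); last first.
  by move=> k; rewrite -!natr1; ring.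
by rewrite binD IH bin_cst; ring.
Qed.

(** Linear in m: divided by (mq)^2 it is of order 1/m, where the absolute third moment would only
    give m^(-1/2). *)
Lemma bin_cube m : bin m (fun k => (k%:R - m%:R * q) ^+ 3) = m%:R * (q * (1 - q) * (1 - 2 * q)).
Proof.
elim: m => [|m IH] /=; first by rewrite !mul0r subr0 expr0n.
have E c : bin m (fun k => (k%:R - m%:R * q + c) ^+ 3) =
    bin m (fun k => (k%:R - m%:R * q) ^+ 3) +
    3 * c * bin m (fun k => (k%:R - m%:R * q) ^+ 2) + c ^+ 3.
  rewrite (@eq_bin _ _ (fun k => (k%:R - m%:R * q) ^+ 3 + 3 * c * (k%:R - m%:R * q) ^+ 2 +
    (3 * c ^+ 2 * (k%:R - m%:R * q) + c ^+ 3))); last by move=> k; ring.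
  by rewrite 3!binD !binZ bin_cst bin_mean; ring.
rewrite (@eq_bin _ _ (fun k => (k%:R - m%:R * q + (1 - q)) ^+ 3)); last first.
  by move=> k; rewrite -!natr1; congr (_ ^+ 3); ring.
rewrite E (@eq_bin _ (fun k => (k%:R - m.+1%:R * q) ^+ 3) (fun k => (k%:R - m%:R * q + (- q)) ^+ 3)); last first.
  by move=> k; rewrite -!natr1; congr (_ ^+ 3); ring.
by rewrite E IH -natr1; ring.
Qed.

Lemma bin_shift m h : bin m.+1 (fun k => k%:R * h k) = m.+1%:R * q * bin m (fun k => h k.+1).
Proof.
elim: m h => [|m IH] h; first by rewrite /=; ring.
rewrite [LHS]/= -!/(bin _.+1 _) IH.
rewrite (@eq_bin m.+1 _ (fun k => k%:R * h k.+1 + h k.+1)); last by move=> k; rewrite -natr1; ring.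
by rewrite binD IH /= -[m.+2%:R]natr1; ring.
Qed.

Lemma le_bin m h h' : 0 <= q <= 1 -> (forall k, h k <= h' k) -> bin m h <= bin m h'.
Proof.
move=> /andP[q0 q1]; elim: m h h' => [|m IH] h h' hh /=; first exact: hh.
by rewrite lerD// ler_wpM2l ?subr_ge0 ?IH.
Qed.

(** [bin_shift] with h k = 1/k turns the mean of 1/(k + 1) into that of k/k, which is 0 at k = 0 and
    1 otherwise. *)
Lemma bin_inv m : 0 <= q <= 1 -> bin m (fun k => k.+1%:R^-1) * (m%:R * q) <= 1.
Proof.
move=> q01; have := bin_shift m (fun k => k%:R^-1).
have b0 : 0 <= bin m (fun k => k.+1%:R^-1) by rewrite -[leLHS](bin_cst m); apply: le_bin.
have h : bin m.+1 (fun k => k%:R * k%:R^-1) <= 1.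
  rewrite -[leRHS](bin_cst m.+1); apply: le_bin => // k.
  by have [->|k0] := eqVneq (k%:R : R) 0; rewrite ?mul0r// divff.
move: q01 h => /andP[q0 _] /[swap] -> h; apply: le_trans h.
by rewrite mulrC ler_wpM2r// ler_wpM2r// ler_nat.
Qed.

End binomial.

Section multinomial.
Context {R : realType} {r : nat}.
Variable w : 'I_r -> R.
Hypotheses (w0 : forall a, 0 <= w a) (w1 : \sum_a w a = 1).
Implicit Types (g h : {ffun 'I_r -> nat} -> R) (nu : {ffun 'I_r -> nat}).

Definition incr nu (b : 'I_r) : {ffun 'I_r -> nat} := [ffun a => (nu a + (a == b))%N].

(* Expectation of g(N), with N the vector of counts of m independent draws from
   the weights w. *)
Fixpoint mult (m : nat) g : R :=
  if m is m'.+1 then \sum_b w b * mult m' (fun nu => g (incr nu b)) else g [ffun=> 0%N].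

Definition mult_support m nu := (\sum_a nu a = m)%N /\ forall a, w a = 0 -> nu a = 0%N.

Lemma sum_incr nu b : (\sum_a incr nu b a = (\sum_a nu a).+1)%N.
Proof.
rewrite (eq_bigr (fun a => nu a + (a == b))%N); last by move=> a _; rewrite ffunE.
by rewrite big_split /= -addn1; congr addn; rewrite (bigD1 b)//= eqxx big1// => a /negbTE ->.
Qed.

Lemma le_mult m g h : (forall nu, mult_support m nu -> g nu <= h nu) -> mult m g <= mult m h.
Proof.
elim: m g h => [|m IH] g h gh /=.
  apply: gh; split; first by rewrite big1// => a _; rewrite ffunE.
  by move=> a _; rewrite ffunE.
apply: ler_sum => b _; have [wb|wb] := eqVneq (w b) 0; first by rewrite wb !mul0r.
rewrite ler_wpM2l// IH// => nu [s1 s2]; apply: gh; split; first by rewrite sum_incr s1.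
move=> a wa; rewrite ffunE s2// add0n; have [ab|//] := eqVneq a b.
by rewrite -ab wa eqxx in wb.
Qed.

Lemma eq_mult m g h : (forall nu, mult_support m nu -> g nu = h nu) -> mult m g = mult m h.
Proof. by move=> gh; apply/eqP; rewrite eq_le !le_mult// => nu /gh ->. Qed.

Lemma multD m g h : mult m (fun nu => g nu + h nu) = mult m g + mult m h.
Proof.
elim: m g h => [//|m IH] g h /=; rewrite -big_split; apply: eq_bigr => b _.
by rewrite IH mulrDr.
Qed.

Lemma multZ m c g : mult m (fun nu => c * g nu) = c * mult m g.
Proof.
elim: m g => [//|m IH] g /=; rewrite mulr_sumr; apply: eq_bigr => b _.
by rewrite IH mulrCA.
Qed.

Lemma mult_cst m c : mult m (fun=> c) = c.
Proof. by elim: m => [//|m /= ->]; rewrite -mulr_suml w1 mul1r. Qed.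

Lemma mult_sum m I (s : seq I) (F : I -> {ffun 'I_r -> nat} -> R) (p : pred I) :
  mult m (fun nu => \sum_(i <- s | p i) F i nu) = \sum_(i <- s | p i) mult m (F i).
Proof.
elim: s => [|i s IH].
  rewrite big_nil -[RHS](mult_cst m); apply: eq_mult => nu _; exact: big_nil.
rewrite big_cons -IH; case: ifP => pi; last by apply: eq_mult => nu _; rewrite big_cons pi.
by rewrite -multD; apply: eq_mult => nu _; rewrite big_cons pi.
Qed.

Lemma multN m g : mult m (fun nu => - g nu) = - mult m g.
Proof. by rewrite -mulN1r -multZ; apply: eq_mult => nu _; rewrite mulN1r. Qed.

(** The factorials are multiplied out to keep the induction free of division. A first draw b leads
    to the counts nu reduced by one at b and accounts for a share nu b / (m + 1) of the right side;
    the shares add up to 1. *)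
Lemma mult_pmf m nu : (\sum_a nu a = m)%N ->
  mult m (fun nu' => (nu' == nu)%:R) * \prod_a (nu a)`!%:R = m`!%:R * \prod_a w a ^+ nu a.
Proof.
elim: m nu => [|m IH] nu snu.
  have nu0 a : nu a = 0%N.
    by apply/eqP; rewrite -leqn0 -snu (bigD1 a)//= leq_addr.
  have -> : nu = [ffun=> 0%N] by apply/ffunP => a; rewrite ffunE nu0.
  by rewrite /= eqxx mul1r mul1r; apply: eq_bigr => a _; rewrite !ffunE expr0.
rewrite /= mulr_suml factS -snu natrM natr_sum -mulrA mulr_suml; apply: eq_bigr => b _.
have [nub|nub] := posnP (nu b).
  rewrite nub mul0r (_ : mult _ _ = 0) ?mulr0 ?mul0r//.
  rewrite -[RHS](mult_cst m); apply: eq_mult => nu' _; case: eqP => // h.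
  by move: nub; rewrite -h ffunE eqxx addn1.
pose mu : {ffun 'I_r -> nat} := [ffun a => (nu a - (a == b))%N].
have Emu : incr mu b = nu.
  by apply/ffunP => a; rewrite !ffunE; have [->|] := eqVneq a b; rewrite ?subn0 ?addn0// subnK.
rewrite (@eq_mult _ _ (fun nu' => (nu' == mu)%:R)); last first.
  move=> nu' _; rewrite -Emu; congr (_%:R); congr nat_of_bool; apply/eqP/eqP => [h|-> //].
  by apply/ffunP => a; have := congr1 (fun f : {ffun _} => f a) h; rewrite !ffunE => /addIn.
have smu : (\sum_a mu a = m)%N by apply/eqP; rewrite -eqSS -(sum_incr mu b) Emu snu.
have mub : mu b = (nu b).-1 by rewrite ffunE eqxx subn1.
have mua a : a != b -> mu a = nu a by rewrite ffunE => /negbTE ->; rewrite subn0.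
have := IH _ smu; rewrite (bigD1 b)//= [in RHS](bigD1 b)//= [in RHS]mulrCA mub.
rewrite (eq_bigr (fun a => (nu a)`!%:R)); last by move=> a /mua ->.
rewrite [in RHS](eq_bigr (fun a => w a ^+ nu a)); last by move=> a /mua ->.
move=> h; rewrite (bigD1 b)//= [in RHS](bigD1 b)//=.
case: (nu b) nub h => [//|k] _ /=; rewrite factS natrM exprS.
move: (mult m _) k.+1%:R (\prod_(_ < r | _) _) (\prod_(_ < r | _) _) => M c p1 p2 h.
transitivity (w b * c * (M * (k`!%:R * p2))); first by ring.
by rewrite h; ring.
Qed.

Lemma mult_bin m a (h : nat -> R) : mult m (fun nu => h (nu a)) = bin (w a) m h.
Proof.
elim: m h => [|m IH] h /=; first by rewrite ffunE.
rewrite (bigD1 a)//= -IH -(IH h); congr (_ * _ + _).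
  by apply: eq_mult => nu _; rewrite ffunE eqxx addn1.
have -> : 1 - w a = \sum_(i < r | i != a) w i by rewrite -w1 (bigD1 a)//= [w a + _]addrC addrK.
rewrite mulr_suml; apply: eq_bigr => b /negbTE ab; congr (_ * _).
by apply: eq_mult => nu _; rewrite ffunE eq_sym ab addn0.
Qed.

End multinomial.

Section atoms.
Context {R : realType} {r : nat}.
Local Notation TR := (measurableTypeR R).
Variables (w : 'I_r -> R) (t : 'I_r -> R) (mu : probability TR R).
Hypotheses (w1 : \sum_a w a = 1) (tinj : injective t) (muw : forall a, mu [set t a] = (w a)%:E).

Definition atoms : set TR := [set x | exists a, x = t a].

Lemma atomsE x : \1_atoms x = \sum_a \1_[set t a] x :> R.
Proof.
rewrite indicE; have [xA|xA] := boolP (x \in atoms).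
  have [a ->] : atoms x by move: xA; rewrite inE.
  rewrite (bigD1 a)//= indicE mem_set// big1 ?addr0// => b ba.
  by rewrite indicE memNset// => /tinj /esym/eqP; rewrite (negbTE ba).
rewrite big1// => a _; rewrite indicE memNset// => xa; case/negP: xA.
by rewrite inE; exists a.
Qed.

Lemma measurable_atoms : measurable atoms.
Proof.
rewrite (_ : atoms = \bigcup_(a in [set: 'I_r]) [set t a]).
  by apply: fin_bigcup_measurable => // a _; exact: measurable_set1.
by apply/seteqP; split => x; [case=> a ->; exists a|case=> a _ /= ->; exists a].
Qed.

Let b1 a : bmf (\1_[set t a] : TR -> R).
Proof. by apply: bmf_indic; exact: measurable_set1. Qed.

Let Ex1 a : Ex mu \1_[set t a] = w a.
Proof. by rewrite Ex_indic ?muw//; exact: measurable_set1. Qed.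

Lemma atoms_as : mu atoms = 1%E.
Proof.
rewrite probE; last exact: measurable_atoms.
have -> : Ex mu \1_atoms = Ex mu (fun x => \sum_a \1_[set t a] x) by apply: eq_Ex; exact: atomsE.
by rewrite Ex_sum//; under eq_bigr do rewrite Ex1; rewrite w1.
Qed.

Lemma Ex_atoms (H : TR -> R) : bmf H -> Ex mu H = \sum_a w a * H (t a).
Proof.
move=> bH; have bs a : bmf (fun x : TR => H (t a) * \1_[set t a] x) by exact: bmfZ.
rewrite (@eq_Ex_as _ _ _ _ atoms H (fun x => \sum_a H (t a) * \1_[set t a] x))//.
- rewrite Ex_sum//; apply: eq_bigr => a _.
  by rewrite -(Ex1 a) mulrC -ExZ.
- exact: measurable_atoms.
- exact: atoms_as.
- by apply: bmf_sum.
move=> x [a ->]; rewrite (bigD1 a)//= indicE mem_set// mulr1 big1 ?addr0// => b ba.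
by rewrite indicE memNset ?mulr0// => /tinj /esym/eqP; rewrite (negbTE ba).
Qed.

Definition counts {m} (x : rvec R m) : {ffun 'I_r -> nat} :=
  [ffun a => \sum_(i < m) (x i == t a)]%N.

Lemma counts_le m (x : rvec R m) a : (counts x a <= m)%N.
Proof.
rewrite ffunE -[leqRHS](card_ord m) -sum1_card.
by apply: leq_sum => i _; case: (_ == _).
Qed.

Lemma measurable_counts m nu : measurable [set x : rvec R m | counts x = nu].
Proof.
pose c (x : rvec R m) : rvec R r := fun a => \sum_i \1_[set t a] (x i).
have mc : measurable_fun setT c.
  apply: measurable_fun_fin_prod => a; apply: measurable_sum => i.
  have mi : measurable_fun setT (fun x : rvec R m => x i : TR) by exact: measurable_coord.
  by have [] := bmf_comp mi (b1 a).
have cE x a : c x a = (counts x a)%:R.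
  rewrite ffunE /c natr_sum; apply: eq_bigr => i _; rewrite indicE.
  by congr (_%:R); congr nat_of_bool; apply/idP/eqP; rewrite inE.
rewrite (_ : [set x | _] = c @^-1` [set y | forall a, [set (nu a)%:R] (y a)]).
  rewrite -[X in measurable X]setTI; apply: mc => //.
  by apply: (@measurable_box _ _ (fun=> TR) (fun a => [set (nu a)%:R])) => a; exact: measurable_set1.
apply/seteqP; split => x /=; first by move=> <- a; rewrite cE.
by move=> h; apply/ffunP => a; apply/eqP; rewrite -(eqr_nat R) -cE; apply/eqP; exact: h.
Qed.

End atoms.

Section bounded_counts.
Context {R : realType} {r : nat}.

Definition widen_counts {N} (nu : {ffun 'I_r -> 'I_N}) : {ffun 'I_r -> nat} :=
  [ffun a => nu a : nat].

(** Writes a function of bounded counts as a finite sum of indicators, the form from which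
    measurability is read off. *)
Lemma sum_widen_counts N (n : {ffun 'I_r -> nat}) (g : {ffun 'I_r -> nat} -> R) :
  (forall a, n a < N)%N ->
  \sum_(nu : {ffun 'I_r -> 'I_N}) (n == widen_counts nu)%:R * g (widen_counts nu) = g n.
Proof.
move=> nN; pose nu0 : {ffun 'I_r -> 'I_N} := [ffun a => Ordinal (nN a)].
have E : widen_counts nu0 = n by apply/ffunP => a; rewrite !ffunE.
rewrite (bigD1 nu0)//= E eqxx mul1r big1 ?addr0// => nu nn.
case: eqP => [h|_]; last by rewrite mul0r.
case/eqP: nn; apply/ffunP => a; apply/val_inj => /=.
by rewrite ffunE /= h ffunE.
Qed.

End bounded_counts.

Section tomography_counts.
Context {R : realType} {r : nat}.
Local Notation TR := (measurableTypeR R).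
Variables (w : 'I_r -> R) (t : 'I_r -> R) (mu : probability TR R).
Hypotheses (w1 : \sum_a w a = 1) (tinj : injective t) (muw : forall a, mu [set t a] = (w a)%:E).

Lemma bmf_counts m (g : {ffun 'I_r -> nat} -> R) : bmf (fun x : rvec R m => g (counts t x)).
Proof.
rewrite (_ : (fun x => _) = fun x : rvec R m => \sum_(nu : {ffun 'I_r -> 'I_m.+1})
   g (widen_counts nu) * \1_[set x | counts t x = widen_counts nu] x); last first.
  apply/funext => x; rewrite -[LHS](@sum_widen_counts _ _ m.+1).
    apply: eq_bigr => nu _; rewrite mulrC indicE; congr (_ * _%:R).
    by congr nat_of_bool; apply/eqP/idP; rewrite inE.
  by move=> a; rewrite ltnS counts_le.
apply: bmf_sum => nu _; apply: bmfZ; apply: bmf_indic; exact: measurable_counts.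
Qed.

(** Conditioning on the first outcome reproduces the recursion of [mult]. *)
Lemma Ex_counts m (P : probability (rvec R m) R) (g : {ffun 'I_r -> nat} -> R) :
  product_law (fun=> mu) P -> Ex P (fun x => g (counts t x)) = mult w m g.
Proof.
elim: m P g => [|m IH] P g hP.
  rewrite (@eq_Ex _ _ _ _ _ (fun=> g [ffun=> 0%N])) ?Ex_cst// => x.
  by congr g; apply/ffunP => a; rewrite !ffunE big_ord0.
have [Q hQ EQ] := product_law_tail hP.
rewrite EQ; last exact: bmf_counts.
pose phi (z : TR * rvec R m) : rvec R m.+1 := fcons (T := fun=> TR) z.
have bphi : bmf (fun z => g (counts t (phi z))).
  have mphi : measurable_fun setT phi by exact: (@measurable_fcons _ m (fun=> TR)).
  have h := bmf_comp mphi (@bmf_counts m.+1 g).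
  exact h.
rewrite (Ex_atoms w1 tinj muw) /=; last exact: bmf_Ex_snd bphi.
apply: eq_bigr => b _; congr (_ * _); rewrite -(IH _ _ hQ).
apply: eq_Ex => y; congr g; apply/ffunP => a; rewrite !ffunE big_ord_recl addnC; congr addn.
  by apply: eq_bigr => i _; rewrite /fcons (dconsS (T := fun=> TR)).
by rewrite /fcons (dcons0 (T := fun=> TR)) /= (inj_eq tinj) eq_sym.
Qed.

Lemma coords_in_atoms_as m (P : probability (rvec R m) R) : product_law (fun=> mu) P ->
  P [set x | forall i, atoms t (x i)] = 1%E.
Proof.
move=> hP; rewrite (hP (fun=> atoms t)) ?big1//.
  by move=> i _; exact: (atoms_as w1 tinj muw).
by move=> i; exact: measurable_atoms.
Qed.

End tomography_counts.

Lemma ln_prod {R : realType} I (s : seq I) (F : I -> R) : (forall i, 0 < F i) ->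
  0 < \prod_(i <- s) F i /\ ln (\prod_(i <- s) F i) = \sum_(i <- s) ln (F i).
Proof.
move=> F0; elim: s => [|i s [h1 h2]]; first by rewrite !big_nil ln1.
by rewrite !big_cons mulr_gt0// lnM ?posrE// h2.
Qed.

(** * Comparison of the multinomial and normal laws *)

Section log_density.
Context {R : realType}.

(** The factor sqrt (2 pi) appears as [stirling_cst], so it cancels exactly against Stirling's
    formula. *)
Lemma ln_normal_pdf (v x : R) : 0 < v ->
  0 < normal_pdf 0 (Num.sqrt v) x /\
  ln (normal_pdf 0 (Num.sqrt v) x) = - stirling_cst - 2^-1 * ln v - x ^+ 2 / v / 2.
Proof.
move=> v0; have s0 : Num.sqrt v != 0 by rewrite gt_eqF// sqrtr_gt0.
have pi0 := @pi_gt0 R.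
rewrite /normal_pdf (negbTE s0) /normal_peak /normal_fun sqr_sqrtr ?ltW// subr0.
set y := v * pi *+ 2; have y0 : 0 < y by rewrite /y pmulrn_rgt0// mulr_gt0.
have z0 : 0 < Num.sqrt y by rewrite sqrtr_gt0.
split; first by rewrite mulr_gt0 ?expR_gt0// invr_gt0.
rewrite lnM ?posrE ?invr_gt0 ?expR_gt0// expRK lnV ?posrE//.
have -> : ln (Num.sqrt y) = 2^-1 * ln y.
  by have := lnXn 2 z0; rewrite sqr_sqrtr ?ltW// => ->; rewrite mulr2n; field.
have -> : y = v * (2 * pi) by rewrite /y -mulr_natr; ring.
rewrite lnM ?posrE ?mulr_gt0// /stirling_cst -mulr_natr invfM; field.
by rewrite gt_eqF.
Qed.

Variable m : R.
Hypothesis m0 : 0 < m.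

(** For [sigma] = 0 and M = 1 the right side is Pearson's statistic of all d + 1 cells, the last one
    having minus the sum of the other deviations. *)
Lemma resid_quad d M (q : 'I_d -> R) sigma (v : rvec R d) :
  (forall i, 0 < q i) -> \sum_i q i < M ->
  \sum_k resid m M q sigma v k ^+ 2 / tau2 m M q k =
  \sum_k (v k - m * q k) ^+ 2 / (m * q k) +
  (sigma + \sum_k (v k - m * q k)) ^+ 2 / (m * (M - \sum_k q k)) - sigma ^+ 2 / (m * M).
Proof.
elim: d M q sigma v => [|d IH] M q sigma v q0 qM.
  by rewrite !big_ord0 addr0 subr0 add0r subrr.
have q'0 i : 0 < q (lift ord0 i) by exact: q0.
have q'M : \sum_i q (lift ord0 i) < M - q ord0 by move: qM; rewrite big_ord_recl ltrBrDl.
have M' : 0 < M - q ord0 by apply: le_lt_trans q'M; apply: sumr_ge0 => i _; exact/ltW.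
have qo := q0 ord0.
rewrite big_ord_recl resid0 tau20.
under eq_bigr do rewrite residS tau2S.
rewrite IH// !big_ord_recl /= opprD !addrA.
have : M - q ord0 - \sum_i q (lift ord0 i) != 0 by rewrite gt_eqF// subr_gt0.
move: (M - q ord0 - _) => A A0.
set B := \sum_(k < d) _ / _; set C := \sum_(k < d) (_ - _).
by field; rewrite A0 !gt_eqF//; lra.
Qed.

(** Logarithm of the determinant of the multinomial covariance: the ratios of successive masses
    telescope. *)
Lemma ln_tau2 d M (q : 'I_d -> R) : (forall i, 0 < q i) -> \sum_i q i < M ->
  \sum_k ln (tau2 m M q k) = d%:R * ln m + \sum_k ln (q k) + ln (M - \sum_k q k) - ln M.
Proof.
elim: d M q => [|d IH] M q q0 qM; first by rewrite !big_ord0 subr0 mul0r !add0r subrr.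
have q'0 i : 0 < q (lift ord0 i) by exact: q0.
have q'M : \sum_i q (lift ord0 i) < M - q ord0 by move: qM; rewrite big_ord_recl ltrBrDl.
have M' : 0 < M - q ord0 by apply: le_lt_trans q'M; apply: sumr_ge0 => i _; exact/ltW.
have qo := q0 ord0; have M0 : 0 < M by lra.
rewrite big_ord_recl tau20; under eq_bigr do rewrite tau2S.
rewrite IH// !big_ord_recl /= opprD !addrA.
rewrite lnM ?posrE ?divr_gt0 ?mulr_gt0// ln_div ?posrE ?mulr_gt0// lnM ?posrE//.
by rewrite -natr1; ring.
Qed.

Lemma ln_resid_pdf d (q : 'I_d -> R) (v : rvec R d) :
  (forall i, 0 < q i) -> \sum_i q i < 1 ->
  0 < resid_pdf m 1 q 0 v /\
  ln (resid_pdf m 1 q 0 v) = - (d%:R * stirling_cst)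
    - 2^-1 * (d%:R * ln m + \sum_k ln (q k) + ln (1 - \sum_k q k))
    - 2^-1 * (\sum_k (v k - m * q k) ^+ 2 / (m * q k) +
        (\sum_k (v k - m * q k)) ^+ 2 / (m * (1 - \sum_k q k))).
Proof.
move=> q0 q1; have t0 k : 0 < tau2 m 1 q k by apply: tau2_gt0.
pose F k := normal_pdf 0 (Num.sqrt (tau2 m 1 q k)) (resid m 1 q 0 v k).
have F0 k : 0 < F k by have [] := ln_normal_pdf (resid m 1 q 0 v k) (t0 k).
have [h ->] := ln_prod (index_enum 'I_d) F0; split => //.
under eq_bigr => k _ do rewrite (ln_normal_pdf (resid m 1 q 0 v k) (t0 k)).2.
have := resid_quad 0 v q0 q1; have := ln_tau2 q0 q1.
rewrite ln1 subr0 add0r expr0n /= mul0r subr0 => h1 h2.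
rewrite -h2 !sumrB -!mulr_suml -mulr_sumr h1 sumrN sumr_const card_ord -mulr_natl.
ring.
Qed.

End log_density.

Section multinomial_normal.
Context {R : realType}.
Local Notation TR := (measurableTypeR R).

(** Three errors: the cubic Taylor term of x ln (x/P), the replacement of ln (x + 1) by ln P in half
    the logarithm, and the error term of Stirling's formula. *)
Definition entropy_rem (P x : R) : R :=
  (x - P) ^+ 3 / (6 * P ^+ 2) + 2^-1 * (P / (x + 1) - 1) + 2 / (x + 1).

Lemma ln_fact_cubic (P : R) (x : nat) : 0 < P ->
  x%:R * ln P - ln x`!%:R <=
  P - (x%:R - P) ^+ 2 / P / 2 - stirling_cst - 2^-1 * ln P + entropy_rem P x%:R.
Proof.
move=> P0; have := @ln_fact_ge R x.
have x1 : 0 < x%:R + 1 :> R by rewrite ltr_wpDl// ler0n.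
have h1 : ln P - ln (x%:R + 1) <= P / (x%:R + 1) - 1.
  have hh : -1 < P / (x%:R + 1) - 1 by rewrite ltrBrDl subrr divr_gt0.
  by have := le_ln1Dx hh; rewrite addrC subrK ln_div ?posrE.
have h2 : P * ((x%:R / P - 1) + (x%:R / P - 1) ^+ 2 / 2 - (x%:R / P - 1) ^+ 3 / 6) <=
    x%:R * ln x%:R - x%:R * ln P.
  have t0 : 0 <= x%:R / P by rewrite divr_ge0 ?ler0n ?(ltW P0).
  apply: le_trans (ler_wpM2l (ltW P0) (mul_ln_ge_cubic t0)) _.
  rewrite mulrA mulrCA divff ?gt_eqF// mulr1; case: x {x1 h1 t0} => [|x]; first by rewrite !mul0r subrr.
  by rewrite ln_div ?posrE ?ltr0n// mulrBr.
have h3 : P * ((x%:R / P - 1) + (x%:R / P - 1) ^+ 2 / 2 - (x%:R / P - 1) ^+ 3 / 6) =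
    x%:R - P + (x%:R - P) ^+ 2 / P / 2 - (x%:R - P) ^+ 3 / (6 * P ^+ 2).
  by field; rewrite gt_eqF.
rewrite h3 in h2; rewrite /entropy_rem -[x.+1%:R]natr1.
set a := _ ^+ 3 / _ in h2 *; set b := _ / _ / 2 in h2 *.
by move: h1 h2; move: (P / _) (2 / _) => c c' h1 h2 h4; lra.
Qed.

(** The cubic term has mean at most 1/(mq) by [bin_cube]; by [bin_inv] the second has mean at most 0
    and the third at most 2/(mq). *)
Lemma bin_entropy_rem (q c0 : R) m : (0 < m)%N -> 0 < c0 -> c0 <= q -> q <= 1 ->
  bin q m (fun k => entropy_rem (m%:R * q) k%:R) <= 3 / (m%:R * c0).
Proof.
move=> m0 c00 cq q1; have q0 : 0 < q by apply: lt_le_trans cq.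
have mR : 0 < m%:R :> R by rewrite ltr0n.
have P0 : 0 < m%:R * q by rewrite mulr_gt0.
rewrite (@eq_bin _ _ _ _ (fun k => (6 * (m%:R * q) ^+ 2)^-1 * (k%:R - m%:R * q) ^+ 3 +
  ((2^-1 * (m%:R * q) + 2) * k.+1%:R^-1 + - 2^-1))); last first.
  move=> k; have kk : k%:R + 1 != 0 :> R by rewrite natr1 pnatr_eq0.
  by rewrite /entropy_rem -[k.+1%:R]natr1; move: (k%:R) kk => y kk; field; rewrite ?kk ?gt_eqF.
rewrite !binD !binZ bin_cst bin_cube.
have q01 : 0 <= q <= 1 by rewrite ltW.
have := bin_inv m q01; set b := bin _ _ _ => hb.
have b2 : b <= (m%:R * q)^-1 by rewrite -[leRHS]mul1r ler_pdivlMr.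
have I : (m%:R * q)^-1 <= (m%:R * c0)^-1.
  by rewrite lef_pV2 ?posrE ?mulr_gt0// ler_wpM2l// ltW.
have -> : (6 * (m%:R * q) ^+ 2)^-1 * (m%:R * (q * (1 - q) * (1 - 2 * q))) =
    (m%:R * q)^-1 * ((1 - q) * (1 - 2 * q) / 6) by field; rewrite !gt_eqF.
have -> : (2^-1 * (m%:R * q) + 2) * b = 2^-1 * (b * (m%:R * q)) + 2 * b by ring.
set J := (m%:R * q)^-1 in b2 I *; have J0 : 0 < J by rewrite invr_gt0.
have h : J * ((1 - q) * (1 - 2 * q) / 6) <= J * 1.
  by rewrite ler_wpM2l ?ltW//; nra.
by lra.
Qed.

Variables (r m : nat) (p : 'I_r -> R) (P1 : probability (rvec R r) R).
Hypotheses (m0 : (0 < m)%N) (p0 : forall a, 0 <= p a) (psum : \sum_a p a = 1).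
Hypothesis HP1 : forall (t : 'I_r -> R) (A : set TR), measurable A ->
  P1 [set y : rvec R r | A (\sum_a t a * (y a - p a))] = normal_law 0 (mvar m p t) A.
Variables (d : nat) (e : 'I_d -> 'I_r) (star : 'I_r) (c0 : R).
Hypotheses (einj : injective e) (estar : forall k, e k != star)
  (esupp : forall a, p a = 0 \/ a = star \/ exists k, a = e k).
Hypotheses (c00 : 0 < c0) (qc0 : forall k, c0 <= p (e k)) (starc0 : c0 <= p star).

Let q k := p (e k).
Let q0 k : 0 < q k. Proof. exact: lt_le_trans (qc0 k). Qed.
Let pstar0 : 0 < p star. Proof. exact: lt_le_trans starc0. Qed.
Let mR : 0 < m%:R :> R. Proof. by rewrite ltr0n. Qed.
Let qstar : 1 - \sum_k q k = p star.
Proof. by rewrite (qsum psum einj estar esupp) opprB addrC subrK. Qed.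
Let qlt1 : \sum_k q k < 1.
Proof. by rewrite -subr_gt0 qstar. Qed.

Let S (F : 'I_r -> R) : R := F star + \sum_k F (e k).

Let SE (F : 'I_r -> R) : (forall a, p a = 0 -> F a = 0) -> \sum_a F a = S F.
Proof. exact: (sum_supp einj estar esupp). Qed.

Let SD F G : S (fun a => F a + G a) = S F + S G.
Proof. by rewrite /S big_split /= addrACA. Qed.

Let SZ c F : S (fun a => c * F a) = c * S F.
Proof. by rewrite /S -mulr_sumr mulrDr. Qed.

Let SN F : S (fun a => - F a) = - S F.
Proof. by rewrite /S sumrN opprD. Qed.

Let SB F G : S (fun a => F a - G a) = S F - S G.
Proof. by rewrite SD SN. Qed.

Let S1 c : S (fun=> c) = d.+1%:R * c.
Proof. by rewrite /S sumr_const card_ord -[d.+1%:R]natr1 -mulr_natl; ring. Qed.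

Let Sle F G : (forall a, c0 <= p a -> F a <= G a) -> S F <= S G.
Proof. by move=> FG; rewrite lerD ?FG// ler_sum// => k _; rewrite FG ?qc0. Qed.

Let P a : R := m%:R * p a.

Let SP : S P = m%:R.
Proof. by rewrite SZ -(@SE p) ?psum ?mulr1. Qed.

Section one_count.
Variable nu : {ffun 'I_r -> nat}.
Hypothesis hnu : mult_support p m nu.
Let x a : R := (nu a)%:R.

Let Sx : S x = m%:R.
Proof.
rewrite -SE; last by move=> a pa; rewrite /x hnu.2.
by rewrite /x -natr_sum hnu.1.
Qed.

(** Stirling's formula cell by cell. The terms linear in the counts cancel those of the factorial of
    m, since counts and means both have total m over the cells of positive probability. *)
Lemma ln_mult_pmf : let M := mult p m (fun nu' => (nu' == nu)%:R) in
  0 < M /\ ln M <= m%:R^-1 - d%:R * stirling_cst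
    - 2^-1 * (d%:R * ln m%:R + S (fun a => ln (p a)))
    - 2^-1 * S (fun a => (x a - P a) ^+ 2 / P a) + S (fun a => entropy_rem (P a) (x a)).
Proof.
move=> M; have fx a : 0 < (nu a)`!%:R :> R by rewrite ltr0n fact_gt0.
(* A cell of probability 0 has count 0, and 0^0 = 1. *)
have px a : 0 < p a ^+ nu a.
  have [pa|pa] := eqVneq (p a) 0; first by rewrite hnu.2// expr0.
  by rewrite exprn_gt0// lt_neqAle eq_sym pa p0.
have [f1 f2] := ln_prod (index_enum 'I_r) fx; have [p1 p2] := ln_prod (index_enum 'I_r) px.
have mf : 0 < m`!%:R :> R by rewrite ltr0n fact_gt0.
have E : M = m`!%:R * \prod_a p a ^+ nu a / \prod_a (nu a)`!%:R.
  by rewrite -(mult_pmf p0 psum hnu.1) mulfK// gt_eqF.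
split; first by rewrite E divr_gt0// mulr_gt0.
rewrite E ln_div ?posrE ?mulr_gt0// lnM ?posrE// f2 p2 -addrA -sumrB SE; last first.
  by move=> a pa; rewrite hnu.2// expr0 fact0 ln1 subrr.
have h : S (fun a => ln (p a ^+ nu a) - ln (nu a)`!%:R) <=
    S (fun a => P a - 2^-1 * ((x a - P a) ^+ 2 / P a) - stirling_cst
      - 2^-1 * (ln m%:R + ln (p a)) + entropy_rem (P a) (x a) - ln m%:R * x a).
  apply: Sle => a ca; have pa : 0 < p a by apply: lt_le_trans ca.
  have Pa : 0 < P a by rewrite mulr_gt0.
  have := ln_fact_cubic (nu a) Pa; rewrite -/(x a) lnXn// -(mulr_natl (ln (p a))) -/(x a).
  rewrite [in X in X -> _](lnM (x := m%:R) (y := p a)) ?posrE//.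
  by move: (_ ^+ 2 / _) (entropy_rem _ _) (ln (nu a)`!%:R) => A B C; lra.
have Sp : S p = 1 by rewrite -SE.
move: h; move: entropy_rem => Er; rewrite !(SD, SN, SZ) !S1 Sp Sx.
have := @ln_fact_le R m m0.
move: (S _) (S _) (S _) (S _) => A B C D; rewrite -[d.+1%:R]natr1 /stirling_cst; lra.
Qed.

(* The terms (x - P)^2 / (2P) of the multinomial and of the normal density cancel. *)
Lemma log_likelihood_ratio (u : rvec R d) :
  forall v, v = cell_point (fun k => (nu (e k))%:R) u ->
  ln (mult p m (fun nu' => (nu' == nu)%:R)) - ln (resid_pdf m%:R 1 q 0 v) <=
  (m%:R^-1 + S (fun a => entropy_rem (P a) (x a)) + (d%:R + d%:R ^+ 2) / (2 * (m%:R * c0))) +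
  (\sum_k (x (e k) - P (e k)) / P (e k) * clip (u k) -
   (x star - P star) / P star * \sum_k clip (u k)).
Proof.
move=> v vE; have [_ h] := ln_mult_pmf; move: h.
have [_ ->] := ln_resid_pdf mR v q0 qlt1.
rewrite qstar.
have -> : \sum_k (v k - m%:R * q k) = - (x star - P star) + \sum_k clip (u k).
  have : S (fun a => x a - P a) = 0 by rewrite SB Sx SP subrr.
  rewrite /S => /eqP; rewrite addr_eq0 => /eqP ->; rewrite opprK -big_split; apply: eq_bigr => k _.
  by rewrite vE /cell_point /P /q /x /=; ring.
have -> : \sum_k (v k - m%:R * q k) ^+ 2 / (m%:R * q k) =
   \sum_k (x (e k) - P (e k)) ^+ 2 / P (e k) + 2 * \sum_k (x (e k) - P (e k)) / P (e k) * clip (u k) +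
   \sum_k clip (u k) ^+ 2 / P (e k).
  rewrite mulr_sumr -!big_split; apply: eq_bigr => k _ /=; rewrite vE /cell_point /P -/(q k) -/(x (e k)).
  by have := q0 k => qk; field; rewrite !gt_eqF.
have I a : c0 <= p a -> (P a)^-1 <= (m%:R * c0)^-1.
  move=> ca; rewrite lef_pV2 ?posrE ?mulr_gt0//; last exact: lt_le_trans ca.
  by rewrite ler_wpM2l// ltW.
have sumc (c : R) : \sum_(k < d) c = d%:R * c by rewrite sumr_const card_ord mulr_natl.
set J := (m%:R * c0)^-1 in I; have J0 : 0 < J by rewrite invr_gt0 mulr_gt0.
have h1 : \sum_k clip (u k) ^+ 2 / P (e k) <= d%:R * J.
  rewrite -sumc; apply: ler_sum => k _.
  have := clip01 (u k) => /andP[c1 c2]; have := I _ (qc0 k) => h.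
  have h' : 0 <= (P (e k))^-1 by rewrite invr_ge0 ltW// /P mulr_gt0 ?q0.
  by rewrite -[leRHS]mul1r ler_pM ?sqr_ge0// expr_le1// ltW.
have hs : 0 <= \sum_k clip (u k) <= d%:R.
  apply/andP; split; first by apply: sumr_ge0 => k _; have /andP[] := clip01 (u k).
  rewrite -[leRHS]mulr1 -sumc; apply: ler_sum => k _.
  by have /andP[_ /ltW] := clip01 (u k).
set s := \sum_k clip (u k) in hs *.
have h2 : s ^+ 2 / P star <= d%:R ^+ 2 * J.
  have h' : 0 <= (P star)^-1 by rewrite invr_ge0 ltW// mulr_gt0.
  have /andP[s0 s1] := hs; rewrite ler_pM ?sqr_ge0 ?I//.
  by rewrite ler_pXn2r// nnegrE.
have -> : (d%:R + d%:R ^+ 2) / (2 * (m%:R * c0)) = 2^-1 * (d%:R * J + d%:R ^+ 2 * J).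
  by rewrite /J; field; rewrite !gt_eqF.
have -> : (- (x star - P star) + s) ^+ 2 / (m%:R * p star) =
   (x star - P star) ^+ 2 / P star - 2 * ((x star - P star) / P star * s) + s ^+ 2 / P star.
  by rewrite -/(P star); have : 0 < P star by [rewrite mulr_gt0]; move=> Ps; field; rewrite gt_eqF.
rewrite /S; move: (\sum_k ln _) (\sum_k _ ^+ 2 / _) (\sum_k _ ^+ 2 / _) h1 (_ ^+ 2 / P star) h2.
move=> A B C h1 D h2.
move: ((x star - P star) ^+ 2 / P star) (\sum_k _ * clip _) => E F.
move: (_ * s) (entropy_rem _ _) (\sum_k entropy_rem _ _) (ln (p star)) => G H K L.
lra.
Qed.

End one_count.

(** The subtraction is truncated, so this completes the counts to total m only when their sum is at
    most m; hence the indicator in [mult_complete_counts]. *)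
Definition complete_counts (nu : {ffun 'I_d -> 'I_m.+1}) : {ffun 'I_r -> nat} :=
  [ffun a => if a == star then (m - \sum_k nu k)%N else (\sum_(k | e k == a) nu k)%N].

Let complete_e nu k : complete_counts nu (e k) = nu k.
Proof.
rewrite ffunE (negbTE (estar k)) (big_pred1 k)// => j.
by rewrite (inj_eq einj).
Qed.

Let sum_nat (n : {ffun 'I_r -> nat}) : (forall a, p a = 0 -> n a = 0%N) ->
  (\sum_a n a = n star + \sum_k n (e k))%N.
Proof.
move=> n0; apply/eqP; rewrite -(eqr_nat R) natrD !natr_sum.
by rewrite (@SE (fun a => (n a)%:R))// => a pa; rewrite n0.
Qed.

Lemma complete_counts_support (nu : {ffun 'I_d -> 'I_m.+1}) : (\sum_k nu k <= m)%N ->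
  mult_support p m (complete_counts nu).
Proof.
move=> hs; have z a : p a = 0 -> complete_counts nu a = 0%N.
  move=> pa; rewrite ffunE; case: eqP => [h|_].
    by move: pstar0; rewrite -h pa ltxx.
  by rewrite big1// => k /eqP ek; have := q0 k; rewrite /q ek pa ltxx.
split=> //; rewrite sum_nat// {1}ffunE eqxx; under [X in (_ + X)%N]eq_bigr do rewrite complete_e.
by rewrite subnK.
Qed.

Lemma mult_complete_counts g : mult p m g =
  \sum_(nu : {ffun 'I_d -> 'I_m.+1}) (\sum_k nu k <= m)%N%:R *
    (mult p m (fun nu' => (nu' == complete_counts nu)%:R) * g (complete_counts nu)).
Proof.
transitivity (mult p m (fun nu' => \sum_(nu : {ffun 'I_d -> 'I_m.+1}) ((\sum_k nu k <= m)%N%:R * g (complete_counts nu)) *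
    (nu' == complete_counts nu)%:R)); last first.
  rewrite (mult_sum p0 psum); apply: eq_bigr => nu _; rewrite multZ; ring.
apply: (eq_mult p0) => n [n1 n2].
have ns := sum_nat n2; rewrite n1 in ns.
have nk k : (n (e k) < m.+1)%N.
  by rewrite ltnS ns (bigD1 k)//= addnCA leq_addr.
pose nu0 : {ffun 'I_d -> 'I_m.+1} := [ffun k => Ordinal (nk k)].
have s0 : (\sum_k nu0 k = \sum_k n (e k))%N by apply: eq_bigr => k _; rewrite ffunE.
have E : complete_counts nu0 = n.
  apply/ffunP => a; have [pa|[->|[k ->]]] := esupp a.
  - by rewrite n2// (complete_counts_support _).2// s0 [leqRHS]ns leq_addl.
  - by rewrite ffunE eqxx s0 ns addnK.
  by rewrite complete_e ffunE.
have hle : (\sum_k nu0 k <= m)%N by rewrite s0 [leqRHS]ns leq_addl.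
rewrite (bigD1 nu0)//= E eqxx mulr1 hle mul1r big1 ?addr0// => nu nn.
case: eqP => [h|_]; last by rewrite mulr0.
case/eqP: nn; apply/ffunP => k; apply/val_inj => /=.
by rewrite ffunE /= h complete_e.
Qed.

(** In the constant, 1 is the error for the factorial of m, 3 / c0 the mean remainder of each of the
    d + 1 cells, and d + d^2 bounds the squared noise of the cells [e k] and of [star], which
    carries the sum of all noises. *)
Lemma multinomial_normal (U : probability (rvec R d) R) (f : rvec R r -> R) :
  product_law (fun=> uniform01) U -> measurable_fun setT f -> (forall y, -1 <= f y <= 1) ->
  mult p m (fun nu => Ex U (fun u =>
    f (yvec m e star (cell_point (fun k => (nu (e k))%:R) u)))) + 1 <=
  Ex P1 (expR \o f) + (1 + (3 * d.+1%:R + d%:R + d%:R ^+ 2) / c0) / m%:R.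
Proof.
move=> hU mf f1; have bf : bmf f := bmf_itv mf f1.
have F0 y : 0 <= (expR \o f) y by exact: expR_ge0.
have H := regression_cells m0 HP1 psum einj estar esupp q0 pstar0 m.+1 hU (bmf_expR bf) F0.
pose Y (n : {ffun 'I_r -> nat}) (u : rvec R d) := yvec m e star (cell_point (fun k => (n (e k))%:R) u).
have mY n : measurable_fun setT (Y n).
  exact: (measurableT_comp (measurable_yvec m e star) (measurable_cell_point _)).
have bY n : bmf (fun u => f (Y n u)) := bmf_comp (mY n) bf.
pose X a (n : {ffun 'I_r -> nat}) : R := ((n a)%:R - P a) / P a.
pose D : R := (d%:R + d%:R ^+ 2) / (2 * (m%:R * c0)).
pose b (n : {ffun 'I_r -> nat}) := m%:R^-1 + S (fun a => entropy_rem (P a) (n a)%:R) + D.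
have bc k : bmf (fun u : rvec R d => clip (u k)).
  have mk : measurable_fun setT (fun u : rvec R d => u k : TR) by exact: measurable_coord.
  apply: (bmf_comp (phi := fun u : rvec R d => u k : TR) mk (f := clip)).
  apply: (@bmf_itv _ _ _ _ 0 1); first exact: measurable_clip.
  by move=> x; have /andP[-> /ltW] := clip01 x.
pose xi k := Ex U (fun u => clip (u k)).
pose G n := 1 + Ex U (fun u => f (Y n u)) - (b n + (\sum_k X (e k) n * xi k - X star n * \sum_k xi k)).
have term (nu : {ffun 'I_d -> 'I_m.+1}) : (\sum_k nu k <= m)%N ->
    mult p m (fun nu' => (nu' == complete_counts nu)%:R) * G (complete_counts nu) <=
    Ex U (fun u => (expR \o f) (yvec m e star (cell_point (fun k => (nu k : nat)%:R) u)) *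
      resid_pdf m%:R 1 q 0 (cell_point (fun k => (nu k : nat)%:R) u)).
  move=> hs; have sn := complete_counts_support hs; set n := complete_counts nu in sn *.
  have [M0 _] := ln_mult_pmf sn.
  set M := mult _ _ _ in M0 *.
  have -> : M * G n = Ex U (fun u => M * (1 + f (Y n u) - (b n +
      (\sum_k X (e k) n * clip (u k) - X star n * \sum_k clip (u k))))).
    have b1 k : bmf (fun u : rvec R d => X (e k) n * clip (u k)) by exact: bmfZ.
    have b2 : bmf (fun u : rvec R d => \sum_k X (e k) n * clip (u k)) by exact: bmf_sum.
    have b3 : bmf (fun u : rvec R d => \sum_k clip (u k)) by exact: bmf_sum.
    have b4 : bmf (fun u : rvec R d => X star n * \sum_k clip (u k)) by exact: bmfZ.
    have b5 := bmfB b2 b4.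
    have b6 := bmfD (bmf_cst (b n)) b5.
    have b7 := bmfD (bmf_cst 1) (bY n).
    rewrite (ExZ _ _ (bmfB b7 b6)) (ExB _ b7 b6) (ExD _ (bmf_cst 1) (bY n)) Ex_cst.
    rewrite (ExD _ (bmf_cst (b n)) b5) Ex_cst (ExB _ b2 b4) (ExZ _ _ b3) !Ex_sum//.
    rewrite /G; congr (_ * (_ - (_ + (_ - _)))); apply: eq_bigr => k _.
    by rewrite ExZ.
  have Yn u : yvec m e star (cell_point (fun k => (nu k : nat)%:R) u) = Y n u.
    rewrite /Y; congr (yvec _ _ _ (cell_point _ u)); apply/funext => k.
    by rewrite /n complete_e.
  have cn u : cell_point (fun k => (nu k : nat)%:R) u = cell_point (fun k => (n (e k))%:R) u.
    by congr (cell_point _ u); apply/funext => k; rewrite /n complete_e.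
  have bg : bmf (fun u : rvec R d => resid_pdf m%:R 1 q 0 (cell_point (fun k => (nu k : nat)%:R) u)).
    have bp := bmf_snd (0 : TR) (bmf_resid_pdf mR q0 qlt1).
    exact: (bmf_comp (measurable_cell_point (fun k => (nu k : nat)%:R)) bp).
  apply: le_Ex.
  - apply: bmfZ; apply: bmfB; first by apply: bmfD => //; exact: bmf_cst.
    apply: bmfD; first exact: bmf_cst.
    by apply: bmfB; [apply: bmf_sum => k _; exact: bmfZ|apply: bmfZ; exact: bmf_sum].
  - apply: bmfM => //; rewrite (_ : (fun u => _) = fun u => (expR \o f) (Y n u)); last first.
      by apply/funext => u; rewrite Yn.
    exact: (bmf_comp (mY n) (bmf_expR bf)).
  move=> u; rewrite Yn cn.
  have L := log_likelihood_ratio sn (u := u) erefl; rewrite -/M in L.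
  have [g0 _] := ln_resid_pdf mR (cell_point (fun k => (n (e k))%:R) u) q0 qlt1.
  set g := resid_pdf _ _ _ _ _ in g0 L *.
  (* Now e^x >= 1 + x bounds the contribution of a cell below by M times 1 + f minus the
     log-likelihood ratio ln (M / g). *)
  have -> : (expR \o f) (Y n u) * g = M * expR (f (Y n u) + ln g - ln M).
    rewrite /= !expRD expRN !lnK ?posrE//; field.
    by rewrite gt_eqF.
  apply: ler_wpM2l; first exact: ltW.
  have h := expR_ge1Dx (f (Y n u) + ln g - ln M); apply: le_trans h.
  move: L; rewrite /b /D /X /P.
  by move: (ln M) (ln g) (S _) (\sum_k _ * _) (_ * \sum_k _) => ? ? ? ? ?; lra.
have H2 : mult p m G <= Ex P1 (expR \o f).
  rewrite mult_complete_counts; apply: le_trans H; apply: ler_sum => nu _.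
  case: leqP => hs; first by rewrite mul1r; exact: term.
  by rewrite mul0r; apply: Ex_ge0 => u; rewrite mulr_ge0 ?expR_ge0// resid_pdf_ge0.
(* The noise is independent of the counts, so its linear terms are constants times centred counts
   and average to 0. *)
have cen a c : mult p m (fun n => X a n * c) = 0.
  transitivity (mult p m (fun n => c / P a * ((n a)%:R - m%:R * p a))).
    by apply: (eq_mult p0) => n _; rewrite /X /P; ring.
  by rewrite multZ (mult_bin p0 psum m a (fun k : nat => k%:R - m%:R * p a)) bin_mean mulr0.
have bdE : mult p m b <= (1 + (3 * d.+1%:R + d%:R + d%:R ^+ 2) / c0) / m%:R.
  have remE a : c0 <= p a -> mult p m (fun n => entropy_rem (P a) (n a)%:R) <= 3 / (m%:R * c0).
    move=> ca; rewrite (mult_bin p0 psum m a (fun k : nat => entropy_rem (P a) k%:R)).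
    apply: bin_entropy_rem => //; rewrite -psum (bigD1 a)//= lerDl.
    by apply: sumr_ge0.
  have : \sum_k mult p m (fun n => entropy_rem (P (e k)) (n (e k))%:R) <= d%:R * (3 / (m%:R * c0)).
    rewrite mulr_natl -[X in _ *+ X]card_ord -sumr_const.
    by apply: ler_sum => k _; exact: remE.
  have := remE _ starc0; rewrite /b /S /D; move: entropy_rem => Er h1 h2.
  rewrite !(multD, mult_cst psum, mult_sum p0 psum) -[d.+1%:R]natr1.
  have J0 : 0 < (m%:R * c0)^-1 by rewrite invr_gt0 mulr_gt0.
  have -> : (1 + (3 * (d%:R + 1) + d%:R + d%:R ^+ 2) / c0) / m%:R =
     m%:R^-1 + (3 * (d%:R + 1) + d%:R + d%:R ^+ 2) * (m%:R * c0)^-1.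
    by field; rewrite !gt_eqF.
  have -> : (d%:R + d%:R ^+ 2) / (2 * (m%:R * c0)) = (d%:R + d%:R ^+ 2) * (m%:R * c0)^-1 / 2.
    by field; rewrite !gt_eqF.
  have d0 : 0 <= (d%:R + d%:R ^+ 2) * (m%:R * c0)^-1.
    by rewrite mulr_ge0 ?addr_ge0 ?sqr_ge0 ?ler0n// ltW.
  move: h1 h2 d0; rewrite !mulrDl.
  move: (m%:R * c0)^-1 J0 (mult _ _ _) (\sum_k _) => J J0 A B.
  lra.
have EG : mult p m G = 1 + mult p m (fun n => Ex U (fun u => f (Y n u))) - mult p m b.
  have E (A B C E : {ffun 'I_r -> nat} -> R) : mult p m (fun n => 1 + A n - (B n + (C n - E n))) =
      1 + mult p m A - (mult p m B + (mult p m C - mult p m E)).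
    by rewrite !(multN, multD, mult_cst psum).
  rewrite /G E cen subr0 (mult_sum p0 psum).
  by rewrite [X in _ - (_ + X)]big1 ?addr0// => k _; exact: cen.
by rewrite EG in H2; move: H2 bdE; move: (mult p m b) (mult p m _) => B A; lra.
Qed.

End multinomial_normal.

(** * Smoothing counts, and recovering the outcomes from smoothed counts *)

Section finite_mixture.
Context {R : realType} {d : measure_display} {X : measurableType d} {n : nat}.
Variables (w : 'I_n.+1 -> R) (P : 'I_n.+1 -> probability X R).
Hypotheses (w0 : forall j, 0 <= w j) (w1 : \sum_j w j = 1).

Local Notation fmix_measure :=
  (msum (fun k => mscale (NngNum (w0 (inord k))) (P (inord k))) n.+1).

Let fmix_measureE A : fmix_measure A = (\sum_j (w j)%:E * P j A)%E.
Proof. by apply: eq_bigr => j _; rewrite /mscale /= inord_val. Qed.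

Let fmix_setT : fmix_measure setT = 1%E.
Proof.
rewrite fmix_measureE (eq_bigr (fun j => (w j)%:E)); last first.
  by move=> j _; rewrite probability_setT mule1.
by rewrite sumEFin w1.
Qed.

HB.instance Definition _ := @Measure_isProbability.Build _ _ R
  fmix_measure fmix_setT.

Definition fmix : probability X R := fmix_measure.

Lemma fmixE A : fmix A = (\sum_j (w j)%:E * P j A)%E.
Proof. exact: fmix_measureE. Qed.

Let Ex_fmix_ge0 (f : X -> R) : bmf f -> (forall x, 0 <= f x) ->
  Ex fmix f = \sum_j w j * Ex (P j) f.
Proof.
move=> bf f0; have [mf _] := bf.
have mEf : measurable_fun [set: X] (EFin \o f) by exact/measurable_EFinP.
apply: EFin_inj; rewrite EFin_Ex// ge0_integral_measure_sum//; last by move=> x _; rewrite lee_fin.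
rewrite -sumEFin; apply: eq_bigr => j _.
rewrite ge0_integral_mscale//=; last by move=> x _; rewrite lee_fin.
by rewrite inord_val EFinM EFin_Ex.
Qed.

Lemma Ex_fmix (f : X -> R) : bmf f -> Ex fmix f = \sum_j w j * Ex (P j) f.
Proof.
move=> bf; have [_ [M fM]] := bf.
have bM := bmfD bf (bmf_cst M).
have := Ex_fmix_ge0 bM; rewrite (ExD _ bf (bmf_cst M)) Ex_cst.
rewrite (eq_bigr (fun j => w j * Ex (P j) f + w j * M)); last first.
  by move=> j _; rewrite (ExD _ bf (bmf_cst M)) Ex_cst mulrDr.
rewrite big_split /= -mulr_suml w1 mul1r => h; apply: (addIr M); apply: h => x.
by have := fM x; rewrite ler_norml => /andP[]; lra.
Qed.

End finite_mixture.

Section reindexing.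
Context {R : realType} {d : measure_display} {T : measurableType d}.

Lemma measurable_reindex n k (g : 'I_k -> 'I_n) :
  measurable_fun setT (fun x : fin_prod (fun _ : 'I_n => T) => (fun i => x (g i)) : fin_prod (fun _ : 'I_k => T)).
Proof. by apply: measurable_fun_fin_prod => i; exact: measurable_coord. Qed.

Lemma product_law_reindex n k (g : 'I_k -> 'I_n) (mu : probability T R)
    (Q : probability (fin_prod (fun _ : 'I_n => T)) R) :
  injective g -> product_law (fun=> mu) Q ->
  product_law (fun=> mu) (push Q (measurable_reindex g)).
Proof.
move=> ginj hQ A mA; rewrite pushE.
pose B j : set T := if [pick i | g i == j] is Some i then A i else setT.
have Bg i : B (g i) = A i.
  by rewrite /B; case: pickP => [i' /eqP /ginj -> //|/(_ i)]; rewrite eqxx.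
have mB j : measurable (B j) by rewrite /B; case: pickP.
rewrite (_ : _ @^-1` _ = [set x : fin_prod (fun _ : 'I_n => T) | forall j, B j (x j)]); last first.
  apply/seteqP; split => x /= h => [j|i]; last by rewrite -Bg.
  by rewrite /B; case: pickP => // i /eqP <-.
rewrite (hQ B mB) (bigID (fun j => j \in codom g)) /= [X in (_ * X)%E]big1 ?mule1; last first.
  move=> j jg; rewrite /B; case: pickP => [i /eqP gi|_]; last exact: probability_setT.
  by rewrite -gi codom_f in jg.
rewrite -big_uniq /=; last by rewrite map_inj_uniq// enum_uniq.
by rewrite big_map big_enum /=; apply: eq_bigr => i _; rewrite Bg.
Qed.

Lemma Ex_reindex_perm n (s : {perm 'I_n}) (mu : probability T R)
    (Q : probability (fin_prod (fun _ : 'I_n => T)) R) (f : fin_prod (fun _ : 'I_n => T) -> R) :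
  product_law (fun=> mu) Q -> bmf f -> Ex Q (fun x => f (fun i => x (s i))) = Ex Q f.
Proof.
move=> hQ bf; rewrite -(Ex_push Q (measurable_reindex s) bf); apply: eq_measure_Ex.
exact: (product_law_unique (product_law_reindex (@perm_inj _ s) hQ) hQ).
Qed.

End reindexing.

Lemma le_Ex_as {R : realType} {d : measure_display} {X : measurableType d}
  (P : probability X R) (A : set X) (f g : X -> R) :
  measurable A -> P A = 1%E -> bmf f -> bmf g -> (forall x, A x -> f x <= g x) ->
  Ex P f <= Ex P g.
Proof.
move=> mA PA bf bg fg; have [_ [M fM]] := bf; have [_ [N gN]] := bg.
have PAc : fine (P (~` A)) = 0 by rewrite probability_setC// PA subee.
rewrite -[leRHS]addr0 -(mulr0 (M + N)) -PAc; apply: Ex_event_le => // x.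
by have := fM x; have := gN x; rewrite !ler_norml => /andP[? ?] /andP[? ?]; lra.
Qed.

Section count_maps.
Context {R : realType}.
Local Notation TR := (measurableTypeR R).
Variables (r m kappa : nat) (t : 'I_r -> R).
Hypotheses (m0 : (0 < m)%N) (rk : (r <= kappa)%N) (tinj : injective t).
Implicit Types (nu : {ffun 'I_r -> nat}).

Let mR : 0 < m%:R :> R. Proof. by rewrite ltr0n. Qed.

(** The first positive count is found from the data alone; a cell chosen from the probabilities
    would make the randomization depend on rho. *)
Definition is_pivot nu (a : 'I_r) : bool :=
  (nu a != 0%N) && [forall b : 'I_r, (b < a)%N ==> (nu b == 0%N)].

Lemma pivot_unique nu a b : is_pivot nu a -> is_pivot nu b -> a = b.
Proof.
move=> /andP[na /forallP ha] /andP[nb /forallP hb]; apply/val_inj.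
case: (ltngtP (a : nat) (b : nat)) => // ab.
  by have := hb a; rewrite ab /= (negbTE na).
by have := ha b; rewrite ab /= (negbTE nb).
Qed.

Definition nonpivot nu (a : 'I_r) : bool := (nu a != 0%N) && ~~ is_pivot nu a.

Definition noise (u : rvec R kappa) (a : 'I_r) : R := clip (u (widen_ord rk a)).

(* A smoothed frequency vector: uniform noise is added to every positive count
   except the first one, which is adjusted so that the entries sum to 1. *)
Definition smooth_counts nu (u : rvec R kappa) : rvec R r := fun a =>
  if nu a == 0%N then 0
  else if is_pivot nu a then 1 - \sum_(b | nonpivot nu b) ((nu b)%:R + noise u b) / m%:R
  else ((nu a)%:R + noise u a) / m%:R.

Definition smooth (z : rvec R m * rvec R kappa) : rvec R r :=
  smooth_counts (counts t z.1) z.2.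

Lemma measurable_noise a : measurable_fun setT (fun u : rvec R kappa => noise u a : TR).
Proof.
apply: (measurableT_comp (f := clip : TR -> TR) measurable_clip).
exact: measurable_coord.
Qed.

Lemma measurable_smooth_counts nu a :
  measurable_fun setT (fun u => smooth_counts nu u a : TR).
Proof.
have mc b : measurable_fun setT (fun u : rvec R kappa => ((nu b)%:R + noise u b) / m%:R : TR).
  apply: measurable_funM; last exact: measurable_cst.
  by apply: measurable_funD; [exact: measurable_cst|exact: measurable_noise].
rewrite /smooth_counts; case: (nu a == 0%N); first exact: measurable_cst.
case: (is_pivot nu a) => //.
apply: measurable_funB; first exact: measurable_cst.
rewrite (_ : (fun u => _) = fun u => \sum_b (if nonpivot nu b then ((nu b)%:R + noise u b) / m%:R else 0)).
  by apply: measurable_sum => b; case: (nonpivot nu b); [exact: mc|exact: measurable_cst].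
by apply/funext => u; exact: big_mkcond.
Qed.

Lemma measurable_smooth : measurable_fun setT smooth.
Proof.
apply: measurable_fun_fin_prod => a.
rewrite (_ : (fun z => _) = fun z : rvec R m * rvec R kappa => \sum_(nu : {ffun 'I_r -> 'I_m.+1})
   \1_[set x | counts t x = widen_counts nu] z.1 * smooth_counts (widen_counts nu) z.2 a); last first.
  apply/funext => z; rewrite /smooth -(@sum_widen_counts _ _ m.+1 (counts t z.1) (fun n => smooth_counts n z.2 a)).
    apply: eq_bigr => nu _; rewrite indicE; congr (_%:R * _).
    by congr nat_of_bool; apply/eqP/idP; rewrite inE.
  by move=> b; rewrite ltnS counts_le.
apply: measurable_sum => nu; apply: measurable_funM.
  have mS : measurable [set x : rvec R m | counts t x = widen_counts nu] by exact: measurable_counts.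
  have [h _] := bmf_indic (R := R) mS.
  exact: (measurableT_comp h measurable_fst).
exact: (measurableT_comp (measurable_smooth_counts (widen_counts nu) a) measurable_snd).
Qed.

(** Values of one smoothed entry that are compatible with the counts: zero marks an empty cell, an
    interval fixes the count, and of the pivot only nonvanishing is recorded. *)
Definition count_cell nu (a : 'I_r) : set TR :=
  if nu a == 0%N then [set 0]
  else if is_pivot nu a then ~` [set 0]
  else `[(nu a)%:R / m%:R, ((nu a)%:R + 1) / m%:R[%classic.

Lemma measurable_count_cell nu a : measurable (count_cell nu a).
Proof.
rewrite /count_cell; case: ifP => _; first exact: measurable_set1.
case: ifP => _; last exact: measurable_itv.
by apply: measurableC; exact: measurable_set1.
Qed.

Definition count_box nu : set (rvec R r) := [set y | forall a, count_cell nu a (y a)].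

Lemma measurable_count_box nu : measurable (count_box nu).
Proof. by apply: (@measurable_box _ _ (fun=> TR)) => a; exact: measurable_count_cell. Qed.

Lemma count_cell0 nu a y : count_cell nu a y -> (y == 0) = (nu a == 0%N).
Proof.
rewrite /count_cell; case: ifP => na; first by move=> /= ->; rewrite eqxx.
case: ifP => pa /=; first by move/eqP/negbTE.
rewrite in_itv /= => /andP[h _]; apply/negbTE; rewrite gt_eqF//.
by apply: lt_le_trans h; rewrite divr_gt0// ltr0n lt0n na.
Qed.

(** The zero pattern determines the pivot, the intervals determine the other counts, and the common
    total determines the count of the pivot. *)
Lemma count_box_inj nu nu' y : (\sum_a nu a = \sum_a nu' a)%N ->
  count_box nu y -> count_box nu' y -> nu = nu'.
Proof.
move=> snu hy hy'.
have z a : (nu a == 0%N) = (nu' a == 0%N) by rewrite -(count_cell0 (hy a)) (count_cell0 (hy' a)).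
have pv a : is_pivot nu a = is_pivot nu' a.
  by rewrite /is_pivot z; congr (_ && _); apply: eq_forallb => b; rewrite z.
have np a : ~~ is_pivot nu a -> nu a = nu' a.
  move=> pa; have [na|na] := eqVneq (nu a) 0%N.
    by rewrite na; apply/esym/eqP; rewrite -z na.
  have := hy a; have := hy' a; rewrite /count_cell -z -pv (negbTE na) (negbTE pa) /= !in_itv /=.
  move=> /andP[h1 h2] /andP[h3 h4].
  have := le_lt_trans h1 h4; have := le_lt_trans h3 h2.
  rewrite !ltr_pM2r ?invr_gt0// !natr1 !ltr_nat !ltnS => l1 l2.
  by apply/eqP; rewrite eqn_leq l1 l2.
apply/ffunP => a; have [pa|/np//] := boolP (is_pivot nu a).
have : (\sum_(b | b != a) nu b = \sum_(b | b != a) nu' b)%N.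
  apply: eq_bigr => b ba; apply: np; apply: contraNN ba => pb.
  by rewrite (pivot_unique pa pb).
by move: snu; rewrite (bigD1 a)//= [in RHS](bigD1 a)//= => /[swap] -> /addIn.
Qed.

(** The adjusted entry is the pivot count minus the total noise, over m; each noise is below 1, so
    this condition keeps it positive. *)
Definition stable_counts nu := [forall a, is_pivot nu a ==> (#|[pred b | nonpivot nu b]| < nu a)%N].

Lemma smooth_counts_box nu u : (\sum_a nu a = m)%N -> stable_counts nu ->
  count_box nu (smooth_counts nu u).
Proof.
move=> snu /forallP st a; rewrite /count_cell /smooth_counts.
case: ifP => // na; case: ifP => pa; last first.
  rewrite /= in_itv /=; have /andP[c0 c1] := clip01 (u (widen_ord rk a)).
  by rewrite ler_pM2r ?invr_gt0// ltr_pM2r ?invr_gt0// lerDl c0 ltrD2l c1.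
move=> /= h; have := st a; rewrite pa /= => st_a.
have E : \sum_(b | nonpivot nu b) (nu b)%:R + (nu a)%:R = m%:R :> R.
  rewrite -snu natr_sum [RHS](bigD1 a)//= addrC; congr (_ + _).
  rewrite [RHS]big_mkcond [LHS]big_mkcond; apply: eq_bigr => b _; rewrite /nonpivot.
  have [->|ba] := eqVneq b a; first by rewrite pa andbF.
  have -> : is_pivot nu b = false by apply: contraNF ba => pb; rewrite (pivot_unique pa pb).
  by rewrite andbT; case: eqVneq => [->|].
have N : \sum_(b | nonpivot nu b) noise u b <= #|[pred b | nonpivot nu b]|%:R.
  rewrite -sumr_const; apply: ler_sum => b _.
  by have /andP[_ /ltW] := clip01 (u (widen_ord rk b)).
move: h => /eqP; rewrite -mulr_suml subr_eq0 eq_sym => /eqP.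
move/(congr1 ( *%R^~ m%:R)); rewrite /= mulfVK ?gt_eqF// mul1r big_split /= -[in RHS]E.
move=> /addrI h; move: N; rewrite h ler_nat leqNgt st_a.
by [].
Qed.

(** Any sequence of eigenvalues with these counts serves, because it is shuffled afterwards. *)
Definition canonical_sequence nu : rvec R m :=
  xget (fun=> 0) [set x : rvec R m | counts t x = nu /\ forall i, atoms t (x i)].

Lemma counts_perm (x y : rvec R m) : counts t x = counts t y ->
  (forall i, atoms t (x i)) -> (forall i, atoms t (y i)) ->
  exists s : {perm 'I_m}, forall i, x i = y (s i).
Proof.
move=> cxy ax ay.
have pe : perm_eq [tuple (x i : R) | i < m] [tuple (y i : R) | i < m].
  apply/allP => z _ /=.
  have E (v : rvec R m) : count_mem z [tuple (v i : R) | i < m] = (\sum_(i < m) (v i == z))%N.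
    rewrite /= count_map -sum1_count big_mkcond big_enum /=; apply: eq_bigr => i _.
    by case: (_ == _).
  apply/eqP; rewrite !E; have [[a ->]|na] := pselect (atoms t z).
    by have := congr1 (fun f : {ffun _ -> _} => f a) cxy; rewrite !ffunE.
  rewrite !big1// => i _; apply/eqP; rewrite eqb0; apply/eqP => h; apply: na; rewrite -h.
    exact: ay.
  exact: ax.
have /tuple_permP[s hs] := pe; exists s => i.
have := congr1 (fun l => nth (x i) l i) hs.
by rewrite -!tnth_nth !tnth_mktuple.
Qed.

End count_maps.

Section shuffling.
Context {R : realType} (m : nat).

(** Permutations are coded by natural numbers, on which every function is measurable; codes beyond
    the enumeration give the identity and are not charged by [shuffle_law]. *)
Definition nth_perm (k : nat) : {perm 'I_m} := nth (perm_one 'I_m) (enum {perm 'I_m}) k.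

Let K := #|{perm 'I_m}|.-1.

Let KE : K.+1 = #|{perm 'I_m}|.
Proof. by rewrite prednK//; apply/card_gt0P; exists (perm_one 'I_m). Qed.

Let w (_ : 'I_K.+1) : R := K.+1%:R^-1.
Let w0 j : 0 <= w j. Proof. by rewrite invr_ge0. Qed.
Let w1 : \sum_j w j = 1.
Proof. by rewrite /w sumr_const card_ord -[LHS]mulr_natl divff// pnatr_eq0. Qed.

Definition shuffle_law : probability nat R :=
  fmix (fun j : 'I_K.+1 => (\d_(j : nat) : probability nat R)) w0 w1.

Lemma bmf_nth_perm (f : {perm 'I_m} -> R) : bmf (fun k : nat => f (nth_perm k)).
Proof.
split=> //; exists (\sum_s `|f s|) => k.
by rewrite (bigD1 (nth_perm k))//= lerDl sumr_ge0.
Qed.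

Lemma Ex_shuffle (f : {perm 'I_m} -> R) :
  Ex shuffle_law (fun k => f (nth_perm k)) = #|{perm 'I_m}|%:R^-1 * \sum_s f s.
Proof.
rewrite Ex_fmix; last exact: bmf_nth_perm.
rewrite -mulr_sumr -KE; congr (_ * _).
transitivity (\sum_(j < K.+1) f (nth_perm j)).
  apply: eq_bigr => j _; apply: EFin_inj; rewrite EFin_Ex; last exact: bmf_nth_perm.
  by rewrite integral_dirac// diracT mul1e.
by rewrite -[RHS]big_enum /= (big_nth (perm_one 'I_m)) big_mkord -cardE -KE.
Qed.

End shuffling.

Section round_trip.
Context {R : realType}.
Local Notation TR := (measurableTypeR R).
Variables (r m kappa : nat) (t : 'I_r -> R).
Hypotheses (m0 : (0 < m)%N) (rk : (r <= kappa)%N) (tinj : injective t).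

(** At most one summand is nonzero, by [count_box_inj]; writing the decoding as a sum makes its
    measurability immediate. *)
Definition unsmooth (z : rvec R r * nat) : rvec R m := fun i =>
  \sum_(nu : {ffun 'I_r -> 'I_m.+1} | (\sum_a nu a == m)%N)
    \1_(count_box m (widen_counts nu)) z.1 *
    canonical_sequence t (widen_counts nu) (nth_perm m z.2 i).

Lemma measurable_unsmooth : measurable_fun setT unsmooth.
Proof.
apply: measurable_fun_fin_prod => i.
rewrite (_ : (fun z => _) = fun z : rvec R r * nat => \sum_(nu : {ffun 'I_r -> 'I_m.+1})
    (if (\sum_a nu a == m)%N then \1_(count_box m (widen_counts nu)) z.1 *
      canonical_sequence t (widen_counts nu) (nth_perm m z.2 i) else 0)); last first.
  by apply/funext => z; exact: big_mkcond.
apply: measurable_sum => nu; case: (_ == _); last exact: measurable_cst.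
apply: measurable_funM.
  have mS : measurable (count_box m (widen_counts nu) : set (rvec R r)) by exact: measurable_count_box.
  have [h _] := bmf_indic (R := R) mS.
  exact: (measurableT_comp h measurable_fst).
have h : measurable_fun setT (fun k : nat => canonical_sequence t (widen_counts nu) (nth_perm m k i) : TR) by [].
exact: (measurableT_comp h measurable_snd).
Qed.

Lemma unsmoothE (nu : {ffun 'I_r -> nat}) y k : (\sum_a nu a = m)%N -> count_box m nu y ->
  unsmooth (y, k) = fun i => canonical_sequence t nu (nth_perm m k i).
Proof.
move=> snu hy; apply/funext => i; rewrite /unsmooth /=.
have nm a : (nu a < m.+1)%N by rewrite ltnS -snu (bigD1 a)//= leq_addr.
pose nu0 : {ffun 'I_r -> 'I_m.+1} := [ffun a => Ordinal (nm a)].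
have E : widen_counts nu0 = nu by apply/ffunP => a; rewrite !ffunE.
have s0 : (\sum_a nu0 a)%N = m by rewrite -[RHS]snu; apply: eq_bigr => a _; rewrite ffunE.
rewrite (bigD1 nu0) /=; last by rewrite s0.
rewrite E indicE mem_set// mul1r big1 ?addr0// => nu' /andP[/eqP s' n'].
rewrite indicE memNset ?mul0r// => hy'; case/eqP: n'.
have h : (\sum_a widen_counts nu' a = m)%N.
  by rewrite -[RHS]s'; apply: eq_bigr => a _; rewrite ffunE.
have := count_box_inj m0 (etrans h (esym snu)) hy' hy; rewrite -E => e.
apply/ffunP => a; apply/val_inj => /=.
by have := congr1 (fun f : {ffun _ -> _} => f a) e; rewrite !ffunE.
Qed.

Variables (w : 'I_r -> R) (mu : probability TR R).
Hypotheses (w0 : forall a, 0 <= w a) (w1 : \sum_a w a = 1)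
  (muw : forall a, mu [set t a] = (w a)%:E).
Variables (P2 : probability (rvec R m) R) (U : probability (rvec R kappa) R).
Hypothesis hP2 : product_law (fun=> mu) P2.

Lemma sum_counts (x : rvec R m) : (forall i, atoms t (x i)) -> (\sum_a counts t x a = m)%N.
Proof.
move=> ax; rewrite (eq_bigr (fun a => \sum_(i < m) (x i == t a))%N); last first.
  by move=> a _; rewrite ffunE.
rewrite exchange_big /= -[RHS](card_ord m) -sum1_card; apply: eq_bigr => i _.
have [a ->] := ax i; rewrite (bigD1 a)//= eqxx big1// => b ba.
by rewrite (inj_eq tinj) eq_sym (negbTE ba).
Qed.

(* An i.i.d. sequence is exchangeable, so a uniform permutation of any fixed
   sequence with the right counts has the conditional law given the counts. *)
Lemma round_trip_tv :
  tv (mult w m (fun nu => (~~ stable_counts nu)%R%:R))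
    (push (pprod (push (pprod P2 U) (@measurable_smooth R r m kappa t rk)) (shuffle_law m))
       measurable_unsmooth) P2.
Proof.
apply: tv_one_sided => f mf f01; have bf : bmf f := bmf_itv mf f01.
pose mphi := @measurable_smooth R r m kappa t rk; pose mpsi := measurable_unsmooth.
have b1 : bmf (fun z => f (unsmooth z)) := bmf_comp mpsi bf.
rewrite (Ex_push _ mpsi bf) (Ex_prod _ _ b1).
have b2 : bmf (fun y => Ex (shuffle_law m) (fun k => f (unsmooth (y, k)))) := bmf_Ex_snd _ b1.
rewrite (Ex_push _ mphi b2).
have b3 : bmf (fun z : rvec R m * rvec R kappa =>
    Ex (shuffle_law m) (fun k => f (unsmooth (smooth t rk z, k)))) := bmf_comp mphi b2.
rewrite (Ex_prod _ _ b3).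
pose c : R := #|{perm 'I_m}|%:R^-1.
(* The average of f over rearrangements of x: it has the mean of f by exchangeability, and for
   stable counts it is exactly the conditional mean of f after the round trip. *)
pose A (x : rvec R m) : R := c * \sum_(s : {perm 'I_m}) f (fun i => x (s i)).
have bs (s : {perm 'I_m}) : bmf (fun x : rvec R m => f (fun i => x (s i))).
  exact: (bmf_comp (measurable_reindex s) bf).
have bsum : bmf (fun x : rvec R m => \sum_(s : {perm 'I_m}) f (fun i => x (s i))) by exact: bmf_sum.
have bA : bmf A by exact: bmfZ.
have EA : Ex P2 A = Ex P2 f.
  rewrite (ExZ _ _ bsum) Ex_sum// (eq_bigr (fun=> Ex P2 f)); last first.
    by move=> s _; exact: (Ex_reindex_perm s hP2 bf).
  rewrite sumr_const -[X in _ * X]mulr_natl mulrA mulVf ?mul1r// pnatr_eq0 -lt0n.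
  by apply/card_gt0P; exists (perm_one 'I_m).
have bb : bmf (fun x : rvec R m => (~~ stable_counts (counts t x))%R%:R : R).
  exact: (bmf_counts t m (fun nu => (~~ stable_counts nu)%R%:R)).
rewrite -EA -(Ex_counts w1 tinj muw (fun nu => (~~ stable_counts nu)%R%:R) hP2) -(ExD _ bA bb).
have A0 x : 0 <= A x.
  rewrite mulr_ge0 ?invr_ge0// sumr_ge0// => s _.
  by have /andP[] := f01 (fun i => x (s i)).
have mat : measurable [set x : rvec R m | forall i, atoms t (x i)].
  by apply: (@measurable_box _ _ (fun=> TR) (fun=> atoms t)) => i; exact: measurable_atoms.
apply: (le_Ex_as mat (coords_in_atoms_as w1 tinj muw hP2)).
- exact: bmf_Ex_snd b3.
- exact: bmfD.
move=> x ax; have [st|st] /= := boolP (stable_counts (counts t x)); last first.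
  apply: (@le_trans _ _ 1); last by rewrite lerDr.
  apply: Ex_le; first exact: bmf_snd b3.
  move=> u; apply: Ex_le; first exact: bmf_snd b1.
  by move=> k; have /andP[] := f01 (unsmooth (smooth t rk (x, u), k)).
rewrite addr0; apply: Ex_le; first exact: bmf_snd b3.
move=> u; have sx := sum_counts ax.
have hbox : count_box m (counts t x) (smooth t rk (x, u)) by exact: smooth_counts_box.
have [c1 c2] : counts t (@canonical_sequence R r m t (counts t x)) = counts t x /\
    forall i, atoms t (@canonical_sequence R r m t (counts t x) i).
  rewrite /canonical_sequence; case: xgetP => [y -> //|/(_ x)]; by case.
(* The chosen sequence is x rearranged by s; composing with s merely permutes the sum over all
   permutations. *)
have [s hs] := counts_perm c1 c2 ax.
rewrite (@eq_Ex _ _ _ _ _ (fun k => (fun q : {perm 'I_m} => f (fun i => x (s (q i)))) (nth_perm m k))).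
  rewrite (@Ex_shuffle R m (fun q => f (fun i => x (s (q i))))) /A le_eqVlt; apply/orP; left; apply/eqP.
  congr (_ * _); rewrite [RHS](reindex_inj (mulIg s)) /=; apply: eq_bigr => q _.
  by congr f; apply/funext => i; rewrite permM.
move=> k; rewrite (unsmoothE k sx hbox); congr f; apply/funext => i; exact: hs.
Qed.

End round_trip.

(** * Both comparisons for a single observable *)

Section one_observation.
Context {R : realType}.
Local Notation TR := (measurableTypeR R).
Variables (r m kappa : nat) (t p : 'I_r -> R).
Hypotheses (m0 : (0 < m)%N) (rk : (r <= kappa)%N) (tinj : injective t).
Hypotheses (p0 : forall a, 0 <= p a) (psum : \sum_a p a = 1).
Variable c0 : R.
Hypotheses (c00 : 0 < c0) (c01 : c0 <= 1) (pc0 : forall a, 0 < p a < 1 -> c0 <= p a).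
Variables (mu : probability TR R) (P1 : probability (rvec R r) R)
  (P2 : probability (rvec R m) R) (U : probability (rvec R kappa) R).
Hypotheses (muw : forall a, mu [set t a] = (p a)%:E) (hP2 : product_law (fun=> mu) P2)
  (hU : product_law (fun=> uniform01) U).
Hypothesis HP1 : forall (t : 'I_r -> R) (A : set TR), measurable A ->
  P1 [set y : rvec R r | A (\sum_a t a * (y a - p a))] = normal_law 0 (mvar m p t) A.

Let mR : 0 < m%:R :> R. Proof. by rewrite ltr0n. Qed.

Let p_le1 a : p a <= 1.
Proof. by rewrite -psum (bigD1 a)//= lerDl sumr_ge0. Qed.

Let pos_ge a : 0 < p a -> c0 <= p a.
Proof.
move=> pa; have := p_le1 a; rewrite le_eqVlt => /predU1P[->//|p1].
by apply: pc0; rewrite pa.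
Qed.

(** At most kappa outcomes; each has a count of at most kappa with probability at most (kappa + 1) /
    (m c0). *)
Let K2 : R := kappa%:R * kappa.+1%:R / c0.

(** The threshold is kappa because at most kappa cells receive noise, so that counts above it are
    stable. *)
Definition large_counts (nu : {ffun 'I_r -> nat}) := [forall a, (0 < p a) ==> (kappa < nu a)%N].

(* Markov's inequality for 1 / (N + 1), N a binomial count. *)
Lemma large_counts_prob : mult p m (fun nu => (~~ large_counts nu)%R%:R) <= K2 / m%:R.
Proof.
apply: (@le_trans _ _ (mult p m (fun nu => \sum_(a | 0 < p a) kappa.+1%:R * (nu a).+1%:R^-1))).
  apply: (le_mult p0) => nu _; have [h|] := boolP (large_counts nu).
    by apply: sumr_ge0 => a _; rewrite mulr_ge0// invr_ge0.
  rewrite negb_forall => /existsP[a]; rewrite negb_imply => /andP[pa]; rewrite -leqNgt => na.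
  rewrite (bigD1 a)//= -[leLHS]addr0 lerD//; last first.
    by apply: sumr_ge0 => b _; rewrite mulr_ge0// invr_ge0.
  by rewrite ler_pdivlMr ?ltr0n// mul1r ler_nat.
rewrite (mult_sum p0 psum).
apply: (@le_trans _ _ (\sum_(a | 0 < p a) kappa.+1%:R / (m%:R * c0))).
  apply: ler_sum => a pa; rewrite multZ; apply: ler_wpM2l => //.
  rewrite (mult_bin p0 psum m a (fun k : nat => k.+1%:R^-1)).
  have q01 : 0 <= p a <= 1 by rewrite p0 p_le1.
  have b := bin_inv m q01; have mp : 0 < m%:R * p a by rewrite mulr_gt0.
  apply: (@le_trans _ _ (m%:R * p a)^-1); first by rewrite -[leRHS]mul1r ler_pdivlMr.
  by rewrite lef_pV2 ?posrE ?mulr_gt0// ler_wpM2l ?pos_ge// ltW.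
rewrite sumr_const -[leLHS]mulr_natl.
have -> : K2 / m%:R = kappa%:R * (kappa.+1%:R / (m%:R * c0)) by rewrite /K2; field; rewrite !gt_eqF.
apply: ler_wpM2r; first by rewrite divr_ge0// mulr_ge0// ltW.
by rewrite ler_nat (leq_trans _ rk)// -[leqRHS]card_ord; exact: max_card.
Qed.

Lemma large_counts_stable nu : mult_support p m nu -> large_counts nu -> stable_counts nu.
Proof.
move=> [_ s2] /forallP lg; apply/forallP => a; apply/implyP => /andP[na _].
have pa : 0 < p a by rewrite lt_neqAle p0 andbT eq_sym; apply: contraNN na => /eqP /s2 ->.
have := lg a; rewrite pa /=; apply: leq_ltn_trans; apply: leq_trans rk.
by rewrite -[leqRHS]card_ord; exact: max_card.
Qed.

Let I : {set 'I_r} := [set a : 'I_r | 0 < p a < 1]%SET.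
Let nd := (2 <= #|I|)%N.

(** A probability strictly between 0 and 1 leaves mass for a second such outcome, so fewer than two
    of them means none. *)
Let deterministic : ~~ nd -> exists a, p a = 1 /\ forall b, b != a -> p b = 0.
Proof.
move=> hnd.
have [a pa] : exists a, 0 < p a.
  apply: contrapT => h; have := psum; rewrite big1 => [/esym/eqP|a _]; first by rewrite oner_eq0.
  apply/eqP; rewrite eq_le p0 andbT leNgt; apply/negP => pa; apply: h; by exists a.
have pe : p a = 1.
  apply: contrapT => /eqP p1; have lt1 : p a < 1 by rewrite lt_neqAle p1 p_le1.
  have [b [ba pb]] : exists b, b != a /\ 0 < p b.
    apply: contrapT => h; have := psum; rewrite (bigD1 a)//= big1 ?addr0.
      by move=> e; rewrite e ltxx in lt1.
    move=> b ba; apply/eqP; rewrite eq_le p0 andbT leNgt; apply/negP => pb.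
    by apply: h; exists b.
  case/negP: hnd; rewrite /nd (cardsD1 a) (cardsD1 b) !inE pa lt1 ba pb /=.
  suff -> : p b < 1 by [].
  by rewrite -psum (bigD1 a)//= (bigD1 b)//= addrA ltr_wpDr ?sumr_ge0// ltrDr.
exists a; split=> // b ba; apply/eqP; rewrite eq_le p0 andbT.
by have := psum; rewrite (bigD1 a)//= (bigD1 b)//= pe => /eqP;
  rewrite -subr_eq0 [1 + _]addrC addrK => /eqP h;
  have : 0 <= \sum_(i | (i != a) && (i != b)) p i by [apply: sumr_ge0]; lra.
Qed.

Let deterministic_counts a nu : p a = 1 -> (forall b, b != a -> p b = 0) ->
  mult_support p m nu -> nu a = m /\ forall b, b != a -> nu b = 0%N.
Proof.
move=> pa pb [s1 s2]; have z b : b != a -> nu b = 0%N by move/pb/s2.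
by split=> //; rewrite -s1 (bigD1 a)//= big1 ?addn0.
Qed.

Lemma observation_round_trip :
  tv ((nd%R%:R : R) * (K2 / m%:R))
    (push (pprod (push (pprod P2 U) (@measurable_smooth R r m kappa t rk)) (shuffle_law m))
       (@measurable_unsmooth R r m t)) P2.
Proof.
have h := round_trip_tv m0 rk tinj psum muw U hP2.
refine (tv_le _ h).
have [_|/deterministic[a [pa pb]]] := boolP nd; rewrite /= ?mul1r ?mul0r.
  apply: le_trans large_counts_prob; apply: (le_mult p0) => nu sn.
  by have [/(large_counts_stable sn) ->|] //= := boolP (large_counts nu); case: (stable_counts nu).
(* When one outcome is certain, its cell is the pivot and no other cell is positive: no noise is
   added and the counts are always stable. *)
rewrite -(mult_cst psum m 0); apply: (le_mult p0) => nu sn.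
have [na nb] := deterministic_counts pa pb sn.
suff -> : stable_counts nu by [].
apply/forallP => b; apply/implyP => pvb; have [ba|ba] := eqVneq b a; last first.
  by move: pvb; rewrite /is_pivot nb.
rewrite ba na (_ : #|_| = 0%N)//; apply: eq_card0 => c; rewrite inE /nonpivot.
have [->|ca] := eqVneq c a; last by rewrite nb.
by rewrite -ba pvb andbF.
Qed.

Lemma Ex_smooth (f : rvec R r -> R) : bmf f ->
  Ex (push (pprod P2 U) (@measurable_smooth R r m kappa t rk)) f =
  mult p m (fun nu => Ex U (fun u => f (smooth_counts m rk nu u))).
Proof.
move=> bf; have b := bmf_comp (@measurable_smooth R r m kappa t rk) bf.
rewrite (Ex_push _ _ bf) (Ex_prod _ _ b).
exact: (Ex_counts psum tinj muw (fun nu => Ex U (fun u => f (smooth_counts m rk nu u)))).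
Qed.

Section nondegenerate.
Hypothesis pge : forall a, 0 < p a -> c0 <= p a.

(** For large counts the pivot is [star] and the smoothed vector is the one of [multinomial_normal].
    Otherwise two values of f differ by at most 2, which adds twice the bound of
    [large_counts_prob]. *)
Lemma observation_dvar_nondegenerate :
  dvar ((1 + (3 * kappa.+1%:R + kappa%:R + kappa%:R ^+ 2) / c0 + 2 * K2) / m%:R)
    (push (pprod P2 U) (@measurable_smooth R r m kappa t rk)) P1.
Proof.
apply: ln_dvar => f mf f1; have bf : bmf f := bmf_itv mf f1.
rewrite Ex_smooth//.
have [star0 pstar0] : exists a, 0 < p a.
  apply: contrapT => h; have := psum; rewrite big1 => [/esym/eqP|a _]; first by rewrite oner_eq0.
  by apply/eqP; rewrite eq_le p0 andbT leNgt; apply/negP => pa; apply: h; exists a.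
(* The eliminated outcome is the first one of positive probability, so as to coincide with the
   pivot. *)
case: (@arg_minnP _ star0 (fun a => 0 < p a) (fun a => a : nat)) => // star ps smin.
pose A := [pred a | (0 < p a) && (a != star)].
pose e (k : 'I_#|A|) : 'I_r := enum_val k.
have einj : injective e by exact: enum_val_inj.
have eA k : A (e k) by have := enum_valP k; rewrite inE.
have estar k : e k != star by have /andP[] := eA k.
have epos k : 0 < p (e k) by have /andP[] := eA k.
have esupp a : p a = 0 \/ a = star \/ exists k, a = e k.
  have [pa|pa] := eqVneq (p a) 0; first by left.
  have [as'|as'] := eqVneq a star; first by right; left.
  right; right; have aA : a \in A by rewrite inE as' andbT lt_neqAle eq_sym pa p0.
  by exists (enum_rank_in aA a); rewrite /e enum_rankK_in.
(* The noise vector has kappa entries whatever the observable; those attached to the outcomes [e k]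
   are again independent uniforms. *)
pose g k := widen_ord rk (e k).
have ginj : injective g.
  by move=> i j /(congr1 val) /= /val_inj; exact: einj.
have hU' := product_law_reindex ginj hU.
pose Y (n : {ffun 'I_r -> nat}) (u : rvec R #|A|) := yvec m e star (cell_point (fun k => (n (e k))%:R) u).
have mY n : measurable_fun setT (Y n).
  exact: (measurableT_comp (measurable_yvec m e star) (measurable_cell_point _)).
have bY n : bmf (fun u => f (Y n u)) := bmf_comp (mY n) bf.
have smoothE nu u : mult_support p m nu -> large_counts nu ->
    smooth_counts m rk nu u = Y nu (fun k => u (g k)).
  move=> [s1 s2] /forallP lg; apply/funext => a; rewrite /smooth_counts /Y /yvec.
  have nup b : (nu b == 0%N) = (p b == 0).
    apply/idP/eqP => [nb|/s2 ->//]; apply/eqP; rewrite eq_le p0 andbT leNgt; apply/negP => pb.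
    by have := lg b; rewrite pb (eqP nb).
  have pvE b : is_pivot nu b = (b == star).
    have pvs : is_pivot nu star.
      rewrite /is_pivot nup gt_eqF//=; apply/forallP => c; apply/implyP => cs.
      rewrite nup eq_le p0 andbT leNgt; apply: contraTN cs => /smin; by rewrite leqNgt.
    by apply/idP/eqP => [pb|->//]; exact: pivot_unique pvs.
  have cellE k : cell_point (fun k => (nu (e k))%:R) (fun k => u (g k)) k = (nu (e k))%:R + noise rk u (e k) :> R by [].
  rewrite pvE nup; have [as'|as'] := eqVneq a star.
    rewrite as' gt_eqF//; congr (1 - _).
    have nA b : nonpivot nu b = (b \in A).
      by rewrite /nonpivot nup pvE unfold_in /= lt_neqAle p0 andbT [0 == _]eq_sym.
    by rewrite (eq_bigl _ _ nA) big_enum_val.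
  have [pa|pa] := eqVneq (p a) 0.
    by rewrite big1// => k /eqP ek; have := epos k; rewrite ek pa ltxx.
  have [h|[h|[k ->]]] := esupp a.
  - by rewrite h eqxx in pa.
  - by rewrite h eqxx in as'.
  by rewrite (big_pred1 k)// => j; rewrite (inj_eq einj).
have bsm nu : bmf (fun u => f (smooth_counts m rk nu u)).
  have ms : measurable_fun setT (fun u : rvec R kappa => smooth_counts m rk nu u).
    by apply: measurable_fun_fin_prod => a; exact: measurable_smooth_counts.
  exact: (bmf_comp ms bf).
have := multinomial_normal m0 p0 psum HP1 einj estar esupp c00 (fun k => pge (epos k)) (pge ps) hU' mf f1.
set B := _ / m%:R => H.
apply: (@le_trans _ _ (mult p m (fun nu => Ex (push U (measurable_reindex g)) (fun u => f (Y nu u)) +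
    2 * (~~ large_counts nu)%R%:R) + 1)).
  rewrite lerD2r; apply: (le_mult p0) => nu sn.
  rewrite (Ex_push _ _ (bY nu)).
  have bYg := bmf_comp (measurable_reindex g) (bY nu).
  have [lg|lg] /= := boolP (large_counts nu).
    by rewrite mulr0 addr0 le_eqVlt; apply/orP; left; apply/eqP/eq_Ex => u; rewrite smoothE.
  rewrite mulr1 -[2](Ex_cst U) -(ExD _ bYg (bmf_cst 2)).
  apply: le_Ex => //; first exact: (bmfD bYg (bmf_cst 2)).
  move=> u; have /andP[_ h1] := f1 (smooth_counts m rk nu u).
  by have /andP[h2 _] := f1 (Y nu (fun k => u (g k))); rewrite /=; lra.
rewrite multD multZ.
have := large_counts_prob; set L := mult _ _ _ => hL.
have dk : #|A|%:R <= kappa%:R :> R.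
  by rewrite ler_nat (leq_trans _ rk)// -[leqRHS]card_ord; exact: max_card.
have hB : B <= (1 + (3 * kappa.+1%:R + kappa%:R + kappa%:R ^+ 2) / c0) / m%:R.
  rewrite /B ler_pM2r ?invr_gt0// lerD2l ler_pM2r ?invr_gt0// lerD ?lerD//.
    by rewrite ler_pM2l// ler_nat ltnS -(ler_nat R).
  by rewrite ler_pXn2r// nnegrE.
have -> : (1 + (3 * kappa.+1%:R + kappa%:R + kappa%:R ^+ 2) / c0 + 2 * K2) / m%:R =
   (1 + (3 * kappa.+1%:R + kappa%:R + kappa%:R ^+ 2) / c0) / m%:R + 2 * (K2 / m%:R) by ring.
move: H hB hL; rewrite /Y; lra.
Qed.

End nondegenerate.

Lemma observation_dvar :
  dvar ((nd%R%:R : R) * ((1 + (3 * kappa.+1%:R + kappa%:R + kappa%:R ^+ 2) / c0 + 2 * K2) / m%:R))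
    (push (pprod P2 U) (@measurable_smooth R r m kappa t rk)) P1.
Proof.
have [_|/deterministic[a [pa pb]]] := boolP nd; rewrite /= ?mul1r ?mul0r.
  exact: observation_dvar_nondegenerate.
apply: ln_dvar => f mf f1; have bf : bmf f := bmf_itv mf f1.
rewrite Ex_smooth// addr0; pose y : rvec R r := fun b => (b == a)%R%:R.
have -> : Ex P1 (expR \o f) = expR (f y).
  have [mS PS] := reg_support_as HP1 psum.
  rewrite -[RHS](Ex_cst P1); apply: (eq_Ex_as mS PS) => //.
  - exact: bmf_expR.
  - exact: bmf_cst.
  move=> z [z0 z1] /=; congr (expR (f _)); apply/funext => b; rewrite /y.
  have [->|ba] := eqVneq b a; last by rewrite z0// pb.
  by move: z1; rewrite (bigD1 a)//= big1 ?addr0// => c ca; rewrite z0// pb.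
apply: (@le_trans _ _ (f y + 1)); last by rewrite addrC expR_ge1Dx.
rewrite lerD2r -[leRHS](mult_cst psum m); apply: (le_mult p0) => nu sn.
have [na nb] := deterministic_counts pa pb sn.
rewrite -[leRHS](Ex_cst U) le_eqVlt; apply/orP; left; apply/eqP/eq_Ex => u; congr f.
apply/funext => b; rewrite /smooth_counts /y; have [->|ba] := eqVneq b a; last by rewrite nb.
have pva : is_pivot nu a.
  by rewrite /is_pivot na -lt0n m0; apply/forallP => c; apply/implyP => ca; rewrite nb// neq_ltn ca.
rewrite na gtn_eqF// pva big1 ?subr0// => c; rewrite /nonpivot; have [->|ca] := eqVneq c a.
  by rewrite pva andbF.
by rewrite nb.
Qed.

End one_observation.

(** * The trace regression and tomography experiments *)

Section spectral_projections.
Local Open Scope complex_scope.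
Local Open Scope sesquilinear_scope.
Context {R : realType}.
Local Notation C := R[i].

Lemma hermsymmxE n (A : 'M[C]_n) : A \is hermsymmx -> A^t* = A.
Proof. by move=> /is_hermitianmxP; rewrite expr0 scale1r => <-. Qed.

(** The rows of the diagonalizing matrix form a basis of eigenvectors; each is fixed by the
    projection of its eigenvalue and annihilated by the others, so the sum fixes the basis. *)
Lemma sum_spectral_projections n r (B : 'M[C]_n) (lam : 'I_r -> R) (Q : 'I_r -> 'M[C]_n) :
  B \is hermsymmx -> spectral_decomposition B lam Q -> \sum_a Q a = 1%:M.
Proof.
move=> hB [inj ev proj _].
have QB a : Q a *m B = (lam a)%:C *: Q a.
  have [_ _ /andP[h _]] := proj a; exact/eigenspaceP.
have BQ a : B *m Q a = (lam a)%:C *: Q a.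
  have [hQ _ _] := proj a.
  have := congr1 (fun X : 'M[C]_n => X^t*) (QB a).
  rewrite trmx_mul map_mxM (hermsymmxE hB) (hermsymmxE hQ) => ->.
  rewrite linearZ /= map_mxZ /= (hermsymmxE hQ); congr (_ *: _).
  by rewrite conj_Creal// complex_real.
have QQ a b : a != b -> Q a *m Q b = 0.
  move=> ab; have : (lam a)%:C *: (Q a *m Q b) = (lam b)%:C *: (Q a *m Q b).
    by rewrite scalemxAl -QB -mulmxA BQ scalemxAr.
  move/eqP; rewrite -subr_eq0 -scalerBl scaler_eq0 => /orP[|/eqP//].
  by rewrite subr_eq0 => /eqP /complexI /inj /eqP; rewrite (negbTE ab).
have /hermitian_normalmx /orthomx_spectralP := hB.
set P := spectralmx B; set D := spectral_diag B => BE.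
have Pu : P \in unitmx by exact: spectral_unit.
have PB : P *m B = diag_mx D *m P.
  rewrite -[RHS](mulKVmx Pu); congr (_ *m _); rewrite BE.
  by rewrite -mulmxA.
suff PQ : P *m \sum_a Q a = P by rewrite -(mulKmx Pu (\sum_a Q a)) PQ mulVmx.
apply/row_matrixP => i; rewrite row_mul.
have rB : row i P *m B = D 0 i *: row i P.
  by rewrite -row_mul PB mul_diag_mx; apply/rowP => k; rewrite !mxE.
have r0 : row i P != 0.
  apply/eqP => h; have : row i (P *m invmx P) = 0 by rewrite row_mul h mul0mx.
  rewrite mulmxV// => /rowP /(_ i); rewrite !mxE eqxx => /eqP.
  by rewrite oner_eq0.
have [a Da] : exists a, D 0 i = (lam a)%:C.
  by apply/ev/eigenvalueP; exists (row i P).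
have rQ : row i P *m Q a = row i P.
  have [_ idem /andP[_ h]] := proj a.
  have /submxP[W ->] : (row i P <= Q a)%MS.
    by apply: submx_trans h; apply/eigenspaceP; rewrite rB Da.
  by rewrite -mulmxA idem.
rewrite mulmx_sumr (bigD1 a)//= rQ big1 ?addr0// => b ba.
by rewrite -rQ -mulmxA QQ ?mulmx0// eq_sym.
Qed.

End spectral_projections.

Section outcome_probability.
Local Open Scope sesquilinear_scope.
Context {R : realType} {p : nat} (S : setting R p).

Lemma sum_oprob j rho : states S rho -> \sum_(a < nev S j) oprob a rho = 1.
Proof.
move=> /(@states_density _ _ S)[_ _ tr1].
have -> : \sum_(a < nev S j) oprob a rho = complex.Re (\tr ((\sum_(a < nev S j) @eproj R p S j a) *m rho)).
  rewrite mulmx_suml (raddf_sum (@mxtrace _ _)) (raddf_sum (@complex.Re R)).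
  by apply: eq_bigr.
by rewrite (sum_spectral_projections (obs_herm S j) (obs_spectral S j)) mul1mx tr1.
Qed.

(** For an idempotent Q the trace equals that of Q rho Q, whose diagonal entries are values of the
    form of rho at the rows of Q. *)
Lemma oprob_ge0 j (a : 'I_(nev S j)) rho : states S rho -> 0 <= oprob a rho.
Proof.
move=> /(@states_density _ _ S)[_ pos _].
have [_ _ /(_ a)[hQ idem _] _] := obs_spectral S j.
suff : 0 <= \tr (eproj a *m rho) by rewrite lecE => /andP[].
rewrite -idem -mulmxA mxtrace_mulC -mulmxA; apply: sumr_ge0 => i _.
have := pos (row i (eproj a)).
have -> : (row i (eproj a))^t* = col i (eproj a).
  by rewrite -[in RHS](hermsymmxE hQ); apply/matrixP => x y; rewrite !mxE.
have -> : row i (eproj a) *m rho *m col i (eproj a) = row i (col i (eproj a *m rho *m eproj a)).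
  rewrite -row_mul; apply/matrixP => x y; rewrite !mxE; apply: eq_bigr => k _.
  by rewrite !mxE.
by rewrite mulmxA; move: (_ *m _ *m _) => M; rewrite !mxE.
Qed.

End outcome_probability.

(** * Mixtures over the observable drawn in the random design *)

Section tagged_mixtures.
Context {R : realType} {d : measure_display} {q : nat} {T : 'I_q.+1 -> measurableType d}.

Lemma tag_in_inj (j : 'I_q.+1) : injective (@tag_in _ _ T j).
Proof.
move=> x y h.
exact: (@Eqdep_dec.inj_pair2_eq_dec _ (fun a b => pselect (a = b)) (fun i => T i : Type) j x y h).
Qed.

Lemma tagged_measurableP (A : set (tagged_space T)) :
  (forall i, measurable (@tag_in _ _ T i @^-1` A)) -> measurable A.
Proof. by []. Qed.

Lemma measurable_tag_in j : measurable_fun setT (@tag_in _ _ T j).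
Proof. by apply: measurableT_fun => A mA; exact: mA. Qed.

Lemma tag_in_preimage_image i j (B : set (T j)) :
  measurable B -> measurable (@tag_in _ _ T i @^-1` (@tag_in _ _ T j @` B)).
Proof.
move=> mB; have [e|ij] := eqVneq i j.
  subst i; rewrite (_ : _ @^-1` _ = B)//; apply/seteqP; split => x /=.
    by move=> [y By /tag_in_inj <-].
  by move=> Bx; exists x.
rewrite (_ : _ @^-1` _ = set0)//; apply/seteqP; split => x //= [y _ h].
by have := congr1 (@projT1 _ _) h => /= e; rewrite e eqxx in ij.
Qed.

Lemma measurable_tag_image j (B : set (T j)) :
  measurable B -> measurable (@tag_in _ _ T j @` B).
Proof. by move=> mB; apply: tagged_measurableP => i; exact: tag_in_preimage_image. Qed.

(** A total left inverse of [tag_in], with the default [point] on the other tags; being measurable,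
    it reduces maps that depend on the tag to a fixed tag. *)
Definition untag (j : 'I_q.+1) (z : tagged_space T) : T j :=
  match eqVneq (projT1 z) j with
  | EqNotNeq e => eq_rect _ (fun i => T i : Type) (projT2 z) _ e
  | _ => point
  end.

Lemma untagK j x : untag j (tag_in x) = x.
Proof.
rewrite /untag /=; case: eqVneq => [e|/eqP//].
by rewrite (eq_axiomK e).
Qed.

Lemma measurable_untag j : measurable_fun setT (untag j).
Proof.
apply: measurableT_fun => A mA; apply: tagged_measurableP => i; have [e|ij] := eqVneq i j.
  subst i; rewrite (_ : _ @^-1` _ = A)//.
  by apply/seteqP; split => x /=; rewrite untagK.
have E x : untag j (@tag_in _ _ T i x) = point.
  by rewrite /untag /=; case: eqVneq => // e; rewrite e eqxx in ij.
have [hp|hp] := pselect (A point).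
  by rewrite (_ : _ @^-1` _ = setT)//; apply/seteqP; split => x //= _; rewrite E.
by rewrite (_ : _ @^-1` _ = set0)//; apply/seteqP; split => x //=; rewrite E.
Qed.

Definition mixes (w : 'I_q.+1 -> R) (P : forall j, probability (T j) R)
    (M : probability (tagged_space T) R) : Prop :=
  forall f, bmf f -> Ex M f = \sum_j w j * Ex (P j) (fun x => f (tag_in x)).

Lemma mixture_mixes w P M : mixture_law w P M -> (forall j, 0 <= w j) -> \sum_j w j = 1 ->
  mixes w P M.
Proof.
move=> hM w0 w1 f bf.
have E A : measurable A -> M A = fmix (fun j => push (P j) (@measurable_tag_in j)) w0 w1 A.
  move=> mA; rewrite fmixE probE//.
  pose B j : set (T j) := @tag_in _ _ T j @^-1` A.
  have mB j : measurable (B j) by exact: mA.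
  have mtB j : measurable (@tag_in _ _ T j @` B j) by exact: measurable_tag_image.
  rewrite (@eq_Ex _ _ _ _ _ (fun z => \sum_j \1_(@tag_in _ _ T j @` B j) z)); last first.
    move=> [i x]; rewrite (bigD1 i)//= big1 ?addr0; last first.
      move=> j ji; rewrite indicE memNset// => -[y _ h].
      by have := congr1 (@projT1 _ _) h => /= e; rewrite e eqxx in ji.
    rewrite !indicE; congr (_%:R); congr nat_of_bool; apply/idP/idP; rewrite !inE.
      by move=> Ax; exists x.
    by move=> [y By <-].
  rewrite Ex_sum; last by move=> j _; exact: bmf_indic.
  rewrite -sumEFin; apply: eq_bigr => j _; rewrite -probE// hM//.
rewrite (eq_measure_Ex _ E) Ex_fmix//; apply: eq_bigr => j _.
by rewrite Ex_push.
Qed.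

Lemma mixes_exists w P : (forall j, 0 <= w j) -> \sum_j w j = 1 -> exists M, mixes w P M.
Proof.
move=> w0 w1; exists (fmix (fun j => push (P j) (@measurable_tag_in j)) w0 w1) => f bf.
by rewrite Ex_fmix//; apply: eq_bigr => j _; rewrite Ex_push.
Qed.

(** The inequality defining [dvar] is linear in both laws, so the inequalities for the separate tags
    are simply averaged. *)
Lemma mixes_dvar w (P Q : forall j, probability (T j) R) M N (e : 'I_q.+1 -> R) :
  (forall j, 0 <= w j) -> \sum_j w j = 1 -> mixes w P M -> mixes w Q N ->
  (forall j, dvar (e j) (P j) (Q j)) -> dvar (\sum_j w j * e j) M N.
Proof.
move=> w0 w1 hM hN h c f mf fc; have bf : bmf f := bmf_itv mf fc.
rewrite hM// hN; last exact: bmf_expR.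
rewrite -[X in _ + X]w1 -!big_split /=; apply: ler_sum => j _.
rewrite -[X in _ + X]mulr1 -!mulrDr ler_wpM2l//.
apply: (h j c) => //; exact: (measurableT_comp mf (@measurable_tag_in j)).
Qed.

Lemma mixes_tv w (P Q : forall j, probability (T j) R) M N (e : 'I_q.+1 -> R) :
  (forall j, 0 <= w j) -> mixes w P M -> mixes w Q N ->
  (forall j, tv (e j) (P j) (Q j)) -> tv (\sum_j w j * e j) M N.
Proof.
move=> w0 hM hN h f mf f01; have bf : bmf f := bmf_itv mf f01.
rewrite hM// hN// -sumrB; apply: le_trans (ler_norm_sum _ _ _) _; apply: ler_sum => j _.
rewrite -mulrBr normrM ger0_norm// ler_wpM2l//.
apply: (h j) => //; exact: (measurableT_comp mf (@measurable_tag_in j)).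
Qed.

(** A test function with values in [0, 1] loses at most the sum of |v j - w j| = v j |1 - w j / v
    j|, and the v j sum to 1. *)
Lemma mixes_tv_weights v w (P : forall j, probability (T j) R) M N :
  (forall j, 0 < v j) -> \sum_j v j = 1 -> mixes v P M -> mixes w P N ->
  tv (gamma w v) M N.
Proof.
move=> v0 v1 hM hN f mf f01; have bf : bmf f := bmf_itv mf f01.
rewrite hM// hN// -sumrB; apply: le_trans (ler_norm_sum _ _ _) _.
rewrite -[leRHS]mul1r -v1 mulr_suml; apply: ler_sum => j _.
rewrite -mulrBl normrM.
have bj := bmf_comp (@measurable_tag_in j) bf.
have a01 : 0 <= Ex (P j) (fun x => f (tag_in x)) <= 1.
  apply/andP; split; first by apply: Ex_ge0 => x; have /andP[] := f01 (tag_in x).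
  by apply: Ex_le => // x; have /andP[] := f01 (tag_in x).
have /andP[a0 a1] := a01; rewrite [X in _ * X]ger0_norm//.
apply: (@le_trans _ _ (`|v j - w j|)); first by rewrite ler_piMr.
have -> : v j - w j = v j * (1 - w j / v j) by field; rewrite gt_eqF.
rewrite normrM gtr0_norm//; apply: ler_wpM2l; first exact: ltW.
apply: (@le_trans _ _ (`|1 - w j / v j| + `|1 - v j / w j|)); first by rewrite lerDl.
rewrite /gamma; exact: (le_bigmax _ (fun j => `|1 - w j / v j| + `|1 - v j / w j|)).
Qed.

End tagged_mixtures.

Section tagged_maps.
Context {R : realType} {d d' dO : measure_display} {q : nat}
  {T : 'I_q.+1 -> measurableType d} {T' : 'I_q.+1 -> measurableType d'}
  {O : measurableType dO}.
Variable phi : forall j, T j * O -> T' j.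
Hypothesis mphi : forall j, measurable_fun setT (@phi j).

Definition tagwise (z : tagged_space T * O) : tagged_space T' :=
  tag_in (phi (projT2 z.1, z.2)).

Lemma measurable_tagwise : measurable_fun setT tagwise.
Proof.
apply: measurableT_fun => A mA.
pose B j : set (T j * O) := @phi j @^-1` (@tag_in _ _ T' j @^-1` A).
have mB j : measurable (B j) by rewrite -[B j]setTI; apply: mphi => //; exact: mA.
have mu j : measurable_fun setT (fun z : tagged_space T * O => (untag j z.1, z.2)).
  apply: measurable_fun_pair; last exact: measurable_snd.
  exact: (measurableT_comp (@measurable_untag _ _ T j) measurable_fst).
rewrite (_ : _ @^-1` A = \bigcup_(j in [set: 'I_q.+1])
    (fst @^-1` (@tag_in _ _ T j @` setT) `&` (fun z : tagged_space T * O => (untag j z.1, z.2)) @^-1` B j)).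
  apply: fin_bigcup_measurable => // j _; apply: measurableI.
    by rewrite -[X in measurable X]setTI; apply: measurable_fst => //; exact: measurable_tag_image.
  by rewrite -[X in measurable X]setTI; apply: mu => //; exact: mB.
apply/seteqP; split => [[[j x] o]|[z o]] /=.
  move=> h; exists j => //; split; first by exists x.
  by rewrite /B /=; have := untagK (T := T) (j := j) x; rewrite /tag_in => ->.
by move=> [j _ [[y _ /= <-]]]; rewrite /B /= untagK.
Qed.

Lemma mixes_tagwise (w : 'I_q.+1 -> R) (P : forall j, probability (T j) R)
    (M : probability (tagged_space T) R) (W : probability O R) :
  mixes w P M ->
  mixes w (fun j => push (pprod (P j) W) (@mphi j)) (push (pprod M W) measurable_tagwise).
Proof.
move=> hM f bf; have b1 := bmf_comp measurable_tagwise bf.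
rewrite (Ex_push _ _ bf) (Ex_prod _ _ b1) hM; last exact: bmf_Ex_snd b1.
apply: eq_bigr => j _; congr (_ * _).
have b2 : bmf (fun y : T' j => f (tag_in y)) := bmf_comp (@measurable_tag_in _ _ T' j) bf.
have b3 := bmf_comp (@mphi j) b2.
by rewrite (Ex_push _ _ b2) (Ex_prod _ _ b3).
Qed.

End tagged_maps.

(** * Deficiency bounds for the two designs *)

Section deficiency_of_the_designs.
Context {R : realType}.
Local Notation TR := (measurableTypeR R).

Lemma deficiency_le1 {param : Type} (Theta : set param) {d1 d2 : measure_display}
    {X1 : measurableType d1} {X2 : measurableType d2}
    (Q1 : param -> probability X1 R) (Q2 : param -> probability X2 R) :
  (deficiency Theta Q1 Q2 <= 1%:E)%E.
Proof.
pose phi (_ : X1 * nat) : X2 := point.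
have mphi : measurable_fun setT phi by exact: measurable_cst.
apply: (@deficiency_le _ _ _ _ _ _ _ _ _ _ _ (\d_(0%N : nat) : probability nat R) phi mphi).
by move=> rho _; exact: tv1.
Qed.

(** If x <= 1 then x <= sqrt x; if x > 1 the summand 1 of the constant makes the right side exceed
    1. *)
Lemma Delta_le_sqrt {param : Type} (Theta : set param) {d1 d2 : measure_display}
    {X1 : measurableType d1} {X2 : measurableType d2}
    (Q1 : param -> probability X1 R) (Q2 : param -> probability X2 R) (g x C1 C2 : R) :
  0 <= g -> 0 <= x -> 0 <= C1 -> 0 <= C2 ->
  (Delta Theta Q1 Q2 <= (g + 3 * Num.sqrt (C1 * x) + C2 * x)%:E)%E ->
  (Delta Theta Q1 Q2 <= (g + (3 * Num.sqrt C1 + C2 + 1) * Num.sqrt x)%:E)%E.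
Proof.
move=> g0 x0 C10 C20 h; have s0 := sqrtr_ge0 x; have s1 := sqrtr_ge0 C1.
have [x1|x1] := leP x 1.
  apply: le_trans h _; rewrite lee_fin sqrtrM//.
  have hx : x <= Num.sqrt x.
    rewrite -{1}(sqr_sqrtr x0) expr2 ler_piMr// -[leRHS]sqrtr1 ler_sqrt//.
  have : C2 * x <= C2 * Num.sqrt x by rewrite ler_wpM2l.
  lra.
apply: (@le_trans _ _ 1%:E).
  by rewrite ge_max !deficiency_le1.
rewrite lee_fin; have hx : 1 <= Num.sqrt x by rewrite -[leLHS]sqrtr1 ler_sqrt// ltW.
have : 0 <= (3 * Num.sqrt C1 + C2) * Num.sqrt x by rewrite mulr_ge0// addr_ge0// mulr_ge0.
lra.
Qed.

Variables (kappa : nat) (c0 c1 : R).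
Hypotheses (c00 : 0 < c0) (c01 : c0 <= c1) (c11 : c1 < 1).

Definition trip_cst : R := kappa%:R * kappa.+1%:R / c0.

Definition smooth_cst : R :=
  1 + (3 * kappa.+1%:R + kappa%:R + kappa%:R ^+ 2) / c0 + 2 * trip_cst.

Lemma trip_cst_ge0 : 0 <= trip_cst.
Proof. by rewrite divr_ge0 ?mulr_ge0// ltW. Qed.

Lemma smooth_cst_ge0 : 0 <= smooth_cst.
Proof.
have i0 : 0 <= c0^-1 by rewrite invr_ge0 ltW.
by rewrite !addr_ge0 ?mulr_ge0 ?trip_cst_ge0.
Qed.

Lemma noise_exists : exists U : probability (rvec R kappa) R, product_law (fun=> uniform01) U.
Proof. exact: product_law_exists. Qed.

Section setting.
Variables (p m : nat) (S : setting R p).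
Hypotheses (m0 : (0 < m)%N) (hk : few_eigenvalues S kappa)
  (hc : bounded_probabilities S c0 c1).

Let mR : 0 < m%:R :> R. Proof. by rewrite ltr0n. Qed.

Lemma nondeg_ge0 (j : 'I_p) (rho : 'M[R[i]]_(hdim S)) : 0 <= nondeg j rho.
Proof. by rewrite /nondeg. Qed.

Lemma nondeg_le1 (j : 'I_p) (rho : 'M[R[i]]_(hdim S)) : nondeg j rho <= 1.
Proof. by rewrite /nondeg; case: (_ <= _)%N. Qed.

Lemma setting_observation (j : 'I_p) rho (P1 : probability (rvec R (nev S j)) R)
    (P2 : probability (rvec R m) R) (U : probability (rvec R kappa) R) :
  states S rho -> regression_law S m j rho P1 -> tomography_law S m j rho P2 ->
  product_law (fun=> uniform01) U ->
  dvar (nondeg j rho * (smooth_cst / m%:R))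
    (push (pprod P2 U) (@measurable_smooth R (nev S j) m kappa (@ev _ _ S j) (hk j))) P1 /\
  tv (nondeg j rho * (trip_cst / m%:R))
    (push (pprod (push (pprod P2 U) (@measurable_smooth R (nev S j) m kappa (@ev _ _ S j) (hk j)))
       (shuffle_law m)) (@measurable_unsmooth R (nev S j) m (@ev _ _ S j))) P2.
Proof.
move=> hrho h1 [mu [muw hP2]] hU.
have tinj : injective (@ev _ _ S j) by have [] := obs_spectral S j.
have p0 (a : 'I_(nev S j)) : 0 <= oprob a rho by exact: oprob_ge0.
have psum := sum_oprob j hrho.
have c0le1 : c0 <= 1 := le_trans c01 (ltW c11).
have pc0 (a : 'I_(nev S j)) : 0 < oprob a rho < 1 -> c0 <= oprob a rho.
  move=> ha; have aI : a \in Iset j rho by rewrite inE.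
  by have /andP[] := hc hrho aI.
split; last exact: (observation_round_trip m0 (hk j) tinj p0 psum c00 c0le1 pc0 U muw hP2).
apply: (observation_dvar m0 (hk j) tinj p0 psum c00 c0le1 pc0 muw hP2 hU) => t A mA.
have := h1 t A mA; rewrite /pushforward /preimage /= => ->.
rewrite big1 => [|a _]; last by rewrite mulr0.
congr (normal_law _ _ _); rewrite -(mvarE m (fun a => oprob a rho) t).
by apply: eq_bigr => a _; apply: eq_bigr => b _; rewrite mxE.
Qed.

(** The bound 1 makes the real supremum a genuine upper bound; for an empty class of states it is 0
    by convention. *)
Lemma sup_in_unit (F : 'M[R[i]]_(hdim S) -> R) :
  (forall rho, states S rho -> 0 <= F rho <= 1) ->
  0 <= sup [set F rho | rho in states S] /\
  forall rho, states S rho -> F rho <= sup [set F rho | rho in states S].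
Proof.
move=> F01; have ub rho : states S rho -> F rho <= sup [set F rho | rho in states S].
  move=> hrho; apply: ub_le_sup; last by exists rho.
  by exists 1 => _ [rho' h <-]; have /andP[] := F01 _ h.
split=> //; have [[rho hrho]|h] := pselect (exists rho, states S rho).
  by apply: le_trans (ub _ hrho); have /andP[] := F01 _ hrho.
rewrite (_ : [set _ | _ in _] = set0) ?sup0//.
by apply/seteqP; split => [y [rho hrho _]|y []]; case: h; exists rho.
Qed.

Lemma zeta_unif_sup : (0 < p)%N -> 0 <= zeta_unif S /\
  forall rho, states S rho -> p%:R^-1 * \sum_(j < p) nondeg j rho <= zeta_unif S.
Proof.
move=> p0; apply: sup_in_unit => rho _; apply/andP; split.
  by rewrite mulr_ge0 ?invr_ge0 ?sumr_ge0// => j _; exact: nondeg_ge0.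
rewrite mulrC ler_pdivrMr ?ltr0n// mul1r.
rewrite -[X in _ <= X%:R]card_ord -sum1_card natr_sum.
by apply: ler_sum => j _; exact: nondeg_le1.
Qed.

Lemma zeta_sup (Pi Xi : 'I_p -> R) :
  positive_distribution Pi -> positive_distribution Xi -> 0 <= zeta S Pi Xi /\
  forall rho, states S rho ->
    Num.max (\sum_(j < p) Pi j * nondeg j rho) (\sum_(j < p) Xi j * nondeg j rho) <= zeta S Pi Xi.
Proof.
have h (w : 'I_p -> R) (rho : 'M[R[i]]_(hdim S)) : positive_distribution w -> 0 <= \sum_(j < p) w j * nondeg j rho <= 1.
  move=> [w0 w1]; apply/andP; split.
    by apply: sumr_ge0 => j _; rewrite mulr_ge0 ?nondeg_ge0// ltW.
  rewrite -w1; apply: ler_sum => j _.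
  by rewrite ler_piMr ?nondeg_le1// ltW.
move=> hPi hXi; apply: sup_in_unit => rho _.
have /andP[a0 a1] := h _ rho hPi; have /andP[b0 b1] := h _ rho hXi.
by rewrite le_max a0 ge_max a1 b1.
Qed.

End setting.

Lemma fixed_design_bound (n m : nat) (S : setting R n)
    (Q1 : 'M[R[i]]_(hdim S) -> probability (fixed_regression_space S) R)
    (Q2 : 'M[R[i]]_(hdim S) -> probability (fixed_tomography_space R n m) R) :
  (0 < n)%N -> (0 < m)%N -> few_eigenvalues S kappa -> bounded_probabilities S c0 c1 ->
  (forall rho, states S rho -> fixed_regression S m rho (Q1 rho)) ->
  (forall rho, states S rho -> fixed_tomography S m rho (Q2 rho)) ->
  (Delta (states S) Q1 Q2 <=
    ((3 * Num.sqrt smooth_cst + trip_cst + 1) * Num.sqrt (n%:R * zeta_unif S / m%:R))%:E)%E.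
Proof.
move=> n0 m0 hk hc h1 h2; have [z0 zub] := zeta_unif_sup S n0.
have nR : 0 < n%:R :> R by rewrite ltr0n.
have mR : 0 < m%:R :> R by rewrite ltr0n.
have [U hU] := noise_exists.
set x := n%:R * zeta_unif S / m%:R.
have x0 : 0 <= x by rewrite divr_ge0 ?mulr_ge0// ltW.
rewrite -[X in X%:E]add0r; apply: Delta_le_sqrt => //; [exact: smooth_cst_ge0|exact: trip_cst_ge0|].
apply: (@Delta_transfer R _ _ _ _ _ _ n (fun _ : 'I_n => rvec R m) (fun k => rvec R (nev S k))
  (fun _ : 'I_n => rvec R kappa) (fun _ : 'I_n => nat)
  (fun k => smooth (@ev _ _ S k) (hk k)) (fun k => @unsmooth R (nev S k) m (@ev _ _ S k))
  (fun k => @measurable_smooth R (nev S k) m kappa (@ev _ _ S k) (hk k))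
  (fun k => @measurable_unsmooth R (nev S k) m (@ev _ _ S k))
  (fun=> U) (fun=> shuffle_law m) Q1 Q2).
- by rewrite mulr_ge0// smooth_cst_ge0.
- by rewrite mulr_ge0// trip_cst_ge0.
move=> rho hrho; have [P1 [hP1 pl1]] := h1 _ hrho; have [P2 [hP2 pl2]] := h2 _ hrho.
have obs k := setting_observation m0 hk hc hrho (hP1 k) (hP2 k) hU.
(* The two experiments share the design, so the intermediate law is the tomography law itself. *)
exists P1, P2, P2, (fun=> 0), (fun k => nondeg k rho * (smooth_cst / m%:R)),
  (fun k => nondeg k rho * (trip_cst / m%:R)); split.
  split=> // k; [exact: tv0|by have [] := obs k|by have [] := obs k].
have sum_le c : 0 <= c -> \sum_(k < n) nondeg k rho * (c / m%:R) <= c * x.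
  move=> cc; rewrite -mulr_suml.
  have -> : c * x = n%:R * zeta_unif S * (c / m%:R) by rewrite /x; ring.
  rewrite ler_wpM2r ?divr_ge0 ?(ltW mR)//.
  by have := zub _ hrho; rewrite mulrC ler_pdivrMr// mulrC.
by split; [rewrite big1|apply: sum_le; exact: smooth_cst_ge0|apply: sum_le; exact: trip_cst_ge0].
Qed.

Lemma random_design_bound (q m n : nat) (S : setting R q.+1) (Pi Xi : 'I_q.+1 -> R)
    (Q1 : 'M[R[i]]_(hdim S) -> probability (random_regression_space S n) R)
    (Q2 : 'M[R[i]]_(hdim S) -> probability (random_tomography_space R q m n) R) :
  (0 < m)%N -> few_eigenvalues S kappa -> bounded_probabilities S c0 c1 ->
  positive_distribution Pi -> positive_distribution Xi ->
  (forall rho, states S rho -> random_regression S m n Pi rho (Q1 rho)) ->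
  (forall rho, states S rho -> random_tomography S m n Xi rho (Q2 rho)) ->
  (Delta (states S) Q1 Q2 <= (n%:R * gamma Pi Xi +
    (3 * Num.sqrt smooth_cst + trip_cst + 1) * Num.sqrt (n%:R * zeta S Pi Xi / m%:R))%:E)%E.
Proof.
move=> m0 hk hc hPi hXi h1 h2; have [z0 zub] := zeta_sup S hPi hXi.
have mR : 0 < m%:R :> R by rewrite ltr0n.
have [U hU] := noise_exists.
set x := n%:R * zeta S Pi Xi / m%:R.
have x0 : 0 <= x by rewrite divr_ge0 ?mulr_ge0// ltW.
have g0 : 0 <= n%:R * gamma Pi Xi.
  by rewrite mulr_ge0// /gamma; apply: bigmax_ge_id.
apply: Delta_le_sqrt => //; [exact: smooth_cst_ge0|exact: trip_cst_ge0|].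
pose mphi := measurable_tagwise (fun j => @measurable_smooth R (nev S j) m kappa (@ev _ _ S j) (hk j)).
pose mpsi := measurable_tagwise (fun j => @measurable_unsmooth R (nev S j) m (@ev _ _ S j)).
apply: (@Delta_transfer R _ _ _ _ _ _ n
  (fun _ : 'I_n => tagged_space (fun _ : 'I_q.+1 => rvec R m))
  (fun _ : 'I_n => tagged_space (fun j : 'I_q.+1 => rvec R (nev S j)))
  (fun _ : 'I_n => rvec R kappa) (fun _ : 'I_n => nat)
  (fun=> tagwise (fun j => smooth (@ev _ _ S j) (hk j)))
  (fun=> tagwise (fun j => @unsmooth R (nev S j) m (@ev _ _ S j)))
  (fun=> mphi) (fun=> mpsi) (fun=> U) (fun=> shuffle_law m) Q1 Q2).
- by rewrite mulr_ge0// smooth_cst_ge0.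
- by rewrite mulr_ge0// trip_cst_ge0.
move=> rho hrho; have [P1 [M1 [hP1 hM1 pl1]]] := h1 _ hrho; have [P2 [M2 [hP2 hM2 pl2]]] := h2 _ hrho.
have obs j := setting_observation m0 hk hc hrho (hP1 j) (hP2 j) hU.
have [Pi0 Pi1] := hPi; have [Xi0 Xi1] := hXi.
have Pi0' j : 0 <= Pi j by exact: ltW.
have Xi0' j : 0 <= Xi j by exact: ltW.
have mix1 := mixture_mixes hM1 Pi0' Pi1; have mix2 := mixture_mixes hM2 Xi0' Xi1.
(* Tomography with observables drawn from Pi. Its entropy against regression averages with weights
   Pi, while the round trip starts from tomography proper and averages with Xi; [zeta] bounds
   both. *)
have [M3 mix3] := mixes_exists P2 Pi0' Pi1.
exists (fun=> M1), (fun=> M2), (fun=> M3), (fun=> gamma Pi Xi),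
  (fun=> \sum_j Pi j * (nondeg j rho * (smooth_cst / m%:R))),
  (fun=> \sum_j Xi j * (nondeg j rho * (trip_cst / m%:R))); split.
  split=> // k.
  - exact: (mixes_tv_weights Xi0 Xi1 mix2 mix3).
  - apply: (mixes_dvar Pi0' Pi1 (mixes_tagwise _ U mix3) mix1) => j.
    by have [] := obs j.
  - apply: (mixes_tv Xi0' (mixes_tagwise _ (shuffle_law m) (mixes_tagwise _ U mix2)) mix2) => j.
    by have [] := obs j.
have sum_le w c : 0 <= c -> \sum_j w j * nondeg j rho <= zeta S Pi Xi ->
    \sum_(k < n) \sum_j w j * (nondeg j rho * (c / m%:R)) <= c * x.
  move=> cc hw; rewrite sumr_const card_ord -[leLHS]mulr_natl.
  have -> : c * x = n%:R * (zeta S Pi Xi * (c / m%:R)) by rewrite /x; ring.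
  rewrite ler_wpM2l//; under eq_bigr do rewrite mulrA.
  by rewrite -mulr_suml ler_wpM2r// divr_ge0// ltW.
have := zub _ hrho; rewrite ge_max => /andP[zPi zXi].
split; first by rewrite sumr_const card_ord mulr_natl.
  by apply: sum_le => //; exact: smooth_cst_ge0.
by apply: sum_le => //; exact: trip_cst_ge0.
Qed.

Lemma zeta_uniform (q : nat) (S : setting R q.+1) (Pi Xi : 'I_q.+1 -> R) :
  (forall j, Pi j = q.+1%:R^-1) -> (forall j, Xi j = q.+1%:R^-1) ->
  zeta S Pi Xi = zeta_unif S /\ gamma Pi Xi = 0.
Proof.
move=> hPi hXi; split.
  have e (rho : 'M[R[i]]_(hdim S)) : Num.max (\sum_j Pi j * nondeg j rho) (\sum_j Xi j * nondeg j rho) =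
      q.+1%:R^-1 * \sum_j nondeg j rho.
    rewrite mulr_sumr -[RHS]maxxx; congr (Num.max _ _); apply: eq_bigr => j _.
      by rewrite hPi.
    by rewrite hXi.
  by congr sup; apply/seteqP; split => _ [rho hrho <-]; exists rho; rewrite ?e.
rewrite /gamma big1_idem//=; first by rewrite maxxx.
by move=> j _; rewrite hPi hXi divff ?subrr ?normr0 ?addr0// invr_eq0 pnatr_eq0.
Qed.

End deficiency_of_the_designs.

Theorem theorem2 (R : realType) (kappa : nat) (c0 c1 : R) :
  0 < c0 -> c0 <= c1 -> c1 < 1 ->
  exists C : R,
    (* (a) random design; the number of observables is p_n = (q n).+1 *)
    (forall (q m : nat -> nat)
        (S : forall n, setting R (q n).+1)
        (Pi Xi : forall n, 'I_(q n).+1 -> R)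
        (Q1 : forall n, 'M[R[i]]_(hdim (S n)) ->
                probability (random_regression_space (S n) n) R)
        (Q2 : forall n, 'M[R[i]]_(hdim (S n)) ->
                probability (random_tomography_space R (q n) (m n) n) R),
      (forall n, (0 < n)%N ->
         [/\ (0 < m n)%N,
             few_eigenvalues (S n) kappa,
             positive_distribution (Pi n),
             positive_distribution (Xi n) &
             bounded_probabilities (S n) c0 c1]) ->
      (forall n, (0 < n)%N ->
         [/\ forall rho, states (S n) rho ->
               random_regression (S n) (m n) n (Pi n) rho (Q1 n rho),
             forall rho, states (S n) rho ->
               random_tomography (S n) (m n) n (Xi n) rho (Q2 n rho),
             identifiable (states (S n)) (Q1 n) &
             identifiable (states (S n)) (Q2 n)]) ->
      (n%:R * gamma (Pi n) (Xi n) @[n --> \oo] --> (0 : R)) ->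
      forall n, (0 < n)%N ->
        (Delta (states (S n)) (Q1 n) (Q2 n) <=
          (n%:R * gamma (Pi n) (Xi n) +
           C * Num.sqrt (n%:R * zeta (S n) (Pi n) (Xi n) / (m n)%:R))%:E)%E /\
        ((forall j, Pi n j = (q n).+1%:R^-1) ->
         (forall j, Xi n j = (q n).+1%:R^-1) ->
         (Delta (states (S n)) (Q1 n) (Q2 n) <=
           (C * Num.sqrt (n%:R * zeta_unif (S n) / (m n)%:R))%:E)%E)) /\
    (* (b) fixed design *)
    (forall (n m : nat) (S : setting R n)
        (Q1 : 'M[R[i]]_(hdim S) -> probability (fixed_regression_space S) R)
        (Q2 : 'M[R[i]]_(hdim S) -> probability (fixed_tomography_space R n m) R),
      (0 < n)%N -> (0 < m)%N ->
      few_eigenvalues S kappa ->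
      bounded_probabilities S c0 c1 ->
      (forall rho, states S rho -> fixed_regression S m rho (Q1 rho)) ->
      (forall rho, states S rho -> fixed_tomography S m rho (Q2 rho)) ->
      identifiable (states S) Q1 ->
      identifiable (states S) Q2 ->
      (Delta (states S) Q1 Q2 <=
        (C * Num.sqrt (n%:R * zeta_unif S / m%:R))%:E)%E).
Proof.
(* The 3 comes from [dvar_tv], [smooth_cst] from the entropy, [trip_cst] from the round trip, and 1
   from the range where the bound is trivial. *)
move=> c00 c01 c11; exists (3 * Num.sqrt (smooth_cst kappa c0) + trip_cst kappa c0 + 1); split.
  move=> q m S Pi Xi Q1 Q2 hyp laws _ n n0.
  have [m0 hk hPi hXi hc] := hyp n n0; have [h1 h2 _ _] := laws n n0.
  have b := random_design_bound c00 c01 c11 m0 hk hc hPi hXi h1 h2.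
  split=> // uPi uXi; have [ez eg] := zeta_uniform (S n) uPi uXi.
  by move: b; rewrite ez eg mulr0 add0r.
move=> n m S Q1 Q2 n0 m0 hk hc h1 h2 _ _.
exact: (fixed_design_bound c00 c01 c11 n0 m0 hk hc h1 h2).
Qed.
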